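(* Let $H$ be a separable Hilbert space and $\mathcal A\subseteq\mathcal B(H)$ a $\mathrm{II}_1$-factor with tracial state $\tau$. The function $H_\tau:\mathcal S(\mathcal A)\ni\rho\mapsto H_\tau(\rho)\in[-\infty,0]$ is non-increasing under approximate convertibility by $\mathrm{LOCC}(\mathcal A)$, when restricted to states of the form $\rho_\psi$, with $\psi\in H$ a unit vector; that is, if $\psi,\varphi\in H$ are unit vectors and $\psi$ is approximately convertible to $\varphi$ via $\mathrm{LOCC}(\mathcal A)$, then $H_\tau(\rho_\psi)\ge H_\tau(\rho_\varphi)$.
   Context: Normal means weak*-continuous. Inner products are linear in the first argument. **Entropy.** $\mathcal S(\mathcal A)$ is the set of normal states of $\mathcal A$; a normal state is identified with its density operator $\rho\in L^1(\mathcal A,\tau)^+$ (the state being $a\mapsto\tau(\rho a)$), a positive $\tau$-measurable operator affiliated with $\mathcal A$. For a unit vector $\psi$, $\rho_\psi$ is the density of $\omega_\psi|_{\mathcal A}$, where $\omega_\psi(x)=(x\psi,\psi)$. For $t>0$, $\mu_t(\rho)=\inf\{\|\rho p\|:p\in\mathcal A\text{ a projection},\ \tau(1-p)\le t\}$. The entropy of $\rho$ relative to $\tau$ is $H_\tau(\rho)=-\int_0^1\mu_t(\rho)\log(\mu_t(\rho))\,dt$ (with $0\log 0=0$). **LOCC maps.** Let $\mathcal A\subseteq\mathcal B(H)$ be a von Neumann algebra and $\mathcal B=\mathcal A'$ its commutant. For a von Neumann subalgebra $\mathcal C\subseteq \mathcal B(H)$, $\mathrm{CP}^\sigma_{\mathcal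 C}(\mathcal B(H))$ is the set of normal completely positive maps $\Phi:\mathcal B(H)\to\mathcal B(H)$ with $\Phi(axb)=a\Phi(x)b$ for all $a,b\in\mathcal C$, $x\in\mathcal B(H)$; $\mathrm{UCP}^\sigma_{\mathcal C}(\mathcal B(H))$ is the subset of unital ones. - A *one-way right local map* relative to $\mathcal A$ is a map $\Phi\circ\Psi$ with $\Phi\in\mathrm{UCP}^\sigma_{\mathcal A}(\mathcal B(H))$ and $\Psi\in\mathrm{CP}^\sigma_{\mathcal B}(\mathcal B(H))$; a *one-way left local map* is a map $\Phi\circ\Psi$ with $\Phi\in\mathrm{CP}^\sigma_{\mathcal A}(\mathcal B(H))$ and $\Psi\in\mathrm{UCP}^\sigma_{\mathcal B}(\mathcal B(H))$. - An *instrument* is a collection $\mathcal I=(\Theta_k)_{k\in\mathbb N}$ of normal completely positive maps on $\mathcal B(H)$ such that $\sum_k\Theta_k(x)$ converges weak* to a limit $\Theta_{\mathcal I}(x)$ for every $x\in\mathcal B(H)$, and $\Theta_{\mathcal I}$ is a normal unital completely positive map. Instruments differing only by a bijective relabelling of the index set are identified. - A *one-way right (left) instrument* relative to $\mathcal A$ is an instrument all of whose maps are one-way right (left) local maps relative to $\mathcal A$; a *one-way (local) instrument* is one which is either a one-way right or a one-way left instrument. - An instrument $(\Gamma_j)_{j\in\mathbb N}$ is a *coarse-graining* of $(\Theta_k)_{k\in\mathbb N}$ if there is a partition $\mathbb N=\bigcup_j S_j$ with $\Gamma_j=\sum_{k\in S_j}\Theta_k$ (point-weak* convergent) for all $j$.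 - An instrument $\mathcal J$ is *linked* to $\mathcal I=(\Theta_k)_k$ if there are one-way instruments $(\Theta_{ki})_{i\in\mathbb N}$, $k\in\mathbb N$, relative to $\mathcal A$ such that $\mathcal J$ is a coarse-graining of $(\Theta_k\circ\Theta_{ki})_{i,k\in\mathbb N}$. - A normal unital completely positive map $\Theta$ on $\mathcal B(H)$ is in $\mathrm{LOCC}(\mathcal A)$ if there are instruments $\mathcal I_0,\dots,\mathcal I_n$ such that $\mathcal I_0$ is a one-way local instrument relative to $\mathcal A$, $\mathcal I_{l+1}$ is linked to $\mathcal I_l$ for $l=0,\dots,n-1$, and $\Theta=\Theta_{\mathcal I_n}$. **Convertibility.** For a normal map $\Theta$ on $\mathcal B(H)$, $\Theta_*$ is its predual, $\Theta_*(\omega)=\omega\circ\Theta$ for $\omega\in\mathcal B(H)_*$. A unit vector $\psi$ is *approximately convertible* to a unit vector $\varphi$ via $\mathrm{LOCC}(\mathcal A)$ if for every $\varepsilon>0$ there is $\Theta\in\mathrm{LOCC}(\mathcal A)$ with $\|\Theta_*(\omega_\psi)-\omega_\varphi\|<\varepsilon$. *)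

(* Defs.v *)
From HB Require Import structures.
From mathcomp Require Import all_boot all_order all_algebra.
From mathcomp Require Import finmap complex.
From mathcomp Require Import all_classical all_reals all_analysis.
From mathcomp Require Import summability.
Set Implicit Arguments.
Unset Strict Implicit.
Unset Printing Implicit Defensive.
Import Order.TTheory GRing.Theory Num.Theory.
Import numFieldNormedType.Exports.
Local Open Scope classical_set_scope.
Local Open Scope ring_scope.
Local Open Scope complex_scope.

HB.mixin Record CompleteNormedModule_isHilbert (R : realType) H
    of CompleteNormedModule R[i] H := {
  dot : H -> H -> R[i] ;
  dot_linearl : forall (c : R[i]) (x y z : H),
    dot (c *: x + y) z = c * dot x z + dot y z ;
  dotC : forall x y : H, dot y x = Num.conj (dot x y) ;
  dot_norm : forall x : H, dot x x = `|x| ^+ 2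
}.

#[short(type="hilbertType")]
HB.structure Definition Hilbert (R : realType) :=
  { H of CompleteNormedModule_isHilbert R H & CompleteNormedModule R[i] H }.

Section BoundedOperators.
Context {R : realType} (H : hilbertType R).

Definition bounded_op : {pred H -> H} :=
  fun f => `[< linear f /\ continuous f >].

Lemma bounded_op_submod : submod_closed bounded_op.
Proof.
split.
  apply/asboolP; split; last exact: cst_continuous.
  by move=> c x y; rewrite /= scaler0 addr0.
move=> c f g /asboolP[fl fc] /asboolP[gl gc]; apply/asboolP; split.
  move=> d x y; rewrite !fctE fl gl !scalerDr !scalerA.
  by rewrite (mulrC c d) addrACA.
move=> x; apply: cvgD; last exact: gc.
exact: (cvgZl_tmp (k := c) (fc x)).
Qed.

HB.instance Definition _ :=
  GRing.isSubmodClosed.Build R[i] (H -> H) bounded_op bounded_op_submod.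

Record bop := BOp { bop_fun :> H -> H ; bop_funP : bop_fun \in bounded_op }.

HB.instance Definition _ := [isSub for bop_fun].
HB.instance Definition _ := [Choice of bop by <:].
HB.instance Definition _ := [SubChoice_isSubLmodule of bop by <:].

Lemma bop_id_subproof : idfun \in bounded_op.
Proof. by apply/asboolP; split => [c x y //|x]; exact: cvg_id. Qed.

Lemma bop_comp_subproof (x y : bop) : (x \o y) \in bounded_op.
Proof.
have /asboolP[xl xc] := bop_funP x; have /asboolP[yl yc] := bop_funP y.
apply/asboolP; split => [c u v|u] /=; first by rewrite yl xl.
by apply: continuous_comp; [exact: yc | exact: xc].
Qed.

Definition bop_one : bop := BOp bop_id_subproof.
Definition bop_mul (x y : bop) : bop := BOp (bop_comp_subproof x y).

Lemma bop_linear (x : bop) : linear x.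
Proof. by have /asboolP[] := bop_funP x. Qed.

Lemma bop_mulA : associative bop_mul. Proof. by move=> x y z; exact: val_inj. Qed.
Lemma bop_mul1 : left_id bop_one bop_mul. Proof. by move=> x; exact: val_inj. Qed.
Lemma bop_1mul : right_id bop_one bop_mul. Proof. by move=> x; exact: val_inj. Qed.
Lemma bop_mulDl : left_distributive bop_mul +%R.
Proof. by move=> x y z; exact: val_inj. Qed.
Lemma bop_mulDr : right_distributive bop_mul +%R.
Proof.
move=> x y z; apply: val_inj; apply/funext => u /=.
by have := bop_linear x 1 (y u) (z u); rewrite !scale1r.
Qed.

(* Multiplication in [bop] is composition; only a [pzRingType] since H may be 0. *)
HB.instance Definition _ := GRing.Zmodule_isPzRing.Build bop
  bop_mulA bop_mul1 bop_1mul bop_mulDl bop_mulDr.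

End BoundedOperators.

Section VonNeumannAlgebras.
Context {R : realType} {H : hilbertType R}.
Local Notation B := (bop H).
Implicit Types (A C : set B) (tau : B -> R[i]).

Definition adjoint (x y : B) := forall u v : H, dot (x u) v = dot u (y v).

Definition positive_op (x : B) := forall u : H, 0 <= dot (x u) u.

Definition projection (p : B) := p * p = p /\ adjoint p p.

Definition commutant C : set B := [set x | forall y, C y -> x * y = y * x].

Definition von_neumann_algebra A :=
  (forall x y, A x -> adjoint x y -> A y) /\ commutant (commutant A) = A.

Definition is_factor A := A `&` commutant A = range (fun c : R[i] => c *: (1 : B)).

Definition finite_algebra A :=
  forall v w, A v -> adjoint v w -> w * v = 1 -> v * w = 1.

Definition minimal_projection A (p : B) :=
  [/\ A p, projection p, p <> 0 &
    forall q, A q -> projection q -> p * q = q -> q = 0 \/ q = p].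

Definition II1_factor A :=
  [/\ von_neumann_algebra A, is_factor A, finite_algebra A &
    forall p, ~ minimal_projection A p].

(* [tau] is only meaningful on [A]; its values elsewhere are junk. *)
Definition tracial_state A tau :=
  [/\ forall (c : R[i]) x y, A x -> A y -> tau (c *: x + y) = c * tau x + tau y,
      forall x, A x -> positive_op x -> 0 <= tau x,
      tau 1 = 1 &
      forall x y, A x -> A y -> tau (x * y) = tau (y * x)].

End VonNeumannAlgebras.

Section Entropy.
Context {R : realType} {H : hilbertType R}.
Local Notation B := (bop H).
Implicit Types (A : set B) (tau : B -> R[i]).

(* Unbounded operators: [papp T] is only meaningful on [pdom T]. *)
Record pop := POp { pdom : set H ; papp : H -> H }.
Implicit Types T : pop.

Definition pop_comp T (a : B) : pop :=
  POp [set u | pdom T (a u)] (fun u => papp T (a u)).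

Definition pop_linear T := pdom T 0 /\
  forall (c : R[i]) u v, pdom T u -> pdom T v ->
    pdom T (c *: u + v) /\ papp T (c *: u + v) = c *: papp T u + papp T v.

Definition pop_closed T :=
  closed [set z : H * H | pdom T z.1 /\ z.2 = papp T z.1].

Definition affiliated A T := forall b, commutant A b ->
  forall u, pdom T u -> pdom T (b u) /\ papp T (b u) = b (papp T u).

Definition tau_measurable A tau T :=
  [/\ pop_linear T, dense (pdom T), pop_closed T, affiliated A T &
    forall d : R, 0 < d -> exists p,
      [/\ A p, projection p, tau (1 - p) <= d%:C & range p `<=` pdom T]].

(* [v, w] is in the graph of T^* iff the right-hand side holds. *)
Definition self_adjoint T := forall v w : H,
  (pdom T v /\ papp T v = w) <->
  (forall u, pdom T u -> dot (papp T u) v = dot u w).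

Definition pop_positive T :=
  self_adjoint T /\ forall u, pdom T u -> 0 <= dot (papp T u) u.

(* Operator norm, +oo unless T is everywhere defined and bounded. *)
Definition pop_norm T : \bar R :=
  if `[< pdom T = setT >]
  then ereal_sup [set (complex.Re `|papp T u|)%:E | u in [set u : H | `|u| <= 1]]
  else +oo%E.

(* b = |a|, the positive square root of a^* a. *)
Definition absolute_value (a b : B) :=
  positive_op b /\ exists2 a', adjoint a a' & b * b = a' * a.

Definition norm1_le A tau (a : B) (e : R) :=
  exists2 b, absolute_value a b & tau b <= e%:C.

Definition cvg_in_measure A tau (a : nat -> B) T :=
  forall d e : R, 0 < d -> 0 < e -> \forall n \near \oo, exists p,
    [/\ A p, projection p, tau (1 - p) <= d%:C, range p `<=` pdom T &
      forall u, `|papp T (p u) - a n (p u)| <= e%:C * `|u| ].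

(* L^1(A, tau) is the completion of A for the norm tau(|a|), realised inside the
   tau-measurable operators through convergence in measure (Nelson); tau extends
   to it by continuity. [L1_trace A tau T z] says that T is in L^1(A, tau) and
   that tau(T) = z. *)
Definition L1_trace A tau T (z : R[i]) :=
  tau_measurable A tau T /\
  exists a : nat -> B,
    [/\ forall n, A (a n),
        forall e : R, 0 < e -> exists N, forall m n, (N <= m)%N -> (N <= n)%N ->
          norm1_le A tau (a m - a n) e,
        cvg_in_measure A tau a T &
        (fun n => tau (a n) : R[i]^o) @ \oo --> (z : R[i]^o)].

(* The product rho a is already closed, because a is bounded. *)
Definition density A tau (omega : B -> R[i]) (rho : pop) :=
  [/\ pop_positive rho, tau_measurable A tau rho &
    forall a, A a -> L1_trace A tau (pop_comp rho a) (omega a)].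

Definition vector_state (psi : H) (x : B) : R[i] := dot (x psi) psi.

Definition singular_value A tau rho (t : R) : \bar R :=
  ereal_inf [set pop_norm (pop_comp rho p) |
    p in [set p | [/\ A p, projection p & tau (1 - p) <= t%:C]]].

(* [fine] is harmless: singular values of tau-measurable operators are finite
   for t > 0. The convention 0 log 0 = 0 holds since [ln 0 = 0]. *)
Definition entropy A tau rho : \bar R :=
  let mu t := fine (singular_value A tau rho t) in
  (- \int[lebesgue_measure]_(t in `]0%R, 1%R]) (mu t * ln (mu t))%:E)%E.

End Entropy.

Section LOCC.
Context {R : realType} {H : hilbertType R}.
Local Notation B := (bop H).
Implicit Types (A C : set B) (Phi Psi Theta : B -> B).

(* The functionals x |-> \sum_k <x xi_k, eta_k>, with xi and eta square-summable,
   are those of the predual B(H)_*. *)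
Definition predual (omega : B -> R[i]) := exists xi eta : nat -> H,
  [/\ cvgn (series (fun k => `|xi k| ^+ 2 : R[i]^o)),
      cvgn (series (fun k => `|eta k| ^+ 2 : R[i]^o)) &
      forall x : B, series (fun k => dot (x (xi k)) (eta k) : R[i]^o) @ \oo -->
        (omega x : R[i]^o)].

Definition weakstar_cvg (F : set_system B) (x : B) :=
  forall omega, predual omega -> (omega : B -> R[i]^o) @ F --> (omega x : R[i]^o).

Definition normal_map Phi := forall (F : set_system B) (x : B), Filter F ->
  weakstar_cvg F x -> weakstar_cvg (Phi @ F) (Phi x).

(* Sum of a family over S: weak* limit along the net of finite subsets of S. *)
Definition weakstar_sum (I : choiceType) (S : set I) (f : I -> B) (x : B) :=
  weakstar_cvg ((fun K : {fset I} => \sum_(i <- K | i \in S) f i) @ totally) x.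

(* Positivity of the operator matrix (x_ij) on H^n. *)
Definition mx_positive n (x : 'I_n -> 'I_n -> B) := forall xi : 'I_n -> H,
  0 <= \sum_i \sum_j dot (x i j (xi j)) (xi i).

Definition completely_positive Phi := linear Phi /\
  forall n (x : 'I_n -> 'I_n -> B),
    mx_positive x -> mx_positive (fun i j => Phi (x i j)).

Definition NCP Phi := completely_positive Phi /\ normal_map Phi.

Definition NUCP Phi := NCP Phi /\ Phi 1 = 1.

Definition bimodule_map C Phi :=
  forall a x b, C a -> C b -> Phi (a * x * b) = a * Phi x * b.

Definition CPs C Phi := NCP Phi /\ bimodule_map C Phi.

Definition UCPs C Phi := CPs C Phi /\ Phi 1 = 1.

Definition right_local A Theta := exists Phi Psi,
  [/\ UCPs A Phi, CPs (commutant A) Psi & Theta = Phi \o Psi].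

Definition left_local A Theta := exists Phi Psi,
  [/\ CPs A Phi, UCPs (commutant A) Psi & Theta = Phi \o Psi].

(* [I] is [nat] or [nat * nat]; the notions below are invariant under bijective
   relabelling of the index type. *)
Definition instrument_sum (I : choiceType) (T : I -> B -> B) Theta :=
  [/\ forall k, NCP (T k),
      forall x, weakstar_sum setT (fun k => T k x) (Theta x) &
      NUCP Theta].

Definition instrument (I : choiceType) (T : I -> B -> B) :=
  exists Theta, instrument_sum T Theta.

Definition one_way_instrument A (T : nat -> B -> B) := instrument T /\
  ((forall k, right_local A (T k)) \/ (forall k, left_local A (T k))).

(* Blocks may be empty (finite instruments are padded with zero maps). *)
Definition coarse_graining (I : choiceType) (T : I -> B -> B)
    (G : nat -> B -> B) :=
  [/\ instrument T, instrument G &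
    exists S : nat -> set I,
      [/\ trivIset setT S, \bigcup_j S j = setT &
        forall j x, weakstar_sum (S j) (fun k => T k x) (G j x)]].

Definition linked A (T J : nat -> B -> B) :=
  exists T' : nat -> nat -> B -> B,
    (forall k, one_way_instrument A (T' k)) /\
    coarse_graining (fun ki : nat * nat => T ki.1 \o T' ki.1 ki.2) J.

Definition LOCC A Theta := exists (n : nat) (T : nat -> nat -> B -> B),
  [/\ one_way_instrument A (T 0%N),
      forall l, (l < n)%N -> linked A (T l) (T l.+1) &
      instrument_sum (T n) Theta].

Definition functional_norm (omega : B -> R[i]) : \bar R :=
  ereal_sup [set (complex.Re `|omega x|)%:E |
    x in [set x : B | forall u, `|x u| <= `|u| ]].

Definition approx_convertible A (psi phi : H) :=
  forall e : R, 0 < e -> exists2 Theta, LOCC A Theta &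
    (functional_norm
      (fun x => vector_state psi (Theta x) - vector_state phi x)%R
      < e%:E)%E.

End LOCC.

Definition separable (T : topologicalType) :=
  exists2 D : set T, countable D & dense D.

(* Main.v *)
(** With mu the singular value function of a density rho and (x)_+ the positive
    part, the integral of (mu - r)_+ is tau ((rho - r)_+), which is the maximum
    of <p psi, psi> - r tau p over projections p of A. As x ln x is a limit of
    positive combinations of an affine function and of such hinges, it suffices
    to bound <p psi, psi>, for a projection p of A, by the supremum of
    <a phi, phi> over projections a of A with tau a <= tau p.

    Maps in CP_{A'} have Kraus operators k in A. If e is a spectral projection
    of p k^* k p, cut away from 0, then the final projection a of the polar part
    of k p e has trace at most tau p and satisfies p k^* a k p = p k^* k p e.
    Hence, up to an arbitrarily small error, the weight <p psi, psi> is still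
    collected after one step of a protocol by projections of trace at most
    tau p, one for each branch; maps in UCP_A do not disturb them. At the end
    the branches sum to a state close to the pure state of phi, so each of them
    is nearly a multiple of that state and collects at most the corresponding
    multiple of the supremum. *)

Require Import Defs.
From mathcomp Require Import all_boot all_order all_algebra.
From mathcomp Require Import complex.
From mathcomp Require Import all_classical all_reals all_analysis.
From mathcomp Require Import finmap ring lra measurable_realfun summability.
Import Order.TTheory GRing.Theory Num.Theory.
Import numFieldNormedType.Exports.
Local Open Scope classical_set_scope.
Local Open Scope ring_scope.
Local Open Scope complex_scope.
Set Implicit Arguments.
Unset Strict Implicit.
Unset Printing Implicit Defensive.

(** * Inner products *)

Section Hilbert.
Context {R : realType} {H : hilbertType R}.
Implicit Types (u v w : H) (c : R[i]) (r : R).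

(** Two obstacles shape the proof. The density is unbounded and the entropy may be minus infinity,
    so trace identities are proved only for bounded cut-offs [Y M = rho (1 - E M)]; what is
    discarded is controlled by [tr (E M)] and [nm (E M psi)], which both tend to 0. The integrals of
    hinges give those of convex piecewise linear minorants of x ln x + 1, and Fatou's lemma passes
    to the limit whether or not it is finite. Since both singular value functions have integral 1,
    the affine part of a minorant contributes equally on both sides.

    Secondly, a round of a protocol may have infinitely many branches, coarse-graining merges them,
    and the projections found in different branches are unrelated. What survives a round is
    therefore not a projection but a lower bound, additive over branches and stable under domination
    of functionals. Each round is truncated to finitely many branches and Kraus operators at an
    arbitrarily small loss; this is harmless for any number of rounds, because the protocol is fixed
    before the losses are chosen. *)

Definition nm u : R := complex.Re `|u|.
Definition rd u v : R := complex.Re (dot u v).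

Lemma ReD (a b : R[i]) : complex.Re (a + b) = complex.Re a + complex.Re b.
Proof. by case: a; case: b. Qed.
Lemma ReN (a : R[i]) : complex.Re (- a) = - complex.Re a.
Proof. by case: a. Qed.
Lemma ReMr r (a : R[i]) : complex.Re (r%:C * a) = r * complex.Re a.
Proof. by case: a => x y /=; rewrite mul0r subr0. Qed.
Lemma ReJ (a : R[i]) : complex.Re (Num.conj a) = complex.Re a.
Proof. by case: a. Qed.
Lemma ReMi (a : R[i]) : complex.Re ('i%C * a) = - complex.Im a.
Proof. by case: a => x y /=; rewrite mul0r mul1r sub0r. Qed.
Lemma Re_le (a b : R[i]) : a <= b -> complex.Re a <= complex.Re b.
Proof. by rewrite lecE => /andP[]. Qed.
Lemma complex_ext (a b : R[i]) : complex.Re a = complex.Re b ->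
  complex.Im a = complex.Im b -> a = b.
Proof. by case: a; case: b => ? ? ? ? /= -> ->. Qed.
Lemma Re_le_norm (a : R[i]) : `|complex.Re a| <= complex.Re `|a|.
Proof.
by rewrite normc_def /= -sqrtr_sqr ler_wsqrtr // lerDl sqr_ge0.
Qed.
Lemma norm_Re_real (a : R[i]) : `|a| = (complex.Re `|a|)%:C.
Proof. by rewrite normc_def. Qed.
Lemma Re_norm_ge0 (a : R[i]) : 0 <= complex.Re `|a|.
Proof. by rewrite -lecR -norm_Re_real (normr_ge0 a). Qed.
Lemma Re_norm_eq0 (a : R[i]) : complex.Re `|a| <= 0 -> a = 0.
Proof.
move=> h; apply/eqP; rewrite -normr_eq0 norm_Re_real.
by have -> : complex.Re `|a| = 0 by apply/eqP; rewrite eq_le h Re_norm_ge0.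
Qed.
Lemma normrC r : `|r%:C| = `|r|%:C.
Proof. by rewrite normc_def /= expr0n addr0 sqrtr_sqr. Qed.

Lemma gt0_realc (e : R[i]) : 0 < e -> exists2 r, 0 < r & e = r%:C.
Proof.
by case: e => a b; rewrite ltcE /= => /andP[/eqP -> a0]; exists a.
Qed.

Lemma norm_nm u : `|u| = (nm u)%:C.
Proof.
rewrite /nm; have : 0 <= `|u| by [].
by case: `|u| => a b; rewrite lecE /= => /andP[/eqP -> _].
Qed.
Lemma nm_ge0 u : 0 <= nm u.
Proof. by rewrite -lecR -norm_nm (normr_ge0 u). Qed.
Hint Resolve nm_ge0 : core.
Lemma nm_triangle u v : nm (u + v) <= nm u + nm v.
Proof. by rewrite -lecR rmorphD /= -!norm_nm ler_normD. Qed.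
Lemma nm_cZ c u : nm (c *: u) = complex.Re `|c| * nm u.
Proof. by rewrite /nm normrZ (norm_Re_real c) ReMr. Qed.
Lemma nmZ r u : nm (r%:C *: u) = `|r| * nm u.
Proof. by rewrite nm_cZ normrC. Qed.
Lemma nmN u : nm (- u) = nm u.
Proof. by rewrite /nm normrN. Qed.
Lemma nm0 : nm (0 : H) = 0.
Proof. by rewrite /nm normr0. Qed.
Lemma nm_distC u v : nm (u - v) = nm (v - u).
Proof. by rewrite -nmN opprB. Qed.
Lemma nm0_eq0 u : nm u = 0 -> u = 0.
Proof. by move=> h; apply/eqP; rewrite -normr_eq0 norm_nm h. Qed.

Lemma dotDl u v w : dot (u + v) w = dot u w + dot v w.
Proof. by have := dot_linearl 1 u v w; rewrite scale1r mul1r. Qed.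
Lemma dot0l w : dot (0 : H) w = 0.
Proof. by apply: (addrI (dot (0 : H) w)); rewrite -dotDl !addr0. Qed.
Lemma dotZl c u w : dot (c *: u) w = c * dot u w.
Proof. by have := dot_linearl c u 0 w; rewrite addr0 dot0l addr0. Qed.
Lemma dotNl u w : dot (- u) w = - dot u w.
Proof. by rewrite -scaleN1r dotZl mulN1r. Qed.
Lemma dotBl u v w : dot (u - v) w = dot u w - dot v w.
Proof. by rewrite dotDl dotNl. Qed.
Lemma dotDr u v w : dot u (v + w) = dot u v + dot u w.
Proof. by rewrite dotC dotDl [dot u v]dotC [dot u w]dotC rmorphD. Qed.
Lemma dot0r w : dot w (0 : H) = 0.
Proof. by rewrite dotC dot0l rmorph0. Qed.
Lemma dotZr c u w : dot u (c *: w) = Num.conj c * dot u w.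
Proof. by rewrite dotC dotZl [dot u w]dotC rmorphM. Qed.
Lemma dotNr u w : dot u (- w) = - dot u w.
Proof. by rewrite dotC dotNl [dot u w]dotC rmorphN. Qed.
Lemma dotBr u v w : dot u (v - w) = dot u v - dot u w.
Proof. by rewrite dotDr dotNr. Qed.
Lemma dot_suml (I : Type) (s : seq I) (P : pred I) (F : I -> H) w :
  dot (\sum_(i <- s | P i) F i) w = \sum_(i <- s | P i) dot (F i) w.
Proof. by apply: (big_morph (fun x => dot x w)) => [x y|]; rewrite ?dotDl ?dot0l. Qed.
Lemma dot_sumr (I : Type) (s : seq I) (P : pred I) (F : I -> H) w :
  dot w (\sum_(i <- s | P i) F i) = \sum_(i <- s | P i) dot w (F i).
Proof. by apply: (big_morph (fun x => dot w x)) => [x y|]; rewrite ?dotDr ?dot0r. Qed.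

Lemma rdC u v : rd u v = rd v u.
Proof. by rewrite /rd dotC ReJ. Qed.
Lemma rdDl u v w : rd (u + v) w = rd u w + rd v w.
Proof. by rewrite /rd dotDl ReD. Qed.
Lemma rdDr u v w : rd u (v + w) = rd u v + rd u w.
Proof. by rewrite /rd dotDr ReD. Qed.
Lemma rdNl u w : rd (- u) w = - rd u w.
Proof. by rewrite /rd dotNl ReN. Qed.
Lemma rdNr u w : rd u (- w) = - rd u w.
Proof. by rewrite /rd dotNr ReN. Qed.
Lemma rdBl u v w : rd (u - v) w = rd u w - rd v w.
Proof. by rewrite rdDl rdNl. Qed.
Lemma rdBr u v w : rd u (v - w) = rd u v - rd u w.
Proof. by rewrite rdDr rdNr. Qed.
Lemma rdZl r u w : rd (r%:C *: u) w = r * rd u w.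
Proof. by rewrite /rd dotZl ReMr. Qed.
Lemma rdZr r u w : rd u (r%:C *: w) = r * rd u w.
Proof. by rewrite rdC rdZl rdC. Qed.
Lemma rd0l w : rd 0 w = 0. Proof. by rewrite /rd dot0l. Qed.
Lemma rd0r w : rd w 0 = 0. Proof. by rewrite /rd dot0r. Qed.
Lemma rdE u : rd u u = nm u ^+ 2.
Proof. by rewrite /rd dot_norm norm_nm -rmorphXn. Qed.
Lemma dotE u : dot u u = (nm u ^+ 2)%:C.
Proof. by rewrite dot_norm norm_nm -rmorphXn. Qed.
Lemma Im_dot u v : complex.Im (dot u v) = rd u ('i%C *: v).
Proof. by rewrite /rd dotZr; case: (dot u v) => a b /=; rewrite mul0r sub0r mulN1r opprK. Qed.
Lemma rdi u v : rd ('i%C *: u) ('i%C *: v) = rd u v.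
Proof.
by rewrite /rd dotZr dotZl; case: (dot u v) => a b /=; rewrite !mul0r !mul1r !mulN1r ?sub0r ?add0r ?addr0 opprK.
Qed.
(** Taking [c = 1] and [c = i] recovers the real and imaginary parts. This is what lets most later
    arguments run with the real form [rd] alone. *)
Lemma rd_dot u v u' v' : (forall c, rd (c *: u) v = rd (c *: u') v') -> dot u v = dot u' v'.
Proof.
move=> h; apply: complex_ext; first by have := h 1; rewrite !scale1r.
have := h 'i%C; rewrite /rd !dotZl !ReMi => e.
by apply: oppr_inj.
Qed.
Lemma rd_eq0 u : (forall v, rd u v = 0) -> u = 0.
Proof.
by move=> /(_ u); rewrite rdE => /eqP; rewrite sqrf_eq0 => /eqP/nm0_eq0.
Qed.

Lemma nm_sqrD u v : nm (u + v) ^+ 2 = nm u ^+ 2 + 2 * rd u v + nm v ^+ 2.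
Proof. by rewrite -!rdE rdDl !rdDr (rdC v u); ring. Qed.
Lemma nm_sqrB u v : nm (u - v) ^+ 2 = nm u ^+ 2 - 2 * rd u v + nm v ^+ 2.
Proof. by rewrite nm_sqrD nmN rdNr; ring. Qed.

(** Common source of the Cauchy-Schwarz inequalities below, for inner products, positive operators
    and completely positive maps. The test value is the minimiser [- b / d]; for [d = 0], an affine
    function of [t] that stays nonnegative must be constant. *)
Lemma quad_discr (a b d : R) : 0 <= a -> 0 <= d ->
  (forall t, 0 <= a + 2 * t * b + t ^+ 2 * d) -> b ^+ 2 <= a * d.
Proof.
move=> a0 d0 h; have [d_0|dn0] := eqVneq d 0.
  move: h; rewrite d_0 mulr0 => h; have [->|bn0] := eqVneq b 0; first by rewrite expr0n.
  exfalso; have := h (- (a + 1) / (2 * b)); rewrite mulr0 addr0 leNgt => /negP; apply.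
  by have -> : a + 2 * (- (a + 1) / (2 * b)) * b = -1 by field.
have dp : 0 < d by rewrite lt_def dn0.
have := h (- b / d); have -> : a + 2 * (- b / d) * b + (- b / d) ^+ 2 * d = (a * d - b ^+ 2) / d by field.
by rewrite pmulr_lge0 ?invr_gt0 // subr_ge0.
Qed.

Lemma ler_of_sqr (a b : R) : 0 <= b -> a ^+ 2 <= b ^+ 2 -> a <= b.
Proof.
move=> b0 h; have [a0|/ltW a0] := leP 0 a; last exact: le_trans a0 b0.
by rewrite -(@ler_pXn2r _ 2).
Qed.

Lemma rd_CS2 u v : rd u v ^+ 2 <= nm u ^+ 2 * nm v ^+ 2.
Proof.
apply: quad_discr; rewrite ?sqr_ge0 // => t.
suff -> : nm u ^+ 2 + 2 * t * rd u v + t ^+ 2 * nm v ^+ 2 = nm (u + t%:C *: v) ^+ 2.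
  by rewrite sqr_ge0.
by rewrite nm_sqrD nmZ rdZr exprMn real_normK ?num_real //; ring.
Qed.
Lemma rd_CS u v : `|rd u v| <= nm u * nm v.
Proof.
rewrite -(@ler_pXn2r _ 2) ?nnegrE ?mulr_ge0 // real_normK ?num_real // exprMn.
exact: rd_CS2.
Qed.
Lemma rd_le u v : rd u v <= nm u * nm v.
Proof. exact: le_trans (ler_norm _) (rd_CS u v). Qed.
Lemma dot_CS u v : complex.Re `|dot u v| <= nm u * nm v.
Proof.
have [d0|dn0] := eqVneq (dot u v) 0.
  by rewrite d0 normr0 mulr_ge0.
have dp : `|dot u v| != 0 by rewrite normr_eq0.
set c := Num.conj (dot u v) / `|dot u v|.
have nc : complex.Re `|c| = 1.
  by rewrite normrM normfV normr_id norm_conjC divff.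
have : rd (c *: u) v = complex.Re `|dot u v|.
  by rewrite /rd dotZl /c mulrAC (mulrC (Num.conj _)) -normCK expr2 mulfK.
by move=> <-; apply: le_trans (rd_le _ _) _; rewrite nm_cZ nc mul1r.
Qed.

Lemma nm_le_rd u r : 0 <= r -> (forall v, rd u v <= r * nm v) -> nm u <= r.
Proof.
move=> r0 h; have := h u; rewrite rdE expr2.
have [->//|un0] := eqVneq (nm u) 0.
by rewrite ler_pM2r // lt_def un0 nm_ge0.
Qed.

Definition ncvg (s : nat -> H) (l : H) :=
  forall e : R, 0 < e -> exists N, forall n, (N <= n)%N -> nm (s n - l) <= e.

Lemma cvg_ncvg (s : nat -> H) l : s @ \oo --> l <-> ncvg s l.
Proof.
split=> [/cvgrPdist_le h e e0|h].
  have [|N _ hN] := h e%:C; first by rewrite ltcR.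
  by exists N => n nN; have := hN n nN; rewrite /= norm_nm lecR nm_distC.
apply/cvgrPdist_le => _ /gt0_realc[e e0 ->].
have [N hN] := h e e0.
by exists N => // n /= nN; rewrite norm_nm lecR nm_distC hN.
Qed.

Lemma ncomplete (s : nat -> H) :
  (forall e : R, 0 < e -> exists N, forall m n, (N <= m)%N -> (N <= n)%N ->
     nm (s m - s n) <= e) -> exists l, ncvg s l.
Proof.
move=> h; suff : cvg (s @ \oo) by move=> /cvg_ex[l /cvg_ncvg]; exists l.
apply/cauchy_cvgP/cauchy_exP => _ /gt0_realc[e e0 ->].
have [|N hN] := h (e / 2); first by rewrite divr_gt0.
exists (s N); exists N => // n nN; rewrite -ball_normE /= norm_nm ltcR.
apply: le_lt_trans (hN _ _ (leqnn N) nN) _.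
by rewrite ltr_pdivrMr // mulr_natr mulr2n ltrDl.
Qed.

Lemma ncvg_unique s l l' : ncvg s l -> ncvg s l' -> l = l'.
Proof.
move=> h h'; apply/eqP; rewrite -subr_eq0; apply/eqP/nm0_eq0/eqP.
rewrite eq_le nm_ge0 andbT; apply/ler_addgt0Pl => e e0; rewrite addr0.
have [|N hN] := h (e / 2); first by rewrite divr_gt0.
have [|N' hN'] := h' (e / 2); first by rewrite divr_gt0.
have := hN (maxn N N') (leq_maxl _ _); have := hN' (maxn N N') (leq_maxr _ _).
have -> : l - l' = (l - s (maxn N N')) + (s (maxn N N') - l') by rewrite subrKA.
by move=> a b; apply: le_trans (nm_triangle _ _) _; rewrite (nm_distC l) (splitr e) lerD.
Qed.

Lemma ncvg_rd s l v : ncvg s l ->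
  forall e : R, 0 < e -> exists N, forall n, (N <= n)%N -> `|rd (s n) v - rd l v| <= e.
Proof.
move=> h e e0; have nv : 0 < nm v + 1 by rewrite ltr_wpDl.
have [|N hN] := h (e / (nm v + 1)); first by rewrite divr_gt0.
exists N => n nN; rewrite -rdBl; apply: le_trans (rd_CS _ _) _.
have := hN n nN; rewrite ler_pdivlMr // => h1; apply: le_trans h1.
by rewrite ler_wpM2l // lerDl.
Qed.

End Hilbert.
#[export] Hint Extern 0 (is_true (_ <= nm _)) => solve [exact: nm_ge0] : core.

(** * Bounded operators, orthogonal projections and adjoints *)

Section Operators.
Context {R : realType} {H : hilbertType R}.
Local Notation B := (bop H).
Implicit Types (u v w : H) (c : R[i]) (r : R) (x y z p : B).

Lemma bopD x y u : (x + y) u = x u + y u. Proof. by []. Qed.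
Lemma bopN x u : (- x) u = - x u. Proof. by []. Qed.
Lemma bopB x y u : (x - y) u = x u - y u. Proof. by []. Qed.
Lemma bopZ c x u : (c *: x) u = c *: x u. Proof. by []. Qed.
Lemma bopM x y u : (x * y) u = x (y u). Proof. by []. Qed.
Lemma bop1E u : (1 : B) u = u. Proof. by []. Qed.
Lemma bop0E u : (0 : B) u = 0. Proof. by []. Qed.
Definition bopE := (bopB, bopD, bopN, bopZ, bopM, bop1E, bop0E).
Lemma bop_ext x y : (forall u, x u = y u) -> x = y.
Proof. by move=> h; apply: val_inj; apply/funext. Qed.

Lemma opD x u v : x (u + v) = x u + x v.
Proof. by have := bop_linear x 1 u v; rewrite !scale1r. Qed.
Lemma op0 x : x 0 = 0.
Proof. by apply: (addrI (x 0)); rewrite -opD !addr0. Qed.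
Lemma opZ x c u : x (c *: u) = c *: x u.
Proof. by have := bop_linear x c u 0; rewrite op0 !addr0. Qed.
Lemma opN x u : x (- u) = - x u.
Proof. by rewrite -scaleN1r opZ scaleN1r. Qed.
Lemma opB x u v : x (u - v) = x u - x v.
Proof. by rewrite opD opN. Qed.
Lemma op_sum x (I : Type) (s : seq I) (P : pred I) (F : I -> H) :
  x (\sum_(i <- s | P i) F i) = \sum_(i <- s | P i) x (F i).
Proof. by apply: (big_morph x) => [u v|]; rewrite ?opD ?op0. Qed.
Lemma bop_sum (I : Type) (s : seq I) (P : pred I) (F : I -> B) u :
  (\sum_(i <- s | P i) F i) u = \sum_(i <- s | P i) F i u.
Proof. by apply: (big_morph (fun x : B => x u)). Qed.

Lemma bopZl c x y : (c *: x) * y = c *: (x * y).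
Proof. exact: bop_ext. Qed.
Lemma bopZr c x y : x * (c *: y) = c *: (x * y).
Proof. by apply: bop_ext => u; rewrite !bopE opZ. Qed.

Lemma bop_bounded x : exists2 K : R, 0 < K & forall u, nm (x u) <= K * nm u.
Proof.
have /asboolP[_ xc] := bop_funP x.
have /cvgrPdist_le/(_ 1 ltr01) := xc 0.
rewrite op0 => /nbhs_ballP[_ /gt0_realc[e e0 ->] he].
exists (2 / e) => [|u]; first by rewrite divr_gt0.
have [->|un0] := eqVneq u 0; first by rewrite op0 !nm0 mulr0.
have nu : 0 < nm u by rewrite lt_def nm_ge0 andbT; apply: contra_neq un0; exact: nm0_eq0.
set t := e / 2 / nm u; have t0 : 0 < t by rewrite !divr_gt0.
have := he (t%:C *: u); rewrite -ball_normE /= !sub0r !normrN opZ !norm_nm !nmZ ltcR gtr0_norm //.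
have -> : t * nm u = e / 2 by rewrite /t; field; rewrite gt_eqF.
rewrite ltr_pdivrMr // mulr_natr mulr2n ltrDl => /(_ e0).
rewrite (_ : 1 = 1%:C) // lecR /t => h.
have -> : 2 / e * nm u = (e / 2 / nm u)^-1 by field; rewrite !gt_eqF.
by rewrite -[leRHS]mul1r ler_pdivlMr // mulrC.
Qed.

Lemma mk_bop (f : H -> H) (K : R) :
  (forall c u v, f (c *: u + v) = c *: f u + f v) ->
  (forall u, nm (f u) <= K * nm u) -> exists x : B, forall u, x u = f u.
Proof.
move=> fl fb.
have fB : f \in @bounded_op R H.
  apply/asboolP; split => // u; apply/cvgrPdist_le => _ /gt0_realc[e e0 ->].
  apply/nbhs_ballP; have K0 : 0 < `|K| + 1 by rewrite ltr_wpDl.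
  exists (e / (`|K| + 1))%:C; first by rewrite /= ltcR divr_gt0.
  move=> v; rewrite -ball_normE /= norm_nm ltcR ltr_pdivlMr // => h.
  rewrite norm_nm lecR.
  have -> : f u - f v = f (u - v).
    by rewrite [u - v]addrC -(scaleN1r v) fl scaleN1r addrC.
  apply: le_trans (fb _) _; rewrite mulrC in h; apply: le_trans (ltW h).
  by apply: ler_wpM2r => //; apply: le_trans (ler_norm _) _; rewrite lerDl.
by exists (BOp fB).
Qed.

Lemma op_ncvg x (s : nat -> H) l : ncvg s l -> ncvg (fun n => x (s n)) (x l).
Proof.
move=> h e e0; have [K K0 hK] := bop_bounded x.
have [|N hN] := h (e / K); first by rewrite divr_gt0.
exists N => n nN; rewrite -opB; apply: le_trans (hK _) _.
by rewrite mulrC -ler_pdivlMr // hN.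
Qed.

Lemma archi_ex (a : R) : exists N : nat, a < N%:R.
Proof. by exists (Num.bound `|a|); apply: le_lt_trans (ler_norm a) (archi_boundP (normr_ge0 a)). Qed.

Definition subspace (M : set H) := [/\ M 0,
  forall c u v, M u -> M v -> M (c *: u + v) &
  forall s l, (forall n, M (s n)) -> ncvg s l -> M l].

(** A minimising sequence for the distance from [u] to [M] is Cauchy by the parallelogram law, since
    the midpoint of two of its terms is again in [M]. The first variation at the limit gives
    orthogonality. *)
Lemma proj_thm (M : set H) u : subspace M ->
  exists2 v, M v & forall w, M w -> dot (u - v) w = 0.
Proof.
case=> M0 Ml Mc.
have MD v w : M v -> M w -> M (v + w) by move=> hv hw; rewrite -[v]scale1r; exact: Ml.
have MZ c v : M v -> M (c *: v) by move=> hv; rewrite -[_ *: _]addr0; exact: Ml.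
set D := [set nm (u - v) ^+ 2 | v in M].
have Dinf : has_inf D.
  split; first by exists (nm (u - 0) ^+ 2); exists 0.
  by exists 0 => _ [v _ <-]; rewrite sqr_ge0.
set d := inf D.
have dle v : M v -> d <= nm (u - v) ^+ 2.
  by move=> hv; apply: ge_inf; [case: Dinf | exists v].
have ex (n : nat) : exists v, M v /\ nm (u - v) ^+ 2 <= d + n.+1%:R^-1.
  have [|_ [v hv <-] hd] := inf_adherent (eps := n.+1%:R^-1) _ Dinf; first by rewrite invr_gt0.
  by exists v; split => //; rewrite ltW.
have [s sM] := choice ex.
have par m n : nm (s m - s n) ^+ 2 <= 2 * (m.+1%:R^-1 + n.+1%:R^-1).
  have hm := (sM m).2; have hn := (sM n).2.
  have hd := dle ((2^-1)%:C *: (s m + s n)) (MZ _ _ (MD _ _ (sM m).1 (sM n).1)).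
  have e1 : nm (s m - s n) ^+ 2 + nm ((u - s m) + (u - s n)) ^+ 2 =
     2 * nm (u - s m) ^+ 2 + 2 * nm (u - s n) ^+ 2.
    have -> : s m - s n = (u - s n) - (u - s m) by rewrite opprB [RHS]addrC subrKA.
    move: (u - s m) (u - s n) => a b.
    by rewrite nm_sqrB nm_sqrD (rdC b); ring.
  have e2 : (u - s m) + (u - s n) = 2%:C *: (u - (2^-1)%:C *: (s m + s n)).
    rewrite scalerBr scalerA -rmorphM divff // scale1r.
    by rewrite (_ : 2%:C = 1 + 1) ?rmorphD // scalerDl scale1r opprD addrACA.
  rewrite e2 nmZ exprMn in e1.
  have := e1; rewrite real_normK ?num_real // => e3.
  move: hm hn hd e3; move: (m.+1%:R^-1) (n.+1%:R^-1) (nm (u - s m) ^+ 2) (nm (u - s n) ^+ 2) => x1 x2 x3 x4 hm hn hd e3. lra.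
have [v sv] : exists v, ncvg s v.
  apply: ncomplete => e e0.
  have [N hN] := archi_ex (4 / e ^+ 2).
  exists N => m n mN nN.
  apply: ler_of_sqr; [exact: ltW|apply: le_trans (par m n) _].
  have q k : (N <= k)%N -> k.+1%:R^-1 <= e ^+ 2 / 4.
    move=> Nk; rewrite -[e ^+ 2 / 4]invrK ler_pV2 ?inE ?unitfE ?invr_gt0 ?invr_eq0 ?gt_eqF ?divr_gt0 ?exprn_gt0 ?ltr0n //.
    rewrite invf_div; apply: le_trans (ltW hN) _; rewrite ler_nat; exact: leqW.
  move: (q _ mN) (q _ nN); move: (m.+1%:R^-1) (n.+1%:R^-1) => ? ?; lra.
exists v => [|w Mw]; first by apply: Mc sv => n; case: (sM n).
have Mv : M v by apply: Mc sv => n; case: (sM n).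
have dv : nm (u - v) ^+ 2 <= d.
  apply/ler_addgt0Pl => e e0.
  have lt1 : nm (u - v) <= Num.sqrt (d + e).
    apply/ler_addgt0Pl => f f0.
    have [N hN] := archi_ex (e^-1).
    have [N' hN'] := sv f f0.
    set k := maxn N N'.
    have h1 := hN' k (leq_maxr _ _).
    have -> : u - v = (s k - v) + (u - s k) by rewrite [RHS]addrC subrKA.
    apply: le_trans (nm_triangle _ _) _; apply: lerD => //.
    apply: ler_of_sqr; first exact: sqrtr_ge0.
    have d0 : 0 <= d by apply: lb_le_inf => [|_ [? _ <-]]; rewrite ?sqr_ge0 //; case: Dinf.
    rewrite sqr_sqrtr; last by apply: addr_ge0 => //; exact: ltW.
    apply: le_trans (sM k).2 _.
    rewrite lerD2l -[e]invrK ler_pV2 ?inE ?unitfE ?invr_gt0 ?invr_eq0 ?gt_eqF ?ltr0n //.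
    by apply: le_trans (ltW hN) _; rewrite ler_nat; apply: leqW; exact: leq_maxl.
  have d0 : 0 <= d by apply: lb_le_inf => [|_ [? _ <-]]; rewrite ?sqr_ge0 //; case: Dinf.
  have de0 : 0 <= d + e by apply: addr_ge0 => //; exact: ltW.
  by rewrite [leRHS]addrC -(sqr_sqrtr de0) ler_pXn2r ?nnegrE ?nm_ge0 ?sqrtr_ge0.
(* Minimality makes a quadratic in [t] with zero constant term nonnegative, so its linear
   coefficient vanishes. *)
have real_orth w' : M w' -> rd (u - v) w' = 0.
  move=> Mw'; apply/eqP; rewrite -sqrf_eq0 eq_le sqr_ge0 andbT.
  rewrite -[leRHS](mul0r (nm w' ^+ 2)) -sqrrN; apply: quad_discr; rewrite ?sqr_ge0 // => t.
  have := le_trans dv (dle (v + t%:C *: w') (MD _ _ Mv (MZ _ _ Mw'))).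
  rewrite opprD addrA; move: (u - v) => a; rewrite nm_sqrB nmZ rdZr exprMn real_normK ?num_real //; lra.
have -> : 0 = dot (0 : H) w by rewrite dot0l.
rewrite dotC [RHS]dotC; congr (Num.conj _).
apply: rd_dot => c; rewrite rd0r rdC; exact: real_orth (MZ _ _ Mw).
Qed.

Lemma subspace_proj (M : set H) : subspace M -> exists p : B,
  [/\ projection p, forall u, M (p u) & forall u, M u -> p u = u].
Proof.
move=> sM; have [M0 Ml Mc] := sM.
have [f fP] := choice (fun u => let: ex_intro2 v a b := proj_thm u sM in ex_intro (fun v => M v /\ forall w, M w -> dot (u - v) w = 0) v (conj a b)).
have MB v w : M v -> M w -> M (v - w) by move=> hv hw; rewrite addrC -scaleN1r; exact: Ml.
have funiq u v : M v -> (forall w, M w -> dot (u - v) w = 0) -> f u = v.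
  move=> Mv hv; have [Mf hf] := fP u; apply/eqP; rewrite -subr_eq0; apply/eqP/nm0_eq0/eqP.
  rewrite -sqrf_eq0 -rdE /rd.
  have e : f u - v = (u - v) - (u - f u) by rewrite opprB [RHS]addrC subrKA.
  by rewrite {1}e dotBl hv ?hf ?subrr //; exact: MB.
have fl c u v : f (c *: u + v) = c *: f u + f v.
  have [Mu hu] := fP u; have [Mv hv] := fP v.
  apply: funiq; first exact: Ml.
  by move=> w Mw; rewrite opprD addrACA -scalerBr dotDl dotZl hu // hv // mulr0 addr0.
have fd u v : dot (f u) v = dot (f u) (f v).
  have [Mu hu] := fP u; have [Mv hv] := fP v.
  apply/eqP; rewrite -subr_eq0 -dotBr dotC hv //; by rewrite rmorph0.
have fb u : nm (f u) <= 1 * nm u.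
  rewrite mul1r; have := fd u u => /(congr1 (@complex.Re R)); rewrite -/(rd _ _) -/(rd _ _) rdE => e.
  have := rd_le (f u) u; rewrite e expr2.
  have [->//|fn0] := eqVneq (nm (f u)) 0.
  by rewrite ler_pM2l // lt_def fn0 nm_ge0.
have [p pf] := mk_bop fl fb.
have pid u : M u -> p u = u.
  by move=> Mu; rewrite pf; apply: funiq => // w _; rewrite subrr dot0l.
exists p; split => // [|u]; last by rewrite pf; case: (fP u).
split; first by apply: bop_ext => u; rewrite bopE pid // pf; case: (fP u).
move=> u v; rewrite !pf fd [dot u _]dotC [dot (f v) u]fd -dotC //.
Qed.

Lemma riesz (f : H -> R[i]) (K : R) :
  (forall c u v, f (c *: u + v) = c * f u + f v) ->
  (forall u, complex.Re `|f u| <= K * nm u) -> exists v, forall u, f u = dot u v.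
Proof.
move=> fl fb.
have f0 : f 0 = 0.
  by apply: Re_norm_eq0; apply: le_trans (fb 0) _; rewrite nm0 mulr0.
have fD u v : f (u + v) = f u + f v by rewrite -[u]scale1r fl mul1r scale1r.
have fZ c u : f (c *: u) = c * f u by rewrite -[c *: u]addr0 fl f0 addr0.
have [all0|/existsNP[u0 fu0]] := pselect (forall u, f u = 0).
  by exists 0 => u; rewrite dot0r all0.
have sM : subspace [set u | f u = 0].
  split=> //= [c u v hu hv|s l hs sl]; first by rewrite fl hu hv mulr0 addr0.
  apply: Re_norm_eq0.
  apply/ler_addgt0Pl => e e0; rewrite addr0.
  have [|N hN] := sl (e / (`|K| + 1)); first by rewrite divr_gt0 // ltr_wpDl.
  have := hN N (leqnn N); rewrite ler_pdivlMr ?ltr_wpDl // => h; apply: le_trans h.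
  have -> : f l = f (l - s N) by rewrite addrC -scaleN1r fl hs mulr0 add0r.
  apply: le_trans (fb _) _; rewrite nm_distC mulrC; apply: ler_wpM2l => //.
  by apply: le_trans (ler_norm _) _; rewrite lerDl.
have [v /= Mv hv] := proj_thm u0 sM.
set z := u0 - v; have fz : f z = f u0 by rewrite /z addrC -scaleN1r fl Mv mulr0 add0r.
have zn0 : z != 0 by apply: contra_notN fu0 => /eqP z0; rewrite -fz z0.
have dz : dot z z != 0.
  by rewrite dot_norm expf_neq0 // normr_eq0.
exists (Num.conj (f z / dot z z) *: z) => u.
(* This combination lies in the kernel of [f], hence is orthogonal to [z]; solving for [f u] gives
   the formula. *)
have := hv (f z *: u - f u *: z); rewrite /= addrC -scaleNr fl fZ.
rewrite mulNr (mulrC (f u)) addNr => /(_ erefl); rewrite -/z dotC => /(congr1 Num.conj).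
rewrite rmorph0 conjCK scaleNr dotDl dotNl !dotZl => /eqP; rewrite addrC subr_eq0 => /eqP e.
by rewrite dotZr conjCK mulrAC e mulfK.
Qed.

Lemma adj_ex x : exists y : B, adjoint x y.
Proof.
have [K K0 hK] := bop_bounded x.
have ex v : exists w, forall u, dot (x u) v = dot u w.
  apply: (@riesz (fun u => dot (x u) v) (K * nm v)) => [c u w|u].
    by rewrite opD opZ dotDl dotZl.
  by apply: le_trans (dot_CS _ _) _; rewrite mulrAC ler_wpM2r.
have [f fP] := choice ex.
have funiq v w : (forall u, dot (x u) v = dot u w) -> f v = w.
  move=> h; apply/eqP; rewrite -subr_eq0; apply/eqP/rd_eq0 => u.
  by rewrite rdC /rd dotBr -fP h subrr.
have [|u|y yf] := @mk_bop f K.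
- move=> c u v; apply: funiq => w.
  by rewrite !dotDr !dotZr !fP.
- have := rdE (f u); rewrite {1}/rd -fP -/(rd _ _) => e.
  have := rd_le (x (f u)) u; rewrite e => h.
  have := le_trans h (ler_wpM2r (nm_ge0 u) (hK (f u))).
  rewrite mulrAC expr2; have [->//|fn0] := eqVneq (nm (f u)) 0.
    by rewrite mulr_ge0 // ltW.
  by rewrite ler_pM2r // lt_def fn0 nm_ge0.
by exists y => u v; rewrite yf fP.
Qed.

Definition adj x : B := projT1 (cid (adj_ex x)).
Lemma adjP x : adjoint x (adj x). Proof. exact: projT2 (cid (adj_ex x)). Qed.
Lemma adj_unique x y : adjoint x y -> y = adj x.
Proof.
move=> h; apply: bop_ext => v; apply/eqP; rewrite -subr_eq0; apply/eqP/rd_eq0 => u.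
by rewrite rdC /rd dotBr -h -adjP subrr.
Qed.
Lemma dot_adj x u v : dot (x u) v = dot u (adj x v). Proof. exact: adjP. Qed.
Lemma dot_adjr x u v : dot u (x v) = dot (adj x u) v.
Proof. by rewrite dotC dot_adj -dotC. Qed.
Lemma rd_adj x u v : rd (x u) v = rd u (adj x v). Proof. by rewrite /rd dot_adj. Qed.
Lemma rd_adjr x u v : rd u (x v) = rd (adj x u) v. Proof. by rewrite /rd dot_adjr. Qed.
Lemma adj_rd x y : (forall u v, rd (x u) v = rd u (y v)) -> y = adj x.
Proof.
move=> h; apply: adj_unique => u v; apply: rd_dot => c.
by rewrite -h opZ.
Qed.
Lemma adjK x : adj (adj x) = x.
Proof. by apply/esym/adj_rd => u v; rewrite rdC -rd_adj rdC. Qed.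
Lemma adjM x y : adj (x * y) = adj y * adj x.
Proof. by apply/esym/adj_rd => u v; rewrite !bopE !rd_adj. Qed.
Lemma adjD x y : adj (x + y) = adj x + adj y.
Proof. by apply/esym/adj_rd => u v; rewrite !bopE rdDl rdDr !rd_adj. Qed.
Lemma adjN x : adj (- x) = - adj x.
Proof. by apply/esym/adj_rd => u v; rewrite !bopE rdNl rdNr !rd_adj. Qed.
Lemma adjB x y : adj (x - y) = adj x - adj y.
Proof. by rewrite adjD adjN. Qed.
Lemma adjZ r x : adj (r%:C *: x) = r%:C *: adj x.
Proof. by apply/esym/adj_rd => u v; rewrite !bopE rdZl rdZr !rd_adj. Qed.
Lemma adj1 : adj (1 : B) = 1.
Proof. by apply/esym/adj_rd => u v. Qed.
Lemma adj0 : adj (0 : B) = 0.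
Proof. by apply/esym/adj_rd => u v; rewrite rd0l rd0r. Qed.
Lemma adj_self x : adjoint x x -> adj x = x.
Proof. by move=> /adj_unique. Qed.
Lemma self_adj x : adj x = x -> adjoint x x.
Proof. by move=> e u v; rewrite dot_adj e. Qed.
End Operators.

(** * Positive operators and projections *)

Section PositiveOperators.
Context {R : realType} {H : hilbertType R}.
Local Notation B := (bop H).
Implicit Types (u v w : H) (r : R) (x y z p b d : B).

(** Over the complex numbers a nonnegative form forces self-adjointness, see [positive_opP];
    recording it separately leaves only the real form to be tested. *)
Definition pos x := adj x = x /\ forall u, 0 <= rd (x u) u.

Lemma pos_sa x : pos x -> adj x = x. Proof. by case. Qed.
Lemma pos_rd x u : pos x -> 0 <= rd (x u) u. Proof. by case. Qed.

Lemma positive_opP x : positive_op x <-> pos x.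
Proof.
split=> [hx|[xs hx] u]; last first.
  rewrite lecE /= hx andbT; apply/eqP.
  have : dot (x u) u = Num.conj (dot (x u) u) by rewrite -dotC dot_adj xs.
  by case: (dot (x u) u) => a b' /= [] /eqP; rewrite -subr_eq0 opprK -mulr2n mulrn_eq0 /= => /eqP.
have im u : rd (x u) ('i%C *: u) = 0.
  by rewrite -Im_dot (ger0_Im (hx u)).
split=> [|u]; last by have := hx u; rewrite lecE => /andP[].
apply/esym/adj_rd => u v.
(* Polarisation: the form is real at [u - i v], which compares [rd (x u) v] with [rd (x v) u]. *)
have := im (u + (- 'i%C) *: v); rewrite opD opZ !scalerDr rdDl !rdDr im add0r scalerA.
have -> : 'i%C * - 'i%C = 1 :> R[i] by rewrite mulrN -expr2 sqr_i opprK.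
rewrite scale1r scaleNr !rdNl rdi (rdC (x v)).
have -> : rd ('i%C *: x v) v = 0 by rewrite -rdi scalerA -expr2 sqr_i scaleN1r rdNl im oppr0.
by rewrite oppr0 addr0 => /eqP; rewrite subr_eq0 => /eqP.
Qed.

Lemma pos0 : pos 0. Proof. by split=> [|u]; rewrite ?adj0 // rd0l. Qed.
Lemma pos1 : pos 1. Proof. by split=> [|u]; rewrite ?adj1 // bop1E rdE sqr_ge0. Qed.
Lemma posD x y : pos x -> pos y -> pos (x + y).
Proof.
move=> [xs hx] [ys hy]; split=> [|u]; first by rewrite adjD xs ys.
by rewrite bopE rdDl addr_ge0.
Qed.
Lemma posZ r x : 0 <= r -> pos x -> pos (r%:C *: x).
Proof.
move=> r0 [xs hx]; split=> [|u]; first by rewrite adjZ xs.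
by rewrite bopE rdZl mulr_ge0.
Qed.
Lemma pos_sum (I : Type) (s : seq I) (P : pred I) (F : I -> B) :
  (forall i, P i -> pos (F i)) -> pos (\sum_(i <- s | P i) F i).
Proof. by move=> h; apply: big_ind => //; [exact: pos0 | exact: posD]. Qed.
Lemma pos_conj x y : pos x -> pos (adj y * x * y).
Proof.
move=> [xs hx]; split=> [|u]; first by rewrite !adjM adjK xs mulrA.
by rewrite !bopE rd_adj adjK.
Qed.
Lemma pos_sqr x : pos (adj x * x).
Proof. by have := pos_conj x pos1; rewrite mulr1. Qed.
Lemma rd_sqr x u : rd ((adj x * x) u) u = nm (x u) ^+ 2.
Proof. by rewrite bopE rd_adj adjK rdE. Qed.

Lemma pos_le_trans x y z : pos (y - x) -> pos (z - y) -> pos (z - x).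
Proof. by move=> h1 h2; rewrite -(subrKA y) addrC; apply: posD. Qed.

Lemma pos_CS x u v : pos x -> rd (x u) v ^+ 2 <= rd (x u) u * rd (x v) v.
Proof.
move=> [xs hx]; apply: quad_discr => // t.
have := hx (u + t%:C *: v); rewrite opD opZ !rdDl !rdDr !rdZl !rdZr.
by rewrite (rd_adj x v) xs (rdC v); lra.
Qed.

(** This is [x ^ 2 <= x]: Cauchy-Schwarz for the form of [x] at [u] and [x u] bounds the fourth
    power of [nm (x u)], and [x <= 1] absorbs one square. *)
Lemma contr_sq x u : pos x -> pos (1 - x) -> nm (x u) ^+ 2 <= rd (x u) u.
Proof.
move=> px p1; have h := pos_CS u (x u) px.
have h1 := pos_rd (x u) p1; rewrite bopE rdBl rdE in h1.
have h0 := pos_rd u px; rewrite rdE in h.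
have [->//|n0] := eqVneq (nm (x u)) 0; first by rewrite expr0n.
have np : 0 < nm (x u) ^+ 2 by rewrite exprn_gt0 // lt_def n0 nm_ge0.
rewrite -(ler_pM2r np) -expr2; apply: le_trans h _.
by apply: ler_wpM2l => //; rewrite -subr_ge0.
Qed.
Lemma contr_nm x u : pos x -> pos (1 - x) -> nm (x u) <= nm u.
Proof.
move=> px p1; have h := contr_sq u px p1.
have h1 := pos_rd u p1; rewrite bopE rdBl rdE in h1.
by apply: ler_of_sqr => //; lra.
Qed.

Lemma mono_cauchy (a : nat -> R) (K : R) : (forall n, a n <= a n.+1) -> (forall n, a n <= K) ->
  forall e, 0 < e -> exists N, forall m, (N <= m)%N -> a m - a N <= e.
Proof.
move=> am aK e e0; have hs : has_sup (range a).
  by split; [exists (a 0%N); exists 0%N | exists K => _ [n _ <-]].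
have [_ [N _ <-] hN] := sup_adherent e0 hs.
exists N => m _; have : a m <= sup (range a).
  by apply: ub_le_sup; [case: hs | exists m].
lra.
Qed.

(** The forms converge as bounded monotone sequences, and [contr_sq] applied to the differences
    upgrades this to strong convergence. *)
Lemma mono_lim (s : nat -> B) : (forall n, pos (s n)) ->
  (forall n, pos (s n.+1 - s n)) -> (forall n, pos (1 - s n)) ->
  exists l : B, forall u, ncvg (fun n => s n u) (l u).
Proof.
move=> s0 si s1.
have sle m n : (m <= n)%N -> pos (s n - s m).
  elim: n => [|n ih]; first by rewrite leqn0 => /eqP ->; rewrite subrr; exact: pos0.
  rewrite leq_eqVlt => /predU1P[->|]; first by rewrite subrr; exact: pos0.
  by rewrite ltnS => /ih h; apply: pos_le_trans h (si n).
have cau u : forall e : R, 0 < e -> exists N, forall m n, (N <= m)%N -> (N <= n)%N ->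
     nm (s m u - s n u) <= e.
  move=> e e0.
  have [|||N hN] := @mono_cauchy (fun n => rd (s n u) u) (nm u ^+ 2) _ _ ((e / 2) ^+ 2).
  - by move=> n; have := pos_rd u (si n); rewrite bopE rdBl subr_ge0.
  - by move=> n; have := pos_rd u (s1 n); rewrite bopE rdBl subr_ge0 rdE.
  - by rewrite exprn_gt0 // divr_gt0.
  have q m : (N <= m)%N -> nm (s m u - s N u) <= e / 2.
    move=> Nm; apply: ler_of_sqr; first by rewrite ltW // divr_gt0.
    have p1 := sle _ _ Nm; have p2 : pos (1 - (s m - s N)).
      by rewrite opprB addrA addrAC; apply: posD.
    have := contr_sq u p1 p2; rewrite bopE => /le_trans; apply.
    by rewrite rdBl hN.
  exists N => m n Nm Nn.
  rewrite -(subrKA (s N u)) (splitr e); apply: le_trans (nm_triangle _ _) _.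
  by apply: lerD; rewrite ?q // nm_distC q.
have [f fP] := choice (fun u => ncomplete (cau u)).
have snm n u : nm (s n u) <= nm u by apply: contr_nm.
have [|u|l lf] := @mk_bop _ _ f 1.
- move=> c u v; apply: ncvg_unique (fP _) _ => e e0.
  have c0 : 0 < complex.Re `|c| + 1 by rewrite ltr_wpDl ?Re_norm_ge0.
  have [|N hN] := fP u (e / 2 / (complex.Re `|c| + 1)); first by rewrite !divr_gt0.
  have [|N' hN'] := fP v (e / 2); first by rewrite divr_gt0.
  exists (maxn N N') => n; rewrite geq_max => /andP[n1 n2].
  have -> : s n (c *: u + v) - (c *: f u + f v) = c *: (s n u - f u) + (s n v - f v).
    by rewrite opD opZ scalerBr opprD addrACA.
  apply: le_trans (nm_triangle _ _) _; rewrite nm_cZ (splitr e) lerD ?hN' //.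
  have := hN _ n1; rewrite ler_pdivlMr // => h; apply: le_trans h.
  by rewrite mulrC; apply: ler_wpM2l => //; rewrite lerDl.
- rewrite mul1r; apply/ler_addgt0Pl => e e0; have [N hN] := fP u e e0.
  have := hN N (leqnn N); rewrite nm_distC => h.
  rewrite -[f u](subrK (s N u)); apply: le_trans (nm_triangle _ _) _.
  exact: lerD.
by exists l => u; rewrite lf.
Qed.

Lemma ncvg_rd_ge (s : nat -> H) l v (K : R) : ncvg s l -> (forall n, K <= rd (s n) v) -> K <= rd l v.
Proof.
move=> sl h; apply/ler_addgt0Pl => e e0; have [N hN] := ncvg_rd v sl e0.
have := hN N (leqnn N); have := h N; rewrite ler_norml => ? /andP[]; lra.
Qed.
Lemma ncvg_eq_rd (s t : nat -> H) l m u v : ncvg s l -> ncvg t m ->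
  (forall n, rd (s n) u = rd (t n) v) -> rd l u = rd m v.
Proof.
move=> sl tm h; apply/eqP; rewrite -subr_eq0 -normr_le0; apply/ler_addgt0Pl => e e0.
have e2 : 0 < e / 2 by rewrite divr_gt0.
have [N hN] := ncvg_rd u sl e2; have [N' hN'] := ncvg_rd v tm e2.
have := hN _ (leq_maxl N N'); have := hN' _ (leq_maxr N N').
rewrite -h !ler_norml => /andP[? ?] /andP[? ?]; apply/andP; split; lra.
Qed.

Lemma pos_lim (s : nat -> B) x : (forall n, pos (s n)) ->
  (forall u, ncvg (fun n => s n u) (x u)) -> pos x.
Proof.
move=> hs sx; split=> [|u]; last by apply: ncvg_rd_ge (sx u) _ => n; exact: pos_rd.
apply/esym/adj_rd => u v; rewrite [RHS]rdC; apply: ncvg_eq_rd (sx u) (sx v) _ => n.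
by rewrite rd_adj (pos_sa (hs n)) rdC.
Qed.
Lemma comm_lim (s : nat -> B) x b : (forall n, b * s n = s n * b) ->
  (forall u, ncvg (fun n => s n u) (x u)) -> b * x = x * b.
Proof.
move=> h sx; apply: bop_ext => u; rewrite !bopE.
apply: (@ncvg_unique _ _ (fun n => b (s n u))); first exact: op_ncvg.
move=> e e0; have [N hN] := sx (b u) e e0; exists N => n /hN.
by have := congr1 (fun y : B => y u) (h n); rewrite !bopE => ->.
Qed.

(* Polynomials with nonnegative coefficients in one operator. *)
Inductive ppoly d : B -> Prop :=
| pp0 : ppoly d 0
| ppX n : ppoly d (d ^+ n)
| ppD x y : ppoly d x -> ppoly d y -> ppoly d (x + y)
| ppZ r x : 0 <= r -> ppoly d x -> ppoly d (r%:C *: x).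

Lemma pp_mul d x y : ppoly d x -> ppoly d y -> ppoly d (x * y).
Proof.
elim=> [|n|x1 x2 _ h1 _ h2|r x1 r0 _ h1] hy.
- by rewrite mul0r; exact: pp0.
- elim: hy => [|m|y1 y2 _ h1 _ h2|r y1 r0 _ h1].
  + by rewrite mulr0; exact: pp0.
  + by rewrite -exprD; exact: ppX.
  + by rewrite mulrDr; exact: ppD.
  + by rewrite bopZr; exact: ppZ.
- by rewrite mulrDl; apply: ppD; auto.
- by rewrite bopZl; apply: ppZ; auto.
Qed.
Lemma pos_expr d n : pos d -> pos (d ^+ n).
Proof.
move=> pd; suff : pos (d ^+ n) /\ pos (d ^+ n.+1) by case.
elim: n => [|n [h1 h2]]; first by rewrite expr0 expr1; split => //; exact: pos1.
split=> //; rewrite exprS exprSr mulrA -{1}(pos_sa pd); exact: pos_conj.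
Qed.
Lemma pp_pos d x : pos d -> ppoly d x -> pos x.
Proof.
move=> pd; elim=> [|n|x1 x2 _ h1 _ h2|r x1 r0 _ h1].
- exact: pos0.
- exact: pos_expr.
- exact: posD.
- exact: posZ.
Qed.
Lemma pp_comm d x b : b * d = d * b -> ppoly d x -> b * x = x * b.
Proof.
move=> bd; elim=> [|n|x1 x2 _ h1 _ h2|r x1 r0 _ h1].
- by rewrite mulr0 mul0r.
- elim: n => [|n ih]; first by rewrite expr0 mulr1 mul1r.
  by rewrite exprS mulrA bd -mulrA ih mulrA.
- by rewrite mulrDr mulrDl h1 h2.
- by rewrite bopZr bopZl h1.
Qed.

Lemma halfD (V : lmodType R[i]) (a : V) : (2^-1 : R)%:C *: a + (2^-1 : R)%:C *: a = a.
Proof.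
rewrite -scalerDl -rmorphD /= (_ : (2^-1 : R) + 2^-1 = 1) ?scale1r //; lra.
Qed.

Section Sqrt.
Variable d : B.
Hypotheses (d0 : pos d) (d1 : pos (1 - d)).
Let h2 : R := 2^-1.
(** The operator [s = 1 - sqrt (1 - d)] solves [s = (d + s * s) / 2]; this is the iteration of that
    equation from 0. *)
Fixpoint sqs n : B := if n is m.+1 then h2%:C *: (d + sqs m * sqs m) else 0.
Let h20 : 0 <= h2. Proof. by rewrite invr_ge0. Qed.

Lemma sqsS n : sqs n.+1 = h2%:C *: (d + sqs n * sqs n). Proof. by []. Qed.
Lemma sqs_pp n : ppoly d (sqs n).
Proof.
elim: n => [|n ih] /=; first exact: pp0.
by apply: ppZ => //; apply: ppD; [exact: (ppX d 1) | exact: pp_mul].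
Qed.
(** A difference of squares is factored into polynomials in [d] with nonnegative coefficients. Such
    polynomials are tracked because positivity of products of commuting positive operators,
    [pos_mul], is itself deduced from square roots. *)
Lemma sqs_incr n : ppoly d (sqs n.+1 - sqs n).
Proof.
elim: n => [|n ih].
  rewrite /= subr0 mulr0 addr0; apply: ppZ => //; exact: (ppX d 1).
have -> : sqs n.+2 - sqs n.+1 = h2%:C *: ((sqs n.+1 - sqs n) * sqs n.+1 + sqs n * (sqs n.+1 - sqs n)).
  rewrite mulrBl mulrBr addrA subrK /= -scalerBr; congr (_ *: _).
  by rewrite opprD addrACA subrr add0r.
by apply: ppZ => //; apply: ppD; apply: pp_mul => //; exact: sqs_pp.
Qed.
Lemma sqs_le1 n : pos (1 - sqs n).
Proof.
elim: n => [|n ih]; first by rewrite subr0; exact: pos1.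
have pn := pp_pos d0 (sqs_pp n).
have -> : 1 - sqs n.+1 = h2%:C *: ((1 - d) + (1 - sqs n * sqs n)).
  by rewrite -{1}(halfD (1 : B)) /= -scalerDr -scalerBr; congr (_ *: _); rewrite opprD addrACA.
apply: posZ => //; apply: posD => //; split=> [|u].
  by rewrite adjB adj1 adjM (pos_sa pn).
rewrite !bopE rdBl rdE rd_adj (pos_sa pn) rdE.
have := contr_sq u pn ih; have := pos_rd u ih; rewrite !bopE rdBl rdE; lra.
Qed.

Lemma sqrt_contr : exists s, [/\ pos s, s * s = 1 - d & forall b, b * d = d * b -> b * s = s * b].
Proof.
have [l hl] := mono_lim (fun n => pp_pos d0 (sqs_pp n)) (fun n => pp_pos d0 (sqs_incr n)) sqs_le1.
have l0 : pos l := pos_lim (fun n => pp_pos d0 (sqs_pp n)) hl.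
have l1 : pos (1 - l).
  apply: (pos_lim sqs_le1) => u e e0; have [N hN] := hl u e e0.
  by exists N => n /hN; rewrite !bopE opprB [u - _ + _]addrC subrKA nm_distC.
have el : l = h2%:C *: (d + l * l).
  apply: bop_ext => u; apply: (@ncvg_unique _ _ (fun n => sqs n.+1 u)).
    by move=> e e0; have [N hN] := hl u e e0; exists N => n nN; apply: hN; exact: leqW.
  move=> e e0; have [N hN] := hl u e e0; have [N' hN'] := hl (l u) e e0.
  exists (maxn N N') => n; rewrite geq_max => /andP[n1 n2].
  rewrite sqsS !bopE -scalerBr opprD addrACA subrr add0r nmZ gtr0_norm ?invr_gt0 //.
  rewrite -(subrKA (sqs n (l u))) -opB.
  have := contr_nm (sqs n u - l u) (pp_pos d0 (sqs_pp n)) (sqs_le1 n).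
  have := nm_triangle (sqs n (sqs n u - l u)) (sqs n (l u) - l (l u)).
  have := hN _ n1; have := hN' _ n2; rewrite /h2; lra.
exists (1 - l); split=> //.
  rewrite mulrBl mul1r mulrBr mulr1 opprB.
  have e2 : l + l = d + l * l by rewrite {1 2}el halfD.
  have -> : 1 - l + (l * l - l) = 1 + (l * l - (l + l)) by rewrite -addrA; congr (_ + _); rewrite opprD addrCA.
  by rewrite e2; congr (_ + _); rewrite opprD addrCA subrr addr0.
move=> b bd; rewrite mulrBr mulrBl mulr1 mul1r; congr (_ - _).
by apply: (comm_lim _ hl) => n; apply: pp_comm (sqs_pp n).
Qed.
End Sqrt.

Lemma pos_bound x : adj x = x -> exists2 K : R, 0 < K & pos (K%:C *: (1 : B) - x).
Proof.
move=> xs; have [K K0 hK] := bop_bounded x; exists K => //; split=> [|u].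
  by rewrite adjB adjZ adj1 xs.
rewrite !bopE rdBl rdZl rdE subr_ge0; apply: le_trans (rd_le _ _) _.
by rewrite expr2 mulrA; apply: ler_wpM2r.
Qed.

Lemma sqrt_ex x : pos x -> exists s, [/\ pos s, s * s = x & forall b, b * x = x * b -> b * s = s * b].
Proof.
move=> px; have [K K0 hK] := pos_bound (pos_sa px).
have iK : 0 <= K^-1 by rewrite invr_ge0 ltW.
(* Since [x <= K], this [d] lies between 0 and 1, and [1 - d] is [x / K]. *)
have [||s [ps ss sc]] := @sqrt_contr (1 - K^-1%:C *: x).
- have := posZ iK hK; rewrite scalerBr scalerA -rmorphM /= mulVf ?gt_eqF // scale1r //.
- by rewrite opprB addrC subrK; exact: posZ.
rewrite opprB addrC subrK in ss.
exists ((Num.sqrt K)%:C *: s); split.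
- by apply: posZ => //; exact: sqrtr_ge0.
- rewrite bopZl bopZr ss !scalerA -!rmorphM /= -expr2 sqr_sqrtr ?ltW // divff ?gt_eqF //.
  by rewrite scale1r.
- move=> b bx; rewrite bopZr bopZl sc // mulrBr mulrBl mulr1 mul1r; congr (_ - _).
  by rewrite bopZr bopZl bx.
Qed.

(** The product equals [s * y * s] for the square root [s] of [x], which commutes with [y]. *)
Lemma pos_mul x y : pos x -> pos y -> x * y = y * x -> pos (x * y).
Proof.
move=> px py xy; have [s [ps ss sc]] := sqrt_ex px.
rewrite -[x in pos (x * y)]ss.
rewrite -mulrA -(sc y); last by rewrite xy.
rewrite mulrA -{1}(pos_sa ps); exact: pos_conj.
Qed.

(** Any positive root [z] of [x * x] is compared with the root [s] that commutes with everything
    [x * x] does, so [(z + s) * (z - s) = 0]. For [v] in the range of [z - s], the forms of [z] and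
    [s] at [v] add up to 0; hence both operators kill [v], and [v = 0]. *)
Lemma sqrt_unique x y : pos x -> pos y -> x * x = y * y -> x = y.
Proof.
move=> px py e; have [s [ps ss sc]] := sqrt_ex (pos_sqr x).
rewrite (pos_sa px) in ss sc.
have key z : pos z -> z * z = x * x -> z = s.
  move=> pz zz.
  have zs : z * s = s * z by apply: sc; rewrite -zz mulrA.
  apply/eqP; rewrite -subr_eq0; apply/eqP; apply: bop_ext => u.
  set v := (z - s) u.
  have e0 : (z + s) v = 0.
    have : (z + s) * (z - s) = 0.
      by rewrite mulrDl !mulrBr ss zz zs addrA subrK subrr.
    by move=> /(congr1 (fun y : B => y u)); rewrite bopE.
  have h : rd (z v) v + rd (s v) v = 0 by rewrite -rdDl -bopD e0 rd0l.
  have hz := pos_rd v pz; have hs := pos_rd v ps.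
  have z0 t : pos t -> rd (t v) v = 0 -> t v = 0.
    move=> pt t0; apply: nm0_eq0; apply/eqP; rewrite -sqrf_eq0 -rdE -sqrf_eq0 eq_le sqr_ge0 andbT.
    by have := pos_CS v (t v) pt; rewrite t0 mul0r.
  have zv : z v = 0 by apply: z0 => //; lra.
  have sv : s v = 0 by apply: z0 => //; lra.
  apply: nm0_eq0; apply/eqP; rewrite -sqrf_eq0 -rdE -/v {2}/v bopE rdBr !(rdC v).
  by rewrite !rd_adj (pos_sa pz) (pos_sa ps) !(rdC u) zv sv !rd0l subrr.
by rewrite (key x) // (key y).
Qed.

(** The lower bound makes the range closed, and triviality of its orthogonal complement makes it
    dense. The statement is about relations so that it covers the graph of the unbounded [1 + rho]
    in [resolvent_ex] as well as bounded operators. *)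
Lemma closed_surj (G : H -> H -> Prop) (K : R) : 0 <= K -> G 0 0 ->
  (forall (c : R[i]) u v w w1, G u w -> G v w1 -> G (c *: u + v) (c *: w + w1)) ->
  (forall s t u w, (forall n, G (s n) (t n)) -> ncvg s u -> ncvg t w -> G u w) ->
  (forall u w, G u w -> nm u <= K * nm w) ->
  (forall v, (forall u w, G u w -> dot w v = 0) -> v = 0) ->
  forall w, exists u, G u w.
Proof.
move=> K0 G0 Gl Gc Gb Go w.
have sM : subspace [set w | exists u, G u w].
  split=> [|c w1 w2 [u1 h1] [u2 h2]|t l /= ht tl]; first by exists 0.
    by exists (c *: u1 + u2); exact: Gl.
  have [s hs] := choice ht.
  have [u su] : exists u, ncvg s u.
    apply: ncomplete => e e0.
    have [|N hN] := tl (e / (2 * (K + 1))); first by rewrite divr_gt0 // mulr_gt0 // ltr_wpDl.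
    exists N => m n Nm Nn.
    have gd : G (s m - s n) (t m - t n).
      by have := Gl (-1) _ _ _ _ (hs n) (hs m); rewrite !scaleN1r ![- _ + _]addrC.
    apply: le_trans (Gb _ _ gd) _.
    rewrite -(subrKA l).
    have a1 := nm_triangle (t m - l) (l - t n).
    have a2 := hN _ Nm; have := hN _ Nn; rewrite nm_distC => a3.
    have a4 : nm (t m - l + (l - t n)) <= e / (K + 1).
      apply: le_trans a1 _; apply: le_trans (lerD a2 a3) _.
      by rewrite le_eqVlt; apply/orP; left; apply/eqP; field; rewrite gt_eqF // ltr_wpDl.
    apply: le_trans (ler_wpM2l K0 a4) _.
    by rewrite mulrA ler_pdivrMr ?ltr_wpDl // mulrC; apply: ler_wpM2l; [exact: ltW | rewrite lerDl].
  by exists u; apply: Gc hs su tl.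
have [v [u hu] hv] := proj_thm w sM.
exists u; suff : w - v = 0 by move=> /eqP; rewrite subr_eq0 => /eqP ->.
apply: Go => u' w' g; rewrite dotC hv ?rmorph0 //; by exists u'.
Qed.

Lemma inv_ex x (c : R) : 0 < c -> pos (x - c%:C *: (1 : B)) ->
  exists y, [/\ x * y = 1, y * x = 1, pos y & forall b, b * x = x * b -> b * y = y * b].
Proof.
move=> c0 px.
have xs : adj x = x.
  by have := pos_sa px; rewrite adjB adjZ adj1 => /addIr.
have lb u : c * nm u <= nm (x u).
  have := pos_rd u px; rewrite !bopE rdBl rdZl rdE subr_ge0 => h.
  have := le_trans h (rd_le _ _); rewrite expr2 mulrA.
  have [->|n0] := eqVneq (nm u) 0; first by move=> _; rewrite mulr0.
  by rewrite ler_pM2r // lt_def n0 nm_ge0.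
have ex w : exists u, x u = w.
  apply: (@closed_surj (fun u w => x u = w) c^-1) => //.
  - by rewrite invr_ge0 ltW.
  - exact: op0.
  - by move=> d u v w1 w2 <- <-; rewrite opD opZ.
  - move=> s t u w' h su tw; apply: (@ncvg_unique _ _ t) => //.
    have := op_ncvg x su; move=> h' e e0; have [N hN] := h' e e0.
    by exists N => n /hN; rewrite h.
  - by move=> u _ <-; rewrite ler_pdivlMl.
  - move=> v hv; apply: nm0_eq0; apply/eqP; rewrite eq_le nm_ge0 andbT.
    have xv : x v = 0.
      by apply: rd_eq0 => u; rewrite rdC -{1}xs -rd_adj /rd (hv u) .
    by have := lb v; rewrite xv nm0 pmulr_rle0.
have [f fP] := choice ex.
have xi u v : x u = x v -> u = v.
  move=> e; apply/eqP; rewrite -subr_eq0; apply/eqP/nm0_eq0/eqP; rewrite eq_le nm_ge0 andbT.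
  by have := lb (u - v); rewrite opB e subrr nm0 pmulr_rle0.
have [|u|y yf] := @mk_bop _ _ f c^-1.
- by move=> d u v; apply: xi; rewrite opD opZ !fP.
- by rewrite ler_pdivlMl // -{2}(fP u).
have xy : x * y = 1 by apply: bop_ext => u; rewrite !bopE yf fP.
have yx : y * x = 1 by apply: bop_ext => u; rewrite !bopE yf; apply: xi; rewrite fP.
have px' : pos x.
  by rewrite -[x](subrK (c%:C *: (1 : B))); apply: posD => //; apply: posZ (ltW c0) pos1.
exists y; split=> // [|b bx]; last first.
  by rewrite -[LHS]mul1r -yx -mulrA (mulrA x) -bx -!mulrA xy mulr1.
have ys : adj y = y.
  have := congr1 (@adj _ _) xy; rewrite adjM xs adj1 => e.
  by rewrite -[adj y]mulr1 -xy mulrA e mul1r.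
split=> // u; rewrite -{2}(bop1E u) -xy bopM rdC; exact: pos_rd.
Qed.

Definition proj p := p * p = p /\ adj p = p.
Lemma projP p : projection p <-> proj p.
Proof. by split=> -[pp ps]; split=> //; [exact: adj_self | exact: self_adj]. Qed.
Lemma proj_pos p : proj p -> pos p.
Proof. by case=> pp ps; rewrite -pp -{1}ps; exact: pos_sqr. Qed.
Lemma proj0 : proj 0. Proof. by split; rewrite ?mulr0 ?adj0. Qed.
Lemma proj1 : proj 1. Proof. by split; rewrite ?mulr1 ?adj1. Qed.
Lemma projC p : proj p -> proj (1 - p).
Proof.
move=> [pp ps]; split; last by rewrite adjB adj1 ps.
by rewrite mulrBl mul1r mulrBr mulr1 pp subrr subr0.
Qed.
Lemma proj_rd p u : proj p -> rd (p u) u = nm (p u) ^+ 2.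
Proof. by case=> pp ps; rewrite -{1}pp bopE rd_adj ps rdE. Qed.
Lemma proj_nm p u : proj p -> nm (p u) <= nm u.
Proof. by move=> pp; apply: contr_nm; [exact: proj_pos | exact/proj_pos/projC]. Qed.
Lemma proj_mul p q : proj p -> proj q -> p * q = q * p -> proj (p * q).
Proof.
move=> [pp ps] [qq qs] pq; split; last by rewrite adjM ps qs.
by rewrite mulrA -(mulrA p) -pq mulrA pp -mulrA qq.
Qed.

(* The positive part of [x] is supported on the complement of [ker (|x| + x)]. *)
Lemma spectral_cut x : adj x = x -> exists e,
  [/\ proj e, forall b, b * x = x * b -> b * e = e * b,
     pos (x * e) & pos (- (x * (1 - e)))].
Proof.
move=> xs; have [s [ps ss sc]] := sqrt_ex (pos_sqr x).
rewrite xs in ss sc.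
have sx : x * s = s * x by apply: sc; rewrite mulrA.
set t := s + x.
have sM : subspace [set u | t u = 0].
  split=> [|c u v hu hv|f l hf fl]; first exact: (op0 t).
    by rewrite /mkset opD opZ hu hv scaler0 addr0.
  apply: (@ncvg_unique _ _ (fun n => t (f n))); first exact: op_ncvg.
  by move=> e e0; exists 0%N => n _; rewrite hf subrr nm0 ltW.
have [n [/projP pn nM nid]] := subspace_proj sM.
have tn : t * n = 0 by apply: bop_ext => u; rewrite bopE; exact: nM.
have comm b : b * x = x * b -> b * n = n * b.
  have half b' : b' * x = x * b' -> n * (b' * n) = b' * n.
    move=> bx; apply: bop_ext => u; rewrite !bopM; apply: nid; rewrite /mkset.
    have bs : b' * s = s * b' by apply: sc; rewrite mulrA bx -mulrA bx mulrA.
    have bt : t * b' = b' * t by rewrite mulrDl mulrDr bx bs.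
    by have := congr1 (fun y : B => y (n u)) bt; rewrite !bopM => ->; rewrite (nM u) op0.
  move=> bx; have h1 := half b bx.
  have h2 : n * (adj b * n) = adj b * n.
    by apply: half; have := congr1 (@adj _ _) bx; rewrite !adjM xs.
  by have := congr1 (@adj _ _) h2; rewrite !adjM adjK pn.2 -mulrA h1 => ->.
have xn := comm x erefl; have sn : s * n = n * s by apply: comm; rewrite sx.
(* Here [s] is the absolute value of [x]. The range of [s - x] lies in the kernel of [s + x], so [x]
   agrees with [s] on [1 - n], while it agrees with [- s] on [n]. *)
have tx : t * (s - x) = 0.
  by rewrite mulrDl !mulrBr ss sx addrA subrK subrr.
have nx : n * (s - x) = s - x.
  apply: bop_ext => u; rewrite bopM; apply: nid; rewrite /mkset.
  by have := congr1 (fun y : B => y u) tx; rewrite bopM.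
have pe := projC pn; exists (1 - n); split=> //.
- by move=> b bx; rewrite mulrBr mulrBl mulr1 mul1r comm.
- have -> : x * (1 - n) = adj (1 - n) * s * (1 - n).
    have h : (1 - n) * s = (1 - n) * x.
      by apply/eqP; rewrite -subr_eq0 -mulrBr mulrBl nx mul1r subrr.
    have xe : x * (1 - n) = (1 - n) * x by rewrite mulrBr mulrBl mulr1 mul1r xn.
    by rewrite pe.2 h -xe -mulrA pe.1.
  exact: pos_conj.
- have -> : - (x * (1 - (1 - n))) = adj n * s * n.
    have h : s * n = - (x * n) by apply/eqP; rewrite -addr_eq0 -mulrDl tn.
    rewrite opprB addrC subrK pn.2 -mulrA h mulrN mulrA -xn -mulrA pn.1 //.
  exact: pos_conj.
Qed.
End PositiveOperators.

(** * Traces *)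

Section Trace.
Context {R : realType} {H : hilbertType R}.
Local Notation B := (bop H).
Implicit Types (u v w : H) (r : R) (x y z p q b d e : B).

Lemma adjZi x : adj ('i%C *: x) = - ('i%C *: adj x).
Proof.
apply/esym/adj_unique => u v; rewrite !bopE dotZl dotNr dotZr dot_adj -mulNr; congr (_ * _).
by apply/eqP; rewrite eq_complex /= oppr0 opprK !eqxx.
Qed.

Context {A : set B} {tau : B -> R[i]}.
Hypotheses (vA : von_neumann_algebra A) (tA : tracial_state A tau).

Lemma vn_bicomm x : (forall b, commutant A b -> b * x = x * b) -> A x.
Proof. by move=> h; have [_ e] := vA; rewrite -e => b hb; rewrite h. Qed.
Lemma commutantP b x : commutant A b -> A x -> b * x = x * b.
Proof. by move=> h /h. Qed.
Lemma vn1 : A 1. Proof. by apply: vn_bicomm => b _; rewrite mulr1 mul1r. Qed.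
Lemma vn0 : A 0. Proof. by apply: vn_bicomm => b _; rewrite mulr0 mul0r. Qed.
Lemma vnD x y : A x -> A y -> A (x + y).
Proof.
move=> Ax Ay; apply: vn_bicomm => b hb.
by rewrite mulrDr mulrDl !(commutantP hb).
Qed.
Lemma vnZ (c : R[i]) x : A x -> A (c *: x).
Proof. by move=> Ax; apply: vn_bicomm => b hb; rewrite bopZl bopZr (commutantP hb). Qed.
Lemma vnN x : A x -> A (- x).
Proof. by move=> Ax; rewrite -scaleN1r; exact: vnZ. Qed.
Lemma vnB x y : A x -> A y -> A (x - y).
Proof. by move=> Ax Ay; apply: vnD => //; exact: vnN. Qed.
Lemma vnM x y : A x -> A y -> A (x * y).
Proof.
move=> Ax Ay; apply: vn_bicomm => b hb.
by rewrite mulrA (commutantP hb Ax) -!mulrA (commutantP hb Ay).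
Qed.
Lemma vn_adj x : A x -> A (adj x).
Proof. by move=> Ax; apply: vA.1 Ax _; exact: adjP. Qed.
Lemma vn_sum (I : Type) (s : seq I) (P : pred I) (F : I -> B) :
  (forall i, P i -> A (F i)) -> A (\sum_(i <- s | P i) F i).
Proof. by move=> h; apply: big_ind => //; [exact: vn0 | exact: vnD]. Qed.
(** By the double commutant; this is how square roots, inverses and spectral projections of elements
    of [A] are seen to lie in [A]. *)
Lemma vn_of_comm x y : A x -> (forall b, b * x = x * b -> b * y = y * b) -> A y.
Proof. by move=> Ax h; apply: vn_bicomm => b hb; apply: h; exact: commutantP. Qed.

Definition tr x : R := complex.Re (tau x).
Lemma tauD x y : A x -> A y -> tau (x + y) = tau x + tau y.
Proof. by case: tA => h _ _ _ Ax Ay; have := h 1 x y Ax Ay; rewrite scale1r mul1r. Qed.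
Lemma tau0 : tau 0 = 0.
Proof. by apply: (addrI (tau 0)); rewrite -tauD ?addr0 //; exact: vn0. Qed.
Lemma tauZ (c : R[i]) x : A x -> tau (c *: x) = c * tau x.
Proof. by case: tA => h _ _ _ Ax; have := h c x 0 Ax vn0; rewrite tau0 !addr0. Qed.
Lemma tauN x : A x -> tau (- x) = - tau x.
Proof. by move=> Ax; rewrite -scaleN1r tauZ // mulN1r. Qed.
Lemma tauB x y : A x -> A y -> tau (x - y) = tau x - tau y.
Proof. by move=> Ax Ay; rewrite tauD ?tauN //; exact: vnN. Qed.
Lemma trD x y : A x -> A y -> tr (x + y) = tr x + tr y.
Proof. by move=> Ax Ay; rewrite /tr tauD // ReD. Qed.
Lemma trZ r x : A x -> tr (r%:C *: x) = r * tr x.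
Proof. by move=> Ax; rewrite /tr tauZ // ReMr. Qed.
Lemma trN x : A x -> tr (- x) = - tr x.
Proof. by move=> Ax; rewrite /tr tauN // ReN. Qed.
Lemma trB x y : A x -> A y -> tr (x - y) = tr x - tr y.
Proof. by move=> Ax Ay; rewrite trD ?trN //; exact: vnN. Qed.
Lemma tr1 : tr 1 = 1. Proof. by rewrite /tr; case: tA => _ _ -> _. Qed.
Lemma tr0 : tr 0 = 0. Proof. by rewrite /tr tau0. Qed.
Lemma trC x y : A x -> A y -> tr (x * y) = tr (y * x).
Proof. by move=> Ax Ay; rewrite /tr; case: tA => _ _ _ ->. Qed.
Lemma tau_pos x : A x -> pos x -> 0 <= tau x.
Proof. by case: tA => _ h _ _ Ax /positive_opP; exact: h. Qed.
Lemma tr_pos x : A x -> pos x -> 0 <= tr x.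
Proof. by move=> Ax px; have /Re_le := tau_pos Ax px. Qed.
Lemma tau_tr x : A x -> pos x -> tau x = (tr x)%:C.
Proof.
move=> Ax px; have := tau_pos Ax px; rewrite /tr; case: (tau x) => a b'.
by rewrite lecE /= => /andP[/eqP -> _].
Qed.
Lemma tr_le x y : A x -> A y -> pos (y - x) -> tr x <= tr y.
Proof. by move=> Ax Ay h; rewrite -subr_ge0 -trB // tr_pos //; exact: vnB. Qed.

Lemma Im_tau_sa x : A x -> adj x = x -> complex.Im (tau x) = 0.
Proof.
move=> Ax xs; have [K K0 hK] := pos_bound xs.
have AK : A (K%:C *: (1 : B)) by apply/vnZ/vn1.
have := ger0_Im (tau_pos (vnB AK Ax) hK).
rewrite tauB // tauZ; last exact: vn1.
case: tA => _ _ -> _; rewrite mulr1.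
by case: (tau x) => a b' /=; rewrite add0r => /eqP; rewrite oppr_eq0 => /eqP.
Qed.
Lemma tr_adj x : A x -> tr (adj x) = tr x.
Proof.
move=> Ax; have Ax' := vn_adj Ax; have AB := vnB Ax Ax'.
have := @Im_tau_sa ('i%C *: (x - adj x)) (vnZ _ AB).
rewrite adjZi adjB adjK -scalerN opprB => /(_ erefl).
rewrite tauZ // tauB // /tr; case: (tau x) (tau (adj x)) => a b' [c d'] /=.
by rewrite mul0r mul1r add0r => /eqP; rewrite subr_eq0 => /eqP.
Qed.

Lemma vn_sqrt x : A x -> pos x -> exists s, [/\ A s, pos s & s * s = x].
Proof.
move=> Ax px; have [s [ps ss sc]] := sqrt_ex px.
by exists s; split=> //; exact: vn_of_comm Ax sc.
Qed.
Lemma tr_pos_mul x y : A x -> A y -> pos x -> pos y -> 0 <= tr (x * y).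
Proof.
move=> Ax Ay px py; have [s [As ps <-]] := vn_sqrt Ax px.
rewrite -mulrA trC //; last exact: vnM.
apply: tr_pos; first by do !apply: vnM.
by rewrite -{1}(pos_sa ps); exact: pos_conj.
Qed.

(** Here [y] may fail to be self-adjoint: expand the nonnegative trace of
    [(K - y) * b * adj (K - y)] and bound its quadratic term by means of [adj y * y <= K ^ 2]. *)
Lemma tr_mul_le y b (K : R) : A y -> A b -> pos b -> 0 <= K ->
  (forall u, nm (y u) <= K * nm u) -> tr (y * b) <= K * tr b.
Proof.
move=> Ay Ab pb; rewrite le_eqVlt => /predU1P[<- h|K0 h].
  have -> : y = 0.
    apply: bop_ext => u; apply: nm0_eq0; apply/eqP; rewrite eq_le nm_ge0 andbT.
    by have := h u; rewrite mul0r.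
  by rewrite !mul0r tr0.
have Ay' := vn_adj Ay.
have AK : A (K%:C *: (1 : B)) by apply/vnZ/vn1.
have h1 : 0 <= tr (((K ^+ 2)%:C *: (1 : B) - adj y * y) * b).
  apply: tr_pos_mul => //.
  - by apply: vnB; [apply/vnZ/vn1 | exact: vnM].
  - split=> [|u]; first by rewrite adjB adjZ adj1 adjM adjK.
    rewrite !bopE rdBl rdZl rdE rd_adj adjK rdE subr_ge0 -exprMn.
    by rewrite ler_pXn2r ?nnegrE ?nm_ge0 // mulr_ge0 // ltW.
have h2 : 0 <= tr ((K%:C *: (1 : B) - y) * b * adj (K%:C *: (1 : B) - y)).
  apply: tr_pos; first by do !apply: vnM => //; [exact: vnB | apply/vn_adj/vnB].
  by rewrite -{1}[K%:C *: (1 : B) - y]adjK; exact: pos_conj.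
have Ayb := vnM Ay Ab; have Aby' := vnM Ab Ay'; have Ayby := vnM Ayb Ay'.
have A2 := vnM (vnM Ay' Ay) Ab.
move: h1 h2; rewrite adjB adjZ adj1 !mulrBl !mulrBr !bopZl !mul1r !bopZr !mulr1.
have Z t (c : R[i]) : A t -> A (c *: t) by exact: vnZ.
rewrite ?bopZl ?scalerA -?rmorphM /= !trB ?trZ //; try by do ?[exact: Z | apply: vnB].
rewrite -(tr_adj Aby') adjM adjK (pos_sa pb) (trC Ayb Ay') mulrA => h1 h2.
have : 2 * K * tr (y * b) <= 2 * K * (K * tr b) by lra.
by rewrite ler_pM2l // mulr_gt0.
Qed.

Lemma vn_abs x y : A x -> absolute_value x y -> [/\ A y, pos y & y * y = adj x * x].
Proof.
move=> Ax [/positive_opP py [x' /adj_unique -> yy]].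
have [s [As ps ss]] := vn_sqrt (vnM (vn_adj Ax) Ax) (pos_sqr x).
by have -> : y = s by apply: sqrt_unique => //; rewrite ss.
Qed.

(** Duality of trace norm and operator norm, without polar decomposition: if [g] is the inverse of
    [y + e], with [y] the absolute value of [x], then [x * g] is a contraction and
    [x = (x * g) * (y + e)]. *)
Lemma norm1_tr x q r : A x -> A q -> norm1_le A tau x r ->
  (forall u, nm (q u) <= nm u) -> tr (x * q) <= r.
Proof.
move=> Ax Aq [y axy /Re_le /=]; have [Ay py yy] := vn_abs Ax axy.
rewrite -/(tr y) => yr hq; apply/ler_addgt0Pr => e e0.
apply: le_trans (lerD yr (lexx e)).
have Ae c : A (c%:C *: (1 : B)) by apply/vnZ/vn1.
have [|g [hg gh pg gc]] := @inv_ex _ _ (y + e%:C *: (1 : B)) e e0; first by rewrite addrK.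
have Ag : A g by apply: vn_of_comm (vnD Ay (Ae e)) gc.
have Axg := vnM Ax Ag.
have -> : x * q = (x * g) * (y + e%:C *: (1 : B)) * q by rewrite -(mulrA x) gh mulr1.
rewrite -mulrA trC //; last by apply: vnM => //; apply: vnD.
have pe : pos (y + e%:C *: (1 : B)) by apply: posD => //; apply: posZ; [exact: ltW | exact: pos1].
rewrite -mulrA trC; [|exact: vnD| exact: vnM].
have : tr (q * (x * g) * (y + e%:C *: (1 : B))) <= 1 * tr (y + e%:C *: (1 : B)).
  apply: tr_mul_le => //; [exact: vnM| exact: vnD | move=> u].
  rewrite mul1r bopM; apply: le_trans (hq _) _.
  apply: ler_of_sqr; first exact: nm_ge0.
  rewrite bopM -rd_sqr -yy bopE rd_adj (pos_sa py) rdE.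
  set w := g u; have -> : u = y w + e%:C *: w.
    by have := congr1 (fun t : B => t u) hg; rewrite !bopE => <-.
  rewrite nm_sqrD nmZ rdZr exprMn.
  have := pos_rd w py; have := sqr_ge0 (nm w); have := sqr_ge0 (`|e| : R) => a1 a2 a3.
  have a4 := mulr_ge0 a1 a2; have a5 := mulr_ge0 (ltW e0) a3; lra.
rewrite mul1r trD // ?trZ ?tr1 ?mulr1 //; exact: vn1.
Qed.

Lemma Re_tau_le p r : tau p <= r%:C -> tr p <= r.
Proof. by move/Re_le. Qed.

(** Needed because [L1_trace] speaks of an arbitrary approximating sequence. The difference
    [a n - c] is small on [p] by convergence in measure; on [1 - p] it is split through [a N], the
    first part being small in trace norm and the second bounded. *)
Lemma L1_trace_bounded T (z : R[i]) c : A c -> (forall u, papp T u = c u) ->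
  L1_trace A tau T z -> complex.Re z = tr c.
Proof.
move=> Ac Tc [_ [a [Aa cau cvm lim]]].
apply/eqP; rewrite -subr_eq0 -normr_le0; apply/ler_addgt0Pl => e e0; rewrite addr0.
have e4 : 0 < e / 4 by rewrite divr_gt0.
have [N hN] := cau (e / 4) e4.
have [K K0 hK] := bop_bounded (a N - c).
(* As [N] is fixed first, the bound imposed on the trace of [1 - p] may depend on the norm bound [K]
   of [a N - c]. *)
have [N1 _ hN1] := cvm (e / 4 / K) (e / 4) (divr_gt0 e4 K0) e4.
have /cvgrPdist_le/(_ (e / 4)%:C) := lim; rewrite ltcR => /(_ e4)[N2 _ hN2].
set n := maxn N (maxn N1 N2).
have nN : (N <= n)%N by exact: leq_maxl.
have [|p [Ap /projP pp tp _ hp]] := hN1 n; first by rewrite /= /n !leq_max leqnn orbT.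
have := hN2 n; rewrite /= {1}/n !leq_max leqnn !orbT => /(_ isT)/Re_le.
move=> /(le_trans (Re_le_norm _)); rewrite ReD ReN -/(tr (a n)) => lim'.
have Aq := vnB vn1 Ap; have pq := projC pp.
have tq : K * tr (1 - p) <= e / 4.
  by rewrite mulrC -ler_pdivlMr //; exact: Re_tau_le.
have key X Y Z : A X -> A Y -> A Z -> (forall u, nm (X (p u)) <= e / 4 * nm u) ->
    norm1_le A tau Y (e / 4) -> (forall u, nm (Z u) <= K * nm u) ->
    tr (X * p + Y * (1 - p) + Z * (1 - p)) <= 3 * (e / 4).
  move=> AX AY AZ hX hY hZ.
  have AXp := vnM AX Ap; have AYq := vnM AY Aq; have AZq := vnM AZ Aq.
  rewrite trD // ?trD //; last exact: vnD.
  have h1 : tr (X * p * 1) <= e / 4 * tr 1.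
    by apply: tr_mul_le => //; [exact: vn1 | exact: pos1 | exact: ltW].
  have h2 : tr (Y * (1 - p)) <= e / 4.
    by apply: norm1_tr => // u; exact: proj_nm.
  have h3 : tr (Z * (1 - p)) <= K * tr (1 - p).
    by apply: tr_mul_le => //; [exact: proj_pos | exact: ltW].
  rewrite mulr1 tr1 in h1; lra.
have hp' u : nm ((a n - c) (p u)) <= e / 4 * nm u.
  by have := hp u; rewrite Tc !norm_nm -rmorphM lecR nm_distC.
have Anc := vnB (Aa n) Ac; have AnN := vnB (Aa n) (Aa N); have ANc := vnB (Aa N) Ac.
have split_ : a n - c = (a n - c) * p + (a n - a N) * (1 - p) + (a N - c) * (1 - p).
  by rewrite -addrA -mulrDl subrKA -mulrDr [p + _]addrC subrK mulr1.
have k1 := key _ _ _ Anc AnN ANc hp' (hN _ _ nN (leqnn N)) hK.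
have k2 := key _ _ _ (vnN Anc) (vnB (Aa N) (Aa n)) (vnN ANc).
rewrite -split_ trB // in k1.
have : tr (- (a n - c)) <= 3 * (e / 4).
  rewrite {1}split_ !opprD -!mulNr -(opprB (a N) (a n)) opprK; apply: k2 => //.
  - by move=> u; rewrite bopN nmN.
  - exact: hN.
  - by move=> u; rewrite bopN nmN.
rewrite trN // trB // => k3; move: lim'; rewrite !ler_norml /= => /andP[? ?].
apply/andP; split; lra.
Qed.

(* [a] is the final projection of the partial isometry [z e |z e|^-1]. *)
Lemma range_proj z e (c : R) : A z -> A e -> proj e -> 0 < c ->
  e * (adj z * z) = (adj z * z) * e -> pos ((adj z * z) * e - c%:C *: e) ->
  exists a, [/\ A a, proj a, tr a = tr e, adj z * a * z = (adj z * z) * e &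
    exists2 y, A y & a = z * y].
Proof.
move=> Az Ae pe c0; have Az' := vn_adj Az; set h := adj z * z => eh ph.
have Ah : A h := vnM Az' Az.
have Aq := vnB vn1 Ae; have [ee es] := pe.
set c1 := Num.min c 1; have c10 : 0 < c1 by rewrite lt_min c0 /=.
(* This operator is [h] on [e] and the identity on [1 - e], hence invertible; [g] below is the
   inverse of [h] inside [e]. *)
set P := h * e + (1 - e).
have pP : pos (P - c1%:C *: (1 : B)).
  have -> : P - c1%:C *: (1 : B) = (h * e - c%:C *: e) + ((c - c1)%:C *: e + (1 - c1)%:C *: (1 - e)).
    rewrite /P !rmorphB rmorph1 !scalerBl !scalerBr !scale1r -(addrA (c%:C *: e)) subrKA.
    by rewrite -!addrA; congr (_ + _); rewrite opprB [RHS]addrC !addrA [RHS]addrAC addrK.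
  apply: posD => //; apply: posD; apply: posZ; rewrite ?subr_ge0 /c1 ?ge_min ?lexx ?orbT //.
    exact: proj_pos.
  exact/proj_pos/projC.
have [Q [PQ QP pQ cQ]] := inv_ex c10 pP.
have AQ : A Q by apply: vn_of_comm cQ; apply: vnD => //; exact: vnM.
have e1e : e * (1 - e) = 0 by rewrite mulrBr mulr1 ee subrr.
have e1e' : (1 - e) * e = 0 by rewrite mulrBl mul1r ee subrr.
have eP : e * P = P * e.
  by rewrite /P mulrDr mulrDl e1e e1e' addr0 addr0 mulrA eh -!mulrA.
have eQ : e * Q = Q * e := cQ _ eP.
have Pe : P * e = h * e by rewrite /P mulrDl e1e' addr0 -mulrA ee.
set g := Q * e; have Ag : A g := vnM AQ Ae.
have gs : adj g = g by rewrite adjM es (pos_sa pQ) eQ.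
have ge : g * e = g by rewrite /g -mulrA ee.
have eg : e * g = g by rewrite /g mulrA eQ -mulrA ee.
have gh : g * h = e by rewrite /g -mulrA eh -Pe mulrA QP mul1r.
have hg : h * g = e by have := congr1 (@adj _ _) gh; rewrite adjM gs es adjM adjK.
exists (z * g * adj z); split.
- by do !apply: vnM.
- split; last by rewrite adjM (adjM z g) adjK gs mulrA.
  have -> : z * g * adj z * (z * g * adj z) = z * (g * h) * g * adj z by rewrite /h !mulrA.
  by rewrite gh -(mulrA z) eg.
- by rewrite trC //; [rewrite mulrA hg | exact: vnM].
- have -> : adj z * (z * g * adj z) * z = h * g * h by rewrite /h !mulrA.
  by rewrite hg eh.
- by exists (g * adj z); [exact: vnM | rewrite mulrA].
Qed.
End Trace.

(** * Spectral projections of a density *)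

Section Density.
Context {R : realType} {H : hilbertType R}.
Local Notation B := (bop H).
Implicit Types (u v w : H) (x y z p q b d e : B).
Context {A : set B} {tau : B -> R[i]}.
Hypotheses (vA : von_neumann_algebra A) (tA : tracial_state A tau).
Context {psi : H} {rho : pop (H := H)}.
Local Notation tr := (tr (tau := tau)).
Hypothesis dens : density A tau (vector_state psi) rho.

Let lin : pop_linear rho. Proof. by case: dens => _ []. Qed.
Let sad : self_adjoint rho. Proof. by case: dens => -[]. Qed.
Let rho_pos u : pdom rho u -> 0 <= rd (papp rho u) u.
Proof. by case: dens => -[_ h] _ _ /h /Re_le. Qed.
Let rho_D (c : R[i]) u v : pdom rho u -> pdom rho v ->
  pdom rho (c *: u + v) /\ papp rho (c *: u + v) = c *: papp rho u + papp rho v.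
Proof. by case: lin => _ h; exact: h. Qed.
Let rho_0 : pdom rho 0 /\ papp rho 0 = 0.
Proof.
have [d0 h] := lin; split=> //; have [_] := h (-1) 0 0 d0 d0.
by rewrite !scaleN1r oppr0 addr0 addNr.
Qed.
Let rho_Z (c : R[i]) u : pdom rho u -> pdom rho (c *: u) /\ papp rho (c *: u) = c *: papp rho u.
Proof.
move=> du; have [d0 e0] := rho_0; have := rho_D c du d0.
by rewrite e0 !addr0.
Qed.
Let rho_sym u v : pdom rho u -> pdom rho v -> rd (papp rho u) v = rd u (papp rho v).
Proof.
by move=> du dv; have [/(_ (conj dv erefl)) h _] := sad v (papp rho v); rewrite /rd h.
Qed.
Let rho_sad v w : (forall u, pdom rho u -> rd (papp rho u) v = rd u w) ->
  pdom rho v /\ papp rho v = w.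
Proof.
move=> h; apply/sad => u du; apply: rd_dot => c.
by have [dc <-] := rho_Z c du; exact: h.
Qed.

(** Positivity bounds [1 + rho] below. Self-adjointness makes its graph closed and leaves no nonzero
    vector orthogonal to its range, since such a vector would satisfy [rho v = - v]. Affiliation
    puts the inverse in [A]. *)
Lemma resolvent_ex : exists Rv : B, [/\ pos Rv, pos (1 - Rv), A Rv,
  forall w, pdom rho (Rv w) /\ papp rho (Rv w) = w - Rv w &
  forall u, pdom rho u -> Rv (papp rho u + u) = u].
Proof.
pose G u w := pdom rho u /\ w = papp rho u + u.
have Gb u w : G u w -> nm u <= 1 * nm w.
  move=> [du ->]; rewrite mul1r; have := rho_pos du => h.
  have h2 := rd_le (papp rho u + u) u; rewrite rdDl rdE in h2.
  have [->//|n0] := eqVneq (nm u) 0.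
  have n1 : 0 < nm u by rewrite lt_def n0 nm_ge0.
  rewrite -(ler_pM2r n1) -expr2; lra.
have Gl (c : R[i]) u v w w1 : G u w -> G v w1 -> G (c *: u + v) (c *: w + w1).
  move=> [du ->] [dv ->]; have [dd e] := rho_D c du dv; split=> //.
  by rewrite e scalerDr addrACA.
have ex w : exists u, G u w.
  apply: (@closed_surj _ _ G 1) => //.
  - by have [d0 e0] := rho_0; split=> //; rewrite e0 addr0.
  - move=> s t u w' h su tw.
    have [|du e] := @rho_sad u (w' - u); last by split=> //; rewrite e subrK.
    move=> x dx; rewrite [LHS]rdC [RHS]rdC.
    apply: (@ncvg_eq_rd _ _ s (fun n => t n - s n)) => //.
      move=> f f0; have [N hN] := su (f / 2) (divr_gt0 f0 (ltr0Sn _ 1)).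
      have [N' hN'] := tw (f / 2) (divr_gt0 f0 (ltr0Sn _ 1)).
      exists (maxn N N') => n; rewrite geq_max => /andP[n1 n2].
      have -> : t n - s n - (w' - u) = (t n - w') + - (s n - u) by rewrite !opprB (addrC u) addrACA (addrC u).
      apply: le_trans (nm_triangle _ _) _; rewrite nmN (splitr f) lerD ?hN ?hN' //.
    move=> n; have [dn ->] := h n; rewrite addrK rho_sym //.
  - move=> v hv; have [|dv e] := @rho_sad v (- v).
      move=> u du; rewrite rdNr; have := hv u _ (conj du erefl) => /(congr1 (@complex.Re R)).
      by rewrite -/(rd _ _) rdDl /= => /eqP; rewrite addr_eq0 => /eqP.
    have := rho_pos dv; rewrite e rdNl rdE => h.
    apply: nm0_eq0; apply/eqP; rewrite -sqrf_eq0 eq_le sqr_ge0 andbT; lra.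
have [f fP] := choice ex.
have Gu u v w : G u w -> G v w -> u = v.
  move=> g1 g2; apply/eqP; rewrite -subr_eq0; apply/eqP/nm0_eq0/eqP; rewrite eq_le nm_ge0 andbT.
  have := Gb _ _ (Gl (-1) _ _ _ _ g2 g1).
  by rewrite !scaleN1r addNr nm0 mulr0 addrC.
have [c u v|u|Rv Rf] := @mk_bop _ _ f 1; [by apply: Gu (fP _) _; exact: Gl|exact: Gb (fP u)|].
have RG w : G (Rv w) w by rewrite Rf.
have dR w : pdom rho (Rv w) by case: (RG w).
have eR w : papp rho (Rv w) = w - Rv w by have [_ e] := RG w; rewrite {2}e addrK.
have wR w : w = papp rho (Rv w) + Rv w by case: (RG w).
have Rs : adj Rv = Rv.
  apply/esym/adj_rd => u v; rewrite {1}(wR v) {2}(wR u) rdDl rdDr rho_sym //.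
have pR : pos Rv.
  split=> // u; rewrite {2}(wR u) rdDr rdE rdC addr_ge0 ?sqr_ge0 //; exact: rho_pos.
exists Rv; split=> //.
- split=> [|u]; first by rewrite adjB adj1 Rs.
  rewrite bopB bop1E -eR {2}(wR u) rdDr rdE addr_ge0 ?sqr_ge0 //; exact: rho_pos.
- apply: (vn_bicomm vA) => b hb; apply: bop_ext => w; rewrite !bopM.
  have aff : affiliated A rho by case: dens => _ [].
  have [db eb] := aff b hb _ (dR w).
  apply: (Gu _ _ (b w)) (RG (b w)); split=> //.
  by rewrite eb -opD -wR.
- by move=> u du; apply: Gu (RG _) _; split.
Qed.

(* [e] is the spectral projection of [rho] for ]m, +oo[, and [y = rho (1 - e)];
   [Rv] is the resolvent [(1 + rho)^-1]. *)
Definition spec (Rv : B) (m : R) (e y : B) :=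
  [/\ [/\ A e, proj e, A y & pos y],
     pos (m%:C *: (1 - e) - y),
     forall b, b * Rv = Rv * b -> b * e = e * b /\ b * y = y * b,
     forall u, pdom rho ((1 - e) u) /\ papp rho ((1 - e) u) = y u &
     forall u, pdom rho u -> [/\ pdom rho (e u), papp rho (e u) = e (papp rho u) &
       m * nm (e u) ^+ 2 <= rd (papp rho (e u)) (e u)]].

(** The density exceeds [m] where the resolvent is below [c = 1 / (1 + m)], so [e] is cut from the
    bounded operator [S]. On [q = 1 - e] the resolvent is at least [c], and its inverse [Q] there
    gives [rho q = q Q - q]. *)
Lemma spec_ex : exists Rv : B, forall m : R, 0 <= m -> exists e y, spec Rv m e y.
Proof.
have [Rv [pR pR1 AR dR uR]] := resolvent_ex; exists Rv => m m0.
have m1 : 0 < 1 + m by lra.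
set c := (1 + m)^-1; have c0 : 0 < c by rewrite invr_gt0.
have c1 : c <= 1 by rewrite invf_le1 //; lra.
set S := c%:C *: (1 : B) - Rv.
have Ss : adj S = S by rewrite adjB adjZ adj1 (pos_sa pR).
have [e [pe ce pSe pSe1]] := spectral_cut Ss.
have [ee es] := pe.
have cS b : b * Rv = Rv * b -> b * S = S * b.
  by move=> bR; rewrite mulrBr mulrBl bopZl bopZr mulr1 mul1r bR.
have ce' b : b * Rv = Rv * b -> b * e = e * b by move=> /cS/ce.
have Re : Rv * e = e * Rv by exact: ce'.
have Ae : A e by apply: vn_of_comm vA _ _ AR ce'.
have SR : S * Rv = Rv * S by rewrite -cS.
have eS : e * S = S * e by apply: cS; rewrite Re.
set q := 1 - e; have pq : proj q := projC pe; have [qq qs] := pq.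
have Rq : Rv * q = q * Rv by rewrite /q mulrBr mulrBl mulr1 mul1r Re.
have eq0 : e * q = 0 by rewrite /q mulrBr mulr1 ee subrr.
have qe0 : q * e = 0 by rewrite /q mulrBl mul1r ee subrr.
set P := Rv * q + e.
have pP : pos (P - c%:C *: (1 : B)).
  have -> : P - c%:C *: (1 : B) = - (S * q) + (1 - c)%:C *: e.
    rewrite /S mulrBl bopZl mul1r opprB /P -addrA -[RHS]addrA; congr (_ + _).
    by rewrite {1}/q rmorphB rmorph1 scalerBl scale1r scalerBr opprB [RHS]addrC subrKA.
  by apply: posD => //; apply: posZ; [rewrite subr_ge0 | exact: proj_pos].
have [Q [PQ QP pQ cQ]] := inv_ex c0 pP.
have cP b : b * Rv = Rv * b -> b * P = P * b.
  move=> bR; have bq : b * q = q * b by rewrite /q mulrBr mulrBl mulr1 mul1r ce'.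
  by rewrite /P mulrDr mulrDl mulrA bR -!mulrA bq (ce' _ bR).
have cQ' b : b * Rv = Rv * b -> b * Q = Q * b by move=> /cP/cQ.
have eQ : e * Q = Q * e by apply: cQ'; rewrite Re.
have qQ : q * Q = Q * q by rewrite /q mulrBr mulrBl mulr1 mul1r eQ.
set y := q * Q - q.
have RqQ : Rv * (q * Q) = q.
  have qP : P * q = Rv * q by rewrite /P mulrDl eq0 addr0 -mulrA qq.
  by rewrite mulrA -qP -mulrA qQ mulrA PQ mul1r.
have qdom u : pdom rho (q u) /\ papp rho (q u) = y u.
  have [] := dR ((q * Q) u); have := congr1 (fun t : B => t u) RqQ; rewrite bopM => ->.
  by move=> d1 ->.
have cy b : b * Rv = Rv * b -> b * y = y * b.
  move=> bR; have bq : b * q = q * b by rewrite /q mulrBr mulrBl mulr1 mul1r ce'.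
  by rewrite /y (mulrBr b) (mulrBl b) mulrA bq -!mulrA cQ'.
have ys : adj y = y by rewrite /y adjB adjM qs (pos_sa pQ) qQ.
have qy : q * y = y by rewrite /y (mulrBr q) mulrA qq.
have yrd u : rd (y u) u = rd (papp rho (q u)) (q u).
  have [_ ->] := qdom u; rewrite -{1}qy bopM rd_adj qs //.
have py : pos y by split=> // u; rewrite yrd rho_pos //; case: (qdom u).
(* This is [rho - m = (1 + m) S Rv^-1] read at the vector [Rv w]; it turns the signs of [S] on [e]
   and on [q] into the two bounds on [rho]. *)
have key w : rd (w - Rv w) (Rv w) - m * nm (Rv w) ^+ 2 = (1 + m) * rd (S w) (Rv w).
  have cm : (1 + m) * c = 1 by rewrite divff // gt_eqF.
  rewrite /S bopB bopZ bop1E !rdBl rdZl rdE.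
  move: (rd w (Rv w)) (nm (Rv w) ^+ 2) => a b'.
  by transitivity ((1 + m) * c * a - (1 + m) * b'); [rewrite cm|]; ring.
exists e, y; split.
- split=> //; exact: (vn_of_comm vA AR cy).
- split=> [|u]; first by rewrite adjB adjZ qs ys.
  rewrite bopB bopZ rdBl rdZl proj_rd // yrd.
  set w := (q * Q) u.
  have qw : q w = w by rewrite -bopM mulrA qq.
  have qu : q u = Rv w by rewrite /w -bopM RqQ.
  rewrite qu; have [_ ->] := dR w.
  rewrite -opprB key -mulrN; apply: mulr_ge0; first exact: ltW.
  have pX : pos (Rv * - (S * q)).
    apply: pos_mul => //; rewrite mulrN mulNr; congr (- _).
    by rewrite mulrA -SR -!mulrA Rq.
  have := pos_rd w pX; rewrite bopM rd_adj (pos_sa pR) bopN bopM qw rdNl //.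
- by move=> b bR; split; [exact: ce' | exact: cy].
- exact: qdom.
- move=> u du; set w := papp rho u + u.
  have uw : u = Rv w by rewrite uR.
  have euw : e u = Rv (e w) by rewrite {1}uw -!bopM Re.
  have [d1 e1] := dR (e w).
  have ew : papp rho (e u) = e (papp rho u).
    by rewrite euw e1 -euw -opB /w addrK.
  split=> //; first by rewrite euw.
  rewrite euw e1 -subr_ge0 key; apply: mulr_ge0; first exact: ltW.
  have pX : pos (Rv * (S * e)).
    by apply: pos_mul => //; rewrite mulrA -SR -!mulrA Re.
  have := pos_rd (e w) pX; rewrite bopM rd_adj (pos_sa pR) bopM -(bopM e e) ee //.
Qed.

Definition om x : R := rd (x psi) psi.

Lemma pos_nm_le y (K : R) : 0 < K -> pos y -> pos (K%:C *: (1 : B) - y) -> forall u, nm (y u) <= K * nm u.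
Proof.
move=> K0 py pK u; have iK : 0 <= K^-1 by rewrite invr_ge0 ltW.
have := @contr_nm _ _ (K^-1%:C *: y) u (posZ iK py).
have -> : 1 - K^-1%:C *: y = K^-1%:C *: (K%:C *: (1 : B) - y).
  by rewrite scalerBr scalerA -rmorphM /= mulVf ?gt_eqF // scale1r.
move=> /(_ (posZ iK pK)); rewrite bopZ nmZ ger0_norm // => h.
by rewrite -ler_pdivrMl.
Qed.

(** All thresholds are cut from one resolvent, whence the commutation relations between different
    [m] and [M]. *)
Record specfam (E Y : R -> B) : Prop := SpecFam {
  sfA : forall m, 0 <= m -> A (E m);
  sfP : forall m, 0 <= m -> proj (E m);
  sfAY : forall m, 0 <= m -> A (Y m);
  sfPY : forall m, 0 <= m -> pos (Y m);
  sfYm : forall m, 0 <= m -> pos (m%:C *: (1 - E m) - Y m);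
  sfEE : forall m M, 0 <= m -> 0 <= M -> E m * E M = E M * E m;
  sfEY : forall m M, 0 <= m -> 0 <= M -> E m * Y M = Y M * E m;
  sfY : forall m u, 0 <= m -> pdom rho ((1 - E m) u) /\ papp rho ((1 - E m) u) = Y m u;
  sfE : forall m u, 0 <= m -> pdom rho u -> [/\ pdom rho (E m u), papp rho (E m u) = E m (papp rho u) &
       m * nm (E m u) ^+ 2 <= rd (papp rho (E m u)) (E m u)] }.

Lemma specfam_ex : exists E Y, specfam E Y.
Proof.
have [Rv h] := spec_ex.
have ex m : exists ey : B * B, 0 <= m -> spec Rv m ey.1 ey.2.
  have [m0|] := boolP (0 <= m); last by exists (0, 0).
  by have [e [y s]] := h m m0; exists (e, y).
have [f fP] := choice ex.
have cR m : 0 <= m -> (f m).1 * Rv = Rv * (f m).1.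
  by move=> m0; have [_ _ h1 _ _] := fP m m0; have [-> _] := h1 Rv erefl.
exists (fun m => (f m).1), (fun m => (f m).2); split.
- by move=> m /fP [[]].
- by move=> m /fP [[]].
- by move=> m /fP [[]].
- by move=> m /fP [[]].
- by move=> m /fP [].
- by move=> m M m0 /fP [_ _ h1 _ _]; have [] := h1 _ (cR m m0).
- by move=> m M m0 /fP [_ _ h1 _ _]; have [] := h1 _ (cR m m0).
- by move=> m u /fP [_ _ _ h1 _]; exact: h1.
- by move=> m u /fP [_ _ _ _ h1]; exact: h1.
Qed.

Section Family.
Context {E Y : R -> B}.
Hypothesis sf : specfam E Y.

Lemma sfYK m : 0 <= m -> (1 - E m) * Y m = Y m /\ Y m * (1 - E m) = Y m.
Proof.
move=> m0; have pq := projC (sfP sf m0); have [qq qs] := pq.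
have h : Y m * (1 - E m) = Y m.
  apply: bop_ext => u; rewrite bopM; have [_ <-] := sfY sf u m0.
  by have [_ <-] := sfY sf ((1 - E m) u) m0; rewrite -bopM qq.
split=> //; have := congr1 (@adj _ _) h.
by rewrite adjM qs (pos_sa (sfPY sf m0)).
Qed.

(** The cut-off turns [rho * (1 - E m) * x] into the bounded operator [Y m * x], so that the trace
    supplied by the density is an ordinary one. *)
Lemma om_trace m x : 0 <= m -> A x -> om ((1 - E m) * x) = tr (Y m * x).
Proof.
move=> m0 Ax; have Aq : A (1 - E m) := vnB vA (vn1 vA) (sfA sf m0).
have Aqx := vnM vA Aq Ax.
have [_ _ /(_ _ Aqx) h] := dens.
apply: (L1_trace_bounded vA tA (T := pop_comp rho ((1 - E m) * x))) h.
  by apply: vnM => //; exact: (sfAY sf).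
by move=> u /=; have [_ <-] := sfY sf (x u) m0.
Qed.

(** Read off from the density at [a = 1]: on [p], the operator [rho] is within 1 of the bounded
    operator [a N]. *)
Lemma rho_small (d : R) : 0 < d -> exists p (K : R), [/\ A p, proj p, tr (1 - p) <= d, 0 < K &
  forall u, pdom rho (p u) /\ nm (papp rho (p u)) <= K * nm u].
Proof.
move=> d0; have [_ _ /(_ 1 (vn1 vA)) [_ [a [_ _ cvm _]]]] := dens.
have [N _ hN] := cvm d 1 d0 ltr01; have [p [Ap /projP pp /Re_le tp rp hp]] := hN N (leqnn N).
have [K K0 hK] := bop_bounded (a N).
exists p, (1 + K); split=> //; first by lra.
move=> u; split; first by have := rp (p u); apply; exists u.
have := hp u; rewrite /= mul1r !norm_nm lecR => h.
have h1 := hK (p u); have h2 := proj_nm u pp; have h3 := ler_wpM2l (ltW K0) h2.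
have -> : papp rho (p u) = (papp rho (p u) - a N (p u)) + a N (p u) by rewrite subrK.
apply: le_trans (nm_triangle _ _) _; lra.
Qed.

(** This stands in for continuity of the trace along [E M]. On [E M] the density is at least [M],
    while [rho p] is bounded by [K], so [E M * p] has norm at most [K / M]; the rest is bounded by
    the trace of [1 - p]. *)
Lemma tr_E_small (d : R) : 0 < d -> exists M0 : R, forall M, M0 <= M -> tr (E M) <= d.
Proof.
move=> d0; have d2 : 0 < d / 2 by rewrite divr_gt0.
have [p [K [Ap pp tp K0 hp]]] := rho_small d2.
exists (K / (d / 2)) => M hM.
have M0 : 0 < M by apply: lt_le_trans hM; rewrite divr_gt0.
have AE := sfA sf (ltW M0); have pE := sfP sf (ltW M0).
have Aq := vnB vA (vn1 vA) Ap; have pq := projC pp.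
have -> : E M = E M * p * 1 + E M * (1 - p) by rewrite mulr1 -mulrDr addrC subrK mulr1.
rewrite (trD tA); [|by rewrite mulr1; exact: vnM|exact: vnM].
rewrite (splitr d); apply: lerD.
  have : tr (E M * p * 1) <= d / 2 * tr 1.
    apply: (tr_mul_le vA tA) => //; [exact: vnM|exact: (vn1 vA)|exact: pos1|exact: ltW|move=> u].
    rewrite bopM; have [du bu] := hp u; have [_ e1 e2] := sfE sf (ltW M0) du.
    rewrite e1 rd_adj (pos_sa (proj_pos pE)) -(bopM (E M) (E M)) pE.1 in e2.
    have e3 := le_trans e2 (rd_le _ _).
    have [->|n0] := eqVneq (nm (E M (p u))) 0; first by rewrite mulr_ge0 // ltW.
    have np : 0 < nm (E M (p u)) by rewrite lt_def n0 nm_ge0.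
    rewrite expr2 mulrA ler_pM2r // in e3.
    have e4 := le_trans e3 bu.
    move: hM; rewrite ler_pdivrMr // => hM.
    have := ler_wpM2r (nm_ge0 u) hM => e5.
    rewrite -(ler_pM2l M0); apply: le_trans e4 _; apply: le_trans e5 _; by rewrite (mulrA M (d / 2)).
  by rewrite (tr1 tA) (mulr1 (d / 2)).
apply: le_trans tp; have : tr (E M * (1 - p)) <= 1 * tr (1 - p).
  apply: (tr_mul_le vA tA) => //; first exact: proj_pos.
  by move=> u; rewrite mul1r; exact: proj_nm.
by rewrite mul1r.
Qed.

(** Approximate [psi] by a vector [u] of the domain: [M] times the square of [nm (E M u)] is at most
    [nm (papp rho u) * nm u], whatever [M] is. *)
Lemma E_psi_small (d : R) : 0 < d -> exists M0 : R, forall M, M0 <= M -> nm (E M psi) <= d.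
Proof.
move=> d0; have d2 : 0 < d / 2 by rewrite divr_gt0.
have [u [du hu]] : exists u, pdom rho u /\ nm (u - psi) <= d / 2.
  have dn : dense (pdom rho) by case: dens => _ [].
  have := dn (ball psi (d / 2)%:C); case.
  - by exists psi; apply: ballxx; rewrite ltcR.
  - exact: ball_open.
  - move=> u [hb du]; exists u; split=> //.
    by move: hb; rewrite -ball_normE /= norm_nm ltcR nm_distC => /ltW.
exists (nm (papp rho u) * nm u / (d / 2) ^+ 2 + 1) => M hM.
have q0 : 0 <= nm (papp rho u) * nm u / (d / 2) ^+ 2 by apply: divr_ge0; [exact: mulr_ge0 | exact: sqr_ge0].
have M0 : 0 < M by lra.
have pE := sfP sf (ltW M0); have [_ e1 e2] := sfE sf (ltW M0) du.
have h1 : nm (E M u) <= d / 2.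
  apply: ler_of_sqr; first exact: ltW.
  rewrite -(ler_pM2l M0); apply: le_trans e2 _; rewrite e1 rd_adj (pos_sa (proj_pos pE)) -(bopM (E M) (E M)) pE.1.
  apply: le_trans (rd_le _ _) _; apply: le_trans (ler_wpM2l (nm_ge0 _) (proj_nm u pE)) _.
  by rewrite -ler_pdivrMr ?exprn_gt0 //; lra.
have -> : E M psi = E M u - E M (u - psi) by rewrite opB opprB addrC subrK.
apply: le_trans (nm_triangle _ _) _; rewrite nmN (splitr d) lerD //.
exact: le_trans (proj_nm _ pE) hu.
Qed.

Hypothesis psi1 : nm psi = 1.
Local Notation Tr := (tr).

Lemma om_proj x : proj x -> om x = nm (x psi) ^+ 2.
Proof. exact: proj_rd. Qed.

(** Below a high cut [M], weight minus [r] times trace is the trace against the bounded operator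
    [D = Y M - r q]. This operator is positive on [E r] and negative on its complement, so
    [tr (D * a)] is largest at [a = E r]. What lies above [M] is estimated separately. *)
Lemma spec_opt (r : R) a : 0 <= r -> A a -> proj a ->
  om a - r * Tr a <= om (E r) - r * Tr (E r).
Proof.
move=> r0 Aa pa; apply/ler_addgt0Pr => g g0.
(* The error [3 * d] pays for replacing [psi] by its part below [M], and [r * d] for the trace of
   [E M]. *)
set d := Num.min 1 (g / (3 + r)).
have r3 : 0 < 3 + r by lra.
have d0 : 0 < d by rewrite lt_min ltr01 divr_gt0.
have d1 : d <= 1 by rewrite ge_min lexx.
have dg : d * (3 + r) <= g by rewrite -ler_pdivlMr // ge_min lexx orbT.
have [M1 hM1] := tr_E_small d0; have [M2 hM2] := E_psi_small d0.
set M := Num.max 0 (Num.max M1 M2).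
have M0 : 0 <= M by rewrite le_max lexx.
have tM : Tr (E M) <= d by apply: hM1; rewrite !le_max lexx !orbT.
have nM : nm (E M psi) <= d by apply: hM2; rewrite !le_max lexx !orbT.
have AM := sfA sf M0; have pM := sfP sf M0; have AY := sfAY sf M0; have pY := sfPY sf M0.
have [qY Yq] := sfYK M0.
set q := 1 - E M; have pq : proj q := projC pM; have [qq qs] := pq.
have Aq : A q := vnB vA (vn1 vA) AM.
have Ar := sfA sf r0; have pr := sfP sf r0; have [rr rs] := pr.
have rY : E r * Y M = Y M * E r := sfEY sf r0 M0.
have rq : E r * q = q * E r by rewrite /q mulrBr mulrBl mulr1 mul1r (sfEE sf).
set er := E r; set y := Y M.
set D := y - r%:C *: q.
have qY' : q * y = y := qY.
have AD : A D by apply: (vnB vA) => //; exact: (vnZ vA).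
have Ds : adj D = D by rewrite adjB adjZ qs (pos_sa pY).
have rD : er * D = D * er by rewrite /D mulrBr mulrBl bopZr bopZl rY rq.
have Drd v : rd (D v) v = rd (papp rho (q v)) (q v) - r * nm (q v) ^+ 2.
  have [_ ->] := sfY sf v M0.
  by rewrite /D bopB bopZ rdBl rdZl (proj_rd _ pq) -/y -{1}qY' bopM rd_adj qs.
have pDer : pos (D * er).
  split=> [|u]; first by rewrite adjM Ds rs rD.
  have -> : rd ((D * er) u) u = rd (D (er u)) (er u).
    by rewrite [RHS]rd_adjr rs -!bopM rD -mulrA rr.
  rewrite Drd; have -> : q (er u) = er (q u) by rewrite -!bopM rq.
  have [dq _] := sfY sf u M0; have [_ _ h] := sfE sf r0 dq.
  by rewrite subr_ge0.
have pDer1 : pos (- (D * (1 - er))).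
  have pr1 := projC pr; have [r1r1 r1s] := pr1.
  have rD1 : (1 - er) * D = D * (1 - er) by rewrite (mulrBr D) (mulrBl D) mulr1 mul1r rD.
  split=> [|u]; first by rewrite adjN adjM Ds r1s rD1.
  rewrite bopN rdNl.
  have -> : rd ((D * (1 - er)) u) u = rd (D ((1 - er) u)) ((1 - er) u).
    by rewrite [RHS]rd_adjr r1s -!bopM rD1 -mulrA r1r1.
  have rq1 : q * (1 - er) = (1 - er) * q by rewrite (mulrBr q) (mulrBl q) mulr1 mul1r rq.
  rewrite Drd opprB subr_ge0; have -> : q ((1 - er) u) = (1 - er) (q u) by rewrite -!bopM rq1.
  have [_ ->] := sfY sf (q u) r0; rewrite [leLHS]rd_adjr r1s -bopM.
  have [-> _] := sfYK r0; have := pos_rd (q u) (sfYm sf r0).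
  by rewrite bopB bopZ rdBl rdZl (proj_rd _ pr1) subr_ge0.
have Aer1 : A (1 - er) := vnB vA (vn1 vA) Ar.
have A1a : A (1 - a) := vnB vA (vn1 vA) Aa.
have ADer := vnM vA AD Ar; have ADer1 := vnM vA AD Aer1.
have h1 : 0 <= Tr (- (D * (1 - er)) * a).
  by apply: (tr_pos_mul vA tA) => //; [exact: vnN | exact: proj_pos].
have h2 : 0 <= Tr (D * er * (1 - a)).
  by apply: (tr_pos_mul vA tA) => //; exact/proj_pos/projC.
have h3 : 0 <= Tr (E M * a) by apply: (tr_pos_mul vA tA) => //; exact: proj_pos.
have h4 : Tr (E M * er) <= Tr (E M).
  rewrite -subr_ge0 -(trB vA tA) //; last exact: (vnM vA).
  rewrite -[X in X - _]mulr1 -mulrBr; apply: (tr_pos_mul vA tA) => //; first exact: proj_pos.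
  exact/proj_pos/projC.
have Aya := vnM vA AY Aa; have Aqa := vnM vA Aq Aa.
have Ayr := vnM vA AY Ar; have Aqr := vnM vA Aq Ar.
have e1 : Tr (D * a) = Tr (y * a) - r * Tr (q * a).
  by rewrite /D mulrBl bopZl (trB vA tA) ?(trZ vA tA) //; exact: vnZ.
have e2 : Tr (D * er) = Tr (y * er) - r * Tr (q * er).
  by rewrite /D mulrBl bopZl (trB vA tA) ?(trZ vA tA) //; exact: vnZ.
have e3 : Tr (q * a) = Tr a - Tr (E M * a).
  by rewrite /q mulrBl mul1r (trB vA tA) //; exact: vnM.
have e4 : Tr (q * er) = Tr er - Tr (E M * er).
  by rewrite /q mulrBl mul1r (trB vA tA) //; exact: vnM.
have e5 : Tr (D * a) = Tr (D * er) - Tr (D * er * (1 - a)) - Tr (- (D * (1 - er)) * a).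
  have ADa := vnM vA AD Aa; have ADra := vnM vA ADer Aa.
  have d2 : D * er * (1 - a) = D * er - D * er * a by rewrite (mulrBr (D * er)) mulr1.
  have d3 : - (D * (1 - er)) * a = D * er * a - D * a.
    by rewrite mulNr (mulrBr D) mulr1 mulrBl opprB.
  rewrite d2 d3 !(trB vA tA) //; ring.
have e6 : om (q * a * q) = Tr (y * a).
  rewrite -mulrA om_trace //; last exact: vnM.
  by rewrite mulrA (trC tA) // mulrA qY.
have e7 : Tr (y * er) = om (q * er) by rewrite om_trace.
have h5 : om (q * er) <= om er.
  have pqr : proj (q * er) by apply: proj_mul => //; rewrite rq.
  rewrite (om_proj pqr) (om_proj pr) bopM.
  by rewrite ler_pXn2r ?nnegrE ?nm_ge0 //; exact: proj_nm.
have h6 : om a <= om (q * a * q) + 3 * d.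
  have -> : om (q * a * q) = nm (a (q psi)) ^+ 2.
    by rewrite /om !bopM rd_adj qs proj_rd.
  rewrite (om_proj pa).
  have -> : a psi = a (q psi) + a (E M psi) by rewrite -opD /q bopB bop1E subrK.
  have n1 : nm (a (q psi)) <= 1.
    by rewrite -psi1; apply: le_trans (proj_nm _ pa) (proj_nm _ pq).
  have n2 : nm (a (E M psi)) <= d by apply: le_trans (proj_nm _ pa) nM.
  rewrite nm_sqrD.
  have n3 : rd (a (q psi)) (a (E M psi)) <= 1 * d.
    apply: le_trans (rd_le _ _) _; exact: ler_pM.
  have n4 : nm (a (E M psi)) ^+ 2 <= 1 * d.
    rewrite expr2; apply: ler_pM => //; exact: le_trans n2 d1.
  lra.
have rM := ler_wpM2l r0 tM; have rM4 := ler_wpM2l r0 h4; have rM3 := mulr_ge0 r0 h3.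
rewrite -/er; rewrite e3 in e1; rewrite e4 in e2; lra.
Qed.

(** On [E m'] the density is at least [m'], whereas on [p] it is bounded by [m]. Hence [1 - p] is
    bounded below on [E m'], up to a part of small trace, and carries it to a projection of the same
    trace under [1 - p]. *)
Lemma spec_cmp (m m' : R) p : 0 <= m -> m < m' -> A p -> proj p ->
  (forall u, pdom rho (p u) /\ nm (papp rho (p u)) <= m * nm u) ->
  Tr (E m') <= Tr (1 - p).
Proof.
move=> m0 mm Ap pp hp; have m'0 : 0 < m' := le_lt_trans m0 mm.
set q := 1 - p; have pq : proj q := projC pp; have [qq qs] := pq.
have Aq : A q := vnB vA (vn1 vA) Ap.
apply/ler_addgt0Pr => g g0; have [M1 hM1] := tr_E_small g0.
set M := Num.max m' M1; have mM : m' <= M by rewrite le_max lexx.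
have M0 : 0 < M := lt_le_trans m'0 mM.
have tM : Tr (E M) <= g by apply: hM1; rewrite le_max lexx orbT.
have AM := sfA sf (ltW M0); have pM := sfP sf (ltW M0).
have Am := sfA sf (ltW m'0); have pm := sfP sf (ltW m'0).
have EE : E m' * E M = E M * E m' by apply: (sfEE sf); exact: ltW.
have EE1 : E m' * (1 - E M) = (1 - E M) * E m' by rewrite mulrBr mulrBl mulr1 mul1r EE.
(* The cut at [M] bounds the norm of [rho v] by [M * nm v] for [v] in [e]; this is what makes
   [(m' - m) / M] a lower bound for [q] on [e]. *)
set e := E m' * (1 - E M).
have pe : proj e by apply: proj_mul => //; exact: projC.
have Ae : A e by apply: (vnM vA) => //; apply: (vnB vA) => //; exact: vn1.
have [ee es] := pe.
have e1 : Tr (E m') = Tr e + Tr (E m' * E M).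
  by rewrite /e mulrBr mulr1 (trB vA tA) ?subrK //; exact: vnM.
have h1 : Tr (E m' * E M) <= Tr (E M).
  have : Tr (E m' * E M) <= 1 * Tr (E M).
    apply: (tr_mul_le vA tA) => //; first exact: proj_pos.
    by move=> u; rewrite mul1r; exact: proj_nm.
  by rewrite mul1r.
suff : Tr e <= Tr q by lra.
set k := ((m' - m) / M) ^+ 2.
have k0 : 0 < k by rewrite exprn_gt0 // divr_gt0 // subr_gt0.
set z := q * e; have Az := vnM vA Aq Ae.
have zz : adj z * z = e * q * e by rewrite /z adjM qs es -mulrA (mulrA q) qq mulrA.
have lower u : k * nm (e u) ^+ 2 <= nm (z u) ^+ 2.
  rewrite /z bopM; set v := e u.
  have ev : v = (1 - E M) (E m' u) by rewrite /v /e EE1 bopM.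
  have [dv rv] := sfY sf (E m' u) (ltW M0); rewrite -ev in dv rv.
  have rvE : papp rho v = Y M v.
    by rewrite rv ev -(bopM (Y M) (1 - E M)); have [_ ->] := sfYK (ltW M0).
  have nrv : nm (papp rho v) <= M * nm v.
    rewrite rvE; apply: pos_nm_le => //; first exact: (sfPY sf (ltW M0)).
    have -> : M%:C *: (1 : B) - Y M = (M%:C *: (1 - E M) - Y M) + M%:C *: E M.
      by rewrite scalerBr addrAC subrK.
    by apply: posD; [exact: (sfYm sf (ltW M0)) | apply: posZ; [exact: ltW | exact: proj_pos]].
  have [dq _] := sfY sf u (ltW M0).
  have [_ _ h2] := sfE sf (ltW m'0) dq.
  have ev2 : v = E m' ((1 - E M) u) by rewrite /v /e bopM.
  rewrite -ev2 in h2.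
  have [dp np] := hp v.
  have sp : papp rho v = papp rho v by [].
  have vv : v = p v + q v by rewrite /q bopB bop1E addrC subrK.
  have h3 : rd (papp rho v) v = rd (papp rho v) (p v) + rd (papp rho v) (q v).
    by rewrite {2}vv rdDr.
  have h4 : rd (papp rho v) (p v) <= m * nm v ^+ 2.
    rewrite rho_sym //; apply: le_trans (rd_le _ _) _.
    by rewrite expr2 mulrA (mulrC m) -mulrA; apply: ler_wpM2l.
  have h5 : rd (papp rho v) (q v) <= M * nm v * nm (q v).
    by apply: le_trans (rd_le _ _) _; apply: ler_wpM2r.
  have [v0|vn0] := eqVneq (nm v) 0; first by rewrite v0 expr0n mulr0 sqr_ge0.
  have vp : 0 < nm v by rewrite lt_def vn0 nm_ge0.
  have h6 : (m' - m) * nm v <= M * nm (q v).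
    rewrite -(ler_pM2r vp); lra.
  rewrite /k -exprMn ler_pXn2r ?nnegrE ?nm_ge0 //; last first.
    by apply: mulr_ge0 => //; apply: divr_ge0; [rewrite subr_ge0; exact: ltW | exact: ltW].
  by rewrite mulrAC ler_pdivrMr // (mulrC (nm (q v))).
have [gl gr] : e * (e * q * e) = e * q * e /\ e * q * e * e = e * q * e.
  by move: ee; clear; move: e q => x y xx; split; [rewrite !mulrA xx | rewrite -!mulrA xx].
have [||a [Aa pa ta _ [y Ay az]]] := range_proj vA tA Az Ae pe k0.
- by rewrite zz gl gr.
- split=> [|u].
    by rewrite adjB adjZ es zz gr adjM (adjM e q) es qs mulrA.
  rewrite bopB bopZ rdBl rdZl (proj_rd u pe) subr_ge0 zz gr.
  by rewrite -zz rd_sqr; exact: lower.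
(* The projection [a] factors through [z = q * e] on the left, so it lies under [q]. *)
have qa : q * a = a by rewrite az mulrA /z (mulrA q) qq.
rewrite -ta -subr_ge0 -(trB vA tA) //.
have -> : q - a = q * (1 - a) by rewrite mulrBr mulr1 qa.
by apply: (tr_pos_mul vA tA) => //; [apply: (vnB vA) => //; exact: vn1 | exact: proj_pos | exact/proj_pos/projC].
Qed.
End Family.
End Density.

(** * Rearrangements and entropy *)

Section DecreasingRearrangement.
Context {R : realType}.
Implicit Types (mu N L : R -> R) (r s t x : R).
Local Notation leb := (@lebesgue_measure R).
Local Notation D := (`]0%R, 1%R]%classic : set R).

(** Over a subdivision into equal steps the decrements of [N] telescope, so the change of [K] is at
    most the mesh. *)
Lemma telescope_const (K N : R -> R) :
  (forall r s, 0 <= r -> r <= s -> `|K s - K r| <= (s - r) * (N r - N s)) ->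
  (forall r, 0 <= r -> 0 <= N r <= 1) ->
  forall r s, 0 <= r -> r <= s -> K s = K r.
Proof.
move=> hK hN r s r0 rs; apply/eqP; rewrite -subr_eq0 -normr_le0.
apply/ler_addgt0Pl => e e0; rewrite addr0.
have [n hn] : exists n : nat, (s - r) / e < n%:R.
  by exists (Num.bound `|(s - r) / e|); apply: le_lt_trans (ler_norm _) (archi_boundP (normr_ge0 _)).
have n0 : 0 < n.+1%:R :> R by [].
pose d := (s - r) / n.+1%:R.
have d0 : 0 <= d by apply: divr_ge0; [rewrite subr_ge0 | exact: ltW].
have key i : `|K (r + i%:R * d) - K r| <= d * (N r - N (r + i%:R * d)).
  elim: i => [|i ih]; first by rewrite mul0r addr0 !subrr normr0 mulr0.
  have i0 : 0 <= r + i%:R * d by rewrite addr_ge0 // mulr_ge0.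
  have e1 : r + i.+1%:R * d = (r + i%:R * d) + d by rewrite -natr1 mulrDl mul1r addrA.
  have := hK _ (r + i.+1%:R * d) i0; rewrite e1 lerDl => /(_ d0).
  have -> : r + i%:R * d + d - (r + i%:R * d) = d by ring.
  move=> h; have -> : K (r + i%:R * d + d) - K r = (K (r + i%:R * d + d) - K (r + i%:R * d)) + (K (r + i%:R * d) - K r) by rewrite subrKA.
  apply: le_trans (ler_normD _ _) _; lra.
have := key n.+1; have -> : r + n.+1%:R * d = s by rewrite /d mulrC divfK ?pnatr_eq0 // addrC subrK.
move=> h; apply: le_trans h _.
have /andP[a1 a2] := hN r r0; have /andP[a3 a4] := hN s (le_trans r0 rs).
apply: le_trans (_ : d * 1 <= _); first by apply: ler_wpM2l => //; lra.
rewrite mulr1 /d ler_pdivrMr // mulrC -ler_pdivrMr //.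
by apply: ltW; apply: lt_le_trans hn _; rewrite ler_nat.
Qed.

(* [N m] and [L m] stand for the traces of the spectral projection of the density
   for ]m, +oo[ and of [(rho - m)_+]; then [mu] is the generalized inverse of [N]. *)
Record rearr mu N L : Prop := Rearr {
  md0 : forall t, 0 < t -> t <= 1 -> 0 <= mu t;
  md1 : forall s t, 0 < s -> s <= t -> t <= 1 -> mu t <= mu s;
  md2 : forall m t, 0 <= m -> 0 < t -> t <= 1 -> N m <= t -> mu t <= m;
  md3 : forall m t, 0 <= m -> 0 < t -> t <= 1 -> mu t < m -> N m <= t;
  md4 : forall m, 0 <= m -> 0 <= N m <= 1;
  md5 : forall r s, 0 <= r -> r <= s -> (s - r) * N s <= L r - L s <= (s - r) * N r;
  md6 : forall e, 0 < e -> exists2 M, 0 <= M & forall m, M <= m -> `|L m| <= e;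
  md7 : L 0 = 1 }.

(** For [r <= s] this is [hinge r x - hinge s x]; being bounded, it has a finite integral. *)
Definition clamp r s x : R := Num.min (Num.max (x - r) 0) (s - r).
Definition hinge r x : R := Num.max (x - r) 0.

Lemma clampD r s M x : r <= s -> s <= M -> clamp r M x = clamp r s x + clamp s M x.
Proof.
rewrite /clamp !minEle !maxEle => rs sM.
by case: (leP (x - r) 0) => ?; case: (leP (x - s) 0) => ?; do 3!case: leP => ?; lra.
Qed.
Lemma clamp_ge0 r s x : r <= s -> 0 <= clamp r s x.
Proof. by move=> rs; rewrite /clamp le_min le_max lexx orbT subr_ge0 rs. Qed.
Lemma hinge_ge0 r x : 0 <= hinge r x.
Proof. by rewrite /hinge le_max lexx orbT. Qed.

Lemma measurable_rearr mu N L : rearr mu N L -> measurable_fun D mu.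
Proof.
move=> h.
apply: (measurability (@measurable_realfun.RGenCInfty.G R)) => [|/= _ [_] [r] -> <-].
  exact: measurable_realfun.RGenCInfty.measurableE.
apply: is_interval_measurable => s t/= [] + + [].
rewrite !in_itv/= !andbT => /andP[s0 s1] rs /andP[t0 t1] rt u /andP[su ut].
have u0 := lt_le_trans s0 su; have u1 := le_trans ut t1.
by rewrite in_itv/= in_itv/= andbT u0 u1; split=> //; apply: le_trans rt _; exact: (md1 h).
Qed.

Lemma measurable_clamp r s : measurable_fun [set: R] (clamp r s).
Proof.
apply: measurable_minr => //; apply: measurable_maxr => //.
exact: measurable_funB.
Qed.
Lemma measurable_hinge r : measurable_fun [set: R] (hinge r).
Proof. by apply: measurable_maxr => //; exact: measurable_funB. Qed.

Lemma leb_D : leb D = 1%E.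
Proof. by rewrite lebesgue_measure_itv /= lte01 oppr0 adde0. Qed.

Lemma leb_oo a : 0 <= a -> leb (`]0%R, a[%classic) = a%:E.
Proof.
move=> a0; rewrite lebesgue_measure_itv /= lte_fin; case: ltP => [_|h].
  by rewrite oppr0 adde0.
by have -> : a = 0 by apply/eqP; rewrite eq_le h.
Qed.

Lemma integral_step (k a : R) : 0 <= k -> 0 <= a <= 1 ->
  (\int[leb]_(t in D) (k * \1_(`]0%R, a[%classic) t)%:E = (k * a)%:E)%E.
Proof.
move=> k0 /andP[a0 a1].
under eq_integral do rewrite EFinM.
rewrite ge0_integralZl_EFin //; last exact/measurable_EFinP/measurable_indic.
rewrite integral_indic // setIidl.
  by rewrite [X in (_ * X)%E](leb_oo a0).
move=> t /=; rewrite !in_itv /= => /andP[-> h] /=.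
exact: ltW (lt_le_trans h a1).
Qed.

Section Integrals.
Context {mu N L : R -> R}.
Hypothesis h : rearr mu N L.

Let mD : measurable D. Proof. exact: measurable_itv. Qed.
Let mmu : measurable_fun D mu. Proof. exact: measurable_rearr h. Qed.
Let mcl r s : measurable_fun D (fun t => (clamp r s (mu t))%:E).
Proof.
apply/measurable_EFinP; apply: measurableT_comp => //; exact: measurable_clamp.
Qed.

(** The value of [mu] is at least [s] on []0, N s[] and at most [r] from [N r] on, which puts the
    integrand between two step functions. *)
Lemma integral_clamp_bound r s : 0 <= r -> r <= s ->
  (((s - r) * N s)%:E <= \int[leb]_(t in D) (clamp r s (mu t))%:E <= ((s - r) * N r)%:E)%E.
Proof.
move=> r0 rs; have s0 := le_trans r0 rs; have sr : 0 <= s - r by rewrite subr_ge0.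
have mst a : measurable_fun D (fun t => ((s - r) * \1_(`]0%R, a[%classic) t)%:E : \bar R).
  by apply/measurable_EFinP; apply: measurable_funM => //; exact: measurable_indic.
apply/andP; split.
  rewrite -(integral_step sr (md4 h s0)); apply: ge0_le_integral => //.
  - by move=> t _; rewrite lee_fin mulr_ge0 // indicE.
  - exact: mst.
  - exact: mcl.
  - move=> t /=; rewrite in_itv /= => /andP[t0 t1]; rewrite lee_fin indicE.
    have [tN|tN] := ltP t (N s); last first.
      rewrite memNset ?mulr0 ?clamp_ge0 //= in_itv /= t0 /=.
      by apply/negP; rewrite -leNgt.
    rewrite mem_set ?mulr1 /=; last by rewrite in_itv /= t0 tN.
    have ms : s <= mu t by rewrite leNgt; apply/negP => /(md3 h s0 t0 t1); rewrite leNgt tN.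
    by rewrite /clamp le_min lexx andbT le_max lerB.
rewrite -(integral_step sr (md4 h r0)); apply: ge0_le_integral => //.
- by move=> t _; rewrite lee_fin clamp_ge0.
- exact: mcl.
- exact: mst.
- move=> t /=; rewrite in_itv /= => /andP[t0 t1]; rewrite lee_fin indicE.
  have [tN|tN] := ltP t (N r).
    rewrite mem_set ?mulr1 /=; last by rewrite in_itv /= t0 tN.
    by rewrite /clamp ge_min lexx orbT.
  rewrite memNset ?mulr0 //=; last first.
    by rewrite in_itv /= t0 /=; apply/negP; rewrite -leNgt.
  have := md2 h r0 t0 t1 tN; rewrite /clamp ge_min ge_max lexx andbT subr_le0 => ->.
  by [].
Qed.

(** The integral and [L r - L s] obey the same two-sided bound in terms of [N]. Their discrepancy
    therefore has increments controlled by those of [N], and [telescope_const] makes it constant. *)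
Lemma integral_clamp r s : 0 <= r -> r <= s ->
  (\int[leb]_(t in D) (clamp r s (mu t))%:E = (L r - L s)%:E)%E.
Proof.
pose J r s := fine (\int[leb]_(t in D) (clamp r s (mu t))%:E).
have JE r' s' : 0 <= r' -> r' <= s' -> (\int[leb]_(t in D) (clamp r' s' (mu t))%:E = (J r' s')%:E)%E.
  move=> r0 rs; have /andP[h1 h2] := integral_clamp_bound r0 rs.
  rewrite /J fineK //; apply/fin_numPlt.
  by rewrite (lt_le_trans (ltNyr _) h1) (le_lt_trans h2 (ltry _)).
have Jb r' s' : 0 <= r' -> r' <= s' -> (s' - r') * N s' <= J r' s' <= (s' - r') * N r'.
  by move=> r0 rs; have := integral_clamp_bound r0 rs; rewrite JE // !lee_fin.
have JD r' s' t : 0 <= r' -> r' <= s' -> s' <= t -> J r' t = J r' s' + J s' t.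
  move=> r0 rs st; have s0 := le_trans r0 rs.
  apply: EFin_inj; rewrite EFinD -!JE //; last exact: le_trans rs st.
  rewrite -ge0_integralD //.
  - by apply: eq_integral => u _; rewrite -EFinD -clampD.
  - by move=> u _; rewrite lee_fin clamp_ge0.
  - exact: mcl.
  - by move=> u _; rewrite lee_fin clamp_ge0.
  - exact: mcl.
move=> r0 rs; rewrite JE //; congr (_%:E).
have J0 : J 0 0 = 0 by have := JD 0 0 0 (lexx _) (lexx _) (lexx _); lra.
have := @telescope_const (fun x => J 0 x + L x) N.
move=> /(_ _ (md4 h) r s r0 rs) e.
have {e} : J 0 s + L s = J 0 r + L r.
  apply: e => a b a0 ab; rewrite (JD 0 a b) //.
  have /andP[h1 h2] := Jb _ _ a0 ab; have /andP[h3 h4] := md5 h a0 ab.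
  rewrite ler_norml; apply/andP; split; lra.
rewrite (JD 0 r s) //; lra.
Qed.

Lemma integral_hinge r : 0 <= r ->
  (\int[leb]_(t in D) (hinge r (mu t))%:E = (L r)%:E)%E.
Proof.
move=> r0.
pose g (n : nat) t := (clamp r (r + n%:R) (mu t))%:E : \bar R.
have rn (n : nat) : r <= r + n%:R by rewrite lerDl.
have glim t : limn (g^~ t) = (hinge r (mu t))%:E.
  apply: cvg_lim => //.
  have [n hn] : exists n : nat, mu t - r < n%:R.
    by exists (Num.bound `|mu t - r|); apply: le_lt_trans (ler_norm _) (archi_boundP (normr_ge0 _)).
  apply: cvg_near_cst; exists n => // k /= nk.
  rewrite /g /clamp addrAC subrr add0r; congr (_%:E).
  have nk' : n%:R <= k%:R :> R by rewrite ler_nat.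
  apply/min_idPl; rewrite ge_max ler0n andbT; lra.
have := @monotone_convergence _ _ R leb D mD g.
under eq_integral do rewrite glim.
move=> ->; first last.
- move=> t _ m n mn; rewrite lee_fin /clamp le_min ge_min lexx /= addrAC subrr add0r.
  by rewrite ge_min addrAC subrr add0r ler_nat mn orbT.
- by move=> n t _; rewrite lee_fin clamp_ge0.
- by move=> n; exact: mcl.
apply: cvg_lim => //.
rewrite (_ : (fun n => _) = (fun n : nat => (L r - L (r + n%:R))%:E)); last first.
  by apply/funext => n; rewrite integral_clamp.
apply: cvg_EFin; first by apply: nearW.
apply/cvgrPdist_le => e e0; have [M M0 hM] := md6 h e0.
exists (Num.bound M) => // n /= Mn.
rewrite opprB addrC subrK; apply: hM.
have := archi_boundP M0 => hb; have : (Num.bound M)%:R <= n%:R :> R by rewrite ler_nat.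
lra.
Qed.
End Integrals.

Lemma ln_bound x y : 0 < x -> 0 < y -> ln y - ln x <= (y - x) / x.
Proof.
move=> x0 y0; rewrite -ln_div ?posrE //.
have -> : y / x = 1 + (y - x) / x by field; rewrite gt_eqF.
apply: le_ln1Dx; have -> : (y - x) / x = y / x - 1 by field; rewrite gt_eqF.
have := divr_gt0 y0 x0; lra.
Qed.

(** The shift by 1 makes the function nonnegative on [[0, +oo[]: its tangent line at 1 is [x]. *)
Definition ent x : R := x * ln x + 1.
Definition tangent r x : R := x * (ln r + 1) - r + 1.

Lemma tangent_le r x : 0 < r -> 0 <= x -> tangent r x <= ent x.
Proof.
rewrite /tangent /ent => r0; rewrite le_eqVlt => /predU1P[<-|x0]; first by rewrite !mul0r; lra.
have := ln_bound x0 r0; rewrite ler_pdivlMr //; lra.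
Qed.
Lemma tangent_ge r x : 0 < r -> 0 <= x -> ent x - tangent r x <= (x - r) ^+ 2 / r.
Proof.
rewrite /tangent /ent => r0; rewrite le_eqVlt => /predU1P[<-|x0].
  by rewrite !mul0r sub0r sqrrN expr2 mulfK ?gt_eqF //; lra.
have h := ln_bound r0 x0; have := ler_wpM2l (ltW x0) h.
have -> : (x - r) ^+ 2 / r = x * ((x - r) / r) - x + r by field; rewrite gt_eqF.
lra.
Qed.
Lemma tangent_lt r s x : 0 < r -> r <= s -> 0 <= x -> x <= r -> tangent s x <= tangent r x.
Proof.
move=> r0 rs x0 xr; have s0 := lt_le_trans r0 rs; rewrite /tangent.
have h := ler_wpM2l x0 (ln_bound r0 s0).
have h2 : x * ((s - r) / r) <= s - r.
  rewrite mulrA ler_pdivrMr // mulrC; apply: ler_wpM2l => //; lra.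
lra.
Qed.
Lemma tangent_gt r s x : 0 < r -> r <= s -> s <= x -> tangent r x <= tangent s x.
Proof.
move=> r0 rs sx; have s0 := lt_le_trans r0 rs; have x0 := lt_le_trans s0 sx; rewrite /tangent.
have h := ler_wpM2l (ltW x0) (ln_bound s0 r0).
have h2 : s - r <= x * ((s - r) / s).
  rewrite mulrA ler_pdivlMr // mulrC; apply: ler_wpM2r => //; lra.
have e : (r - s) / s = - ((s - r) / s) by rewrite -mulNr opprB.
rewrite e mulrN in h; lra.
Qed.

(* A piecewise linear convex minorant of [ent], written as an affine function
   plus a positive combination of hinges so that it can be integrated. *)
Fixpoint pl (d : R) (m : nat) x : R :=
  if m is k.+1 then pl d k x + Num.max (tangent (k.+2%:R * d) x - tangent (k.+1%:R * d) x) 0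
  else tangent d x.

(** The second clause carries the induction: past the last node only the last tangent is active, so
    adding the next hinge yields the maximum of two tangents. *)
Lemma pl_le d m x : 0 < d -> 0 <= x ->
  pl d m x <= ent x /\ (m.+1%:R * d <= x -> pl d m x = tangent (m.+1%:R * d) x).
Proof.
move=> d0 x0; have p k : 0 < k.+1%:R * d by rewrite mulr_gt0.
have pm k : k.+1%:R * d <= k.+2%:R * d by rewrite ler_pM2r // ler_nat.
elim: m => [|m [ih1 ih2]] /=; first by split=> [|_]; rewrite ?mul1r //; exact: tangent_le.
have [xl|xl] := leP (m.+1%:R * d) x; last first.
  have h := tangent_lt (p m) (pm m) x0 (ltW xl).
  rewrite max_r ?subr_le0 // addr0; split=> // hx.
  by have := lt_le_trans xl (le_trans (pm m) hx); rewrite ltxx.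
rewrite ih2 //; split=> [|hx].
  rewrite addr_maxr addr0 addrC subrK ge_max !tangent_le //.
by rewrite max_l ?subr_ge0 ?tangent_gt // addrC subrK.
Qed.
Lemma pl_ge d m x : (forall j, (j <= m)%N -> tangent (j.+1%:R * d) x <= pl d m x).
Proof.
elim: m => [|m ih] j; first by rewrite leqn0 => /eqP -> /=; rewrite mul1r.
rewrite leq_eqVlt => /predU1P[->|].
  apply: le_trans (_ : tangent (m.+1%:R * d) x + (tangent (m.+2%:R * d) x - tangent (m.+1%:R * d) x) <= _).
    by rewrite addrC subrK.
  by apply: lerD; [exact: ih | rewrite le_max lexx].
rewrite ltnS => /ih /= h; apply: le_trans h _.
by rewrite lerDl le_max lexx orbT.
Qed.
(** The minorant dominates the tangent at the first mesh point [r] beyond [x], whose error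
    [(x - r) ^ 2 / r] is at most the mesh [d] because [r >= d]. The mesh points extend past [n + 1],
    so they reach beyond [x] for large [n]. *)
Lemma pl_cvg x : 0 <= x -> forall e, 0 < e ->
  exists n0, forall n, (n0 <= n)%N -> ent x - pl (n.+1%:R^-1) (n.+1 * n.+1) x <= e.
Proof.
move=> x0 e e0.
have [n0 h0] : exists n : nat, x + 1 + 2 / e < n%:R.
  by exists (Num.bound `|x + 1 + 2 / e|); apply: le_lt_trans (ler_norm _) (archi_boundP (normr_ge0 _)).
exists n0 => n n0n; set d := n.+1%:R^-1.
have hn : x + 1 + 2 / e < n.+1%:R by apply: lt_le_trans h0 _; rewrite ler_nat leqW.
have e2 : 0 < 2 / e by rewrite divr_gt0.
have n1 : 0 < n.+1%:R :> R by [].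
have d0 : 0 < d by rewrite invr_gt0.
pose j := Num.trunc (x / d).
have xd : 0 <= x / d by rewrite divr_ge0 // ltW.
have j1 : j%:R <= x / d by rewrite -truncn_ge_nat.
have j2 : x / d < j.+1%:R by rewrite -truncn_le_nat.
rewrite ler_pdivlMr // in j1; rewrite ltr_pdivrMr // in j2.
have jm : (j <= n.+1 * n.+1)%N.
  rewrite -(ler_nat R) natrM; have : j%:R * d <= n.+1%:R by lra.
  by rewrite -ler_pdivlMr // invrK.
have p : 0 < j.+1%:R * d by rewrite mulr_gt0.
have := pl_ge d x jm => h1; have h2 := tangent_ge p x0.
have e1 : j.+1%:R * d = j%:R * d + d by rewrite -natr1 mulrDl mul1r.
have h3 : (x - j.+1%:R * d) ^+ 2 / (j.+1%:R * d) <= d.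
  have q0 : 0 <= j%:R * d by rewrite mulr_ge0 // ltW.
  rewrite ler_pdivrMr // e1; nra.
have h4 : d <= e.
  have ei : 0 < e^-1 by rewrite invr_gt0.
  have ne : e^-1 < n.+1%:R by lra.
  by rewrite /d -[e]invrK lef_pV2 ?posrE ?invr_gt0 //; exact: ltW.
have h5 := le_trans h2 (le_trans h3 h4); lra.
Qed.
End DecreasingRearrangement.

Section EntropyComparison.
Context {R : realType}.
Implicit Types (mu N L : R -> R) (r s t x : R).
Local Notation leb := (@lebesgue_measure R).
Local Notation D := (`]0%R, 1%R]%classic : set R).

Let mD : measurable D. Proof. exact: measurable_itv. Qed.

Definition slope d (k : nat) : R := ln (k.+2%:R * d) - ln (k.+1%:R * d).
(** The abscissa at which the tangents at [(k + 1) d] and [(k + 2) d] meet. *)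
Definition knot d (k : nat) : R := d / slope d k.
(** The integral of [pl d m x - ln d * x] along [mu], expressed through [L] alone. As the slopes are
    positive, it is monotone in [L] once [L 0] is fixed. *)
Fixpoint pl_val d (m : nat) L : R :=
  if m is k.+1 then pl_val d k L + slope d k * L (knot d k) else L 0 + 1 - d.

Lemma slope_gt0 d k : 0 < d -> 0 < slope d k.
Proof.
move=> d0; rewrite subr_gt0 ltr_ln ?posrE ?mulr_gt0 //.
by rewrite ltr_pM2r // ltr_nat.
Qed.
Lemma knot_ge0 d k : 0 < d -> 0 <= knot d k.
Proof. by move=> d0; rewrite divr_ge0 // ltW // slope_gt0. Qed.
Lemma tangent_diff d k x : 0 < d ->
  Num.max (tangent (k.+2%:R * d) x - tangent (k.+1%:R * d) x) 0 = slope d k * hinge (knot d k) x.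
Proof.
move=> d0; have s0 := slope_gt0 k d0.
rewrite /hinge maxr_pMr ?ltW // mulr0; congr (Num.max _ _).
rewrite mulrBr /knot [slope d k * (_ / _)]mulrC divfK ?gt_eqF // /tangent /slope.
have -> : k.+2%:R = k.+1%:R + 1 :> R by rewrite natr1.
ring.
Qed.
Lemma pl_val_le d m L1 L2 : 0 < d -> L1 0 = L2 0 ->
  (forall r, 0 <= r -> L1 r <= L2 r) -> pl_val d m L1 <= pl_val d m L2.
Proof.
move=> d0 e h; elim: m => [|m ih] /=; first by rewrite e.
by apply: lerD => //; apply: ler_wpM2l; [exact: ltW (slope_gt0 _ _) | apply: h; exact: knot_ge0].
Qed.

Lemma measurable_tangent r : measurable_fun [set: R] (tangent r).
Proof.
rewrite /tangent; apply: measurable_funD => //; apply: measurable_funB => //.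
exact: measurable_funM.
Qed.
Lemma measurable_pl d m : measurable_fun [set: R] (pl d m).
Proof.
elim: m => [|m ih] /=; first exact: measurable_tangent.
apply: measurable_funD => //; apply: measurable_maxr => //.
by apply: measurable_funB; exact: measurable_tangent.
Qed.
Lemma measurable_ent : measurable_fun [set: R] (@ent R).
Proof.
apply: measurable_funD => //; apply: measurable_funM => //; exact: measurable_ln.
Qed.

Section One.
Context {mu N L : R -> R}.
Hypothesis h : rearr mu N L.
Let mmu : measurable_fun D mu. Proof. exact: measurable_rearr h. Qed.
Let mc (f : R -> R) : measurable_fun [set: R] f -> measurable_fun D (fun t => (f (mu t))%:E).
Proof. by move=> mf; apply/measurable_EFinP; exact: measurableT_comp. Qed.
Let mu0 t : D t -> 0 <= mu t.
Proof. by rewrite /= in_itv /= => /andP[? ?]; exact: (md0 h). Qed.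

Lemma integral_mu : (\int[leb]_(t in D) (mu t)%:E = 1)%E.
Proof.
have := integral_hinge h (lexx 0); rewrite (md7 h) => <-; apply: eq_integral => t /set_mem Dt.
by rewrite /hinge subr0 max_l // mu0.
Qed.

Lemma pl_lower d m x : pl d m x >= tangent d x.
Proof. by have := @pl_ge R d m x 0 (leq0n _); rewrite mul1r. Qed.

(** Subtracting [ln d * x] turns the first piece into [x + (1 - d)], so all the pieces are
    nonnegative and can be integrated term by term. *)
Lemma integral_pl_shift d m : 0 < d -> d <= 1 ->
  (\int[leb]_(t in D) (pl d m (mu t) - ln d * mu t)%:E = (pl_val d m L)%:E)%E.
Proof.
move=> d0 d1.
have mpl k : measurable_fun D (fun t => (pl d k (mu t) - ln d * mu t)%:E).
  apply: (mc (f := fun x => pl d k x - ln d * x)); apply: measurable_funB; first exact: measurable_pl.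
  exact: measurable_funM.
elim: m => [|m ih] /=.
  under eq_integral => t _.
    have -> : tangent d (mu t) - ln d * mu t = mu t + (1 - d) by rewrite /tangent; ring.
    rewrite EFinD; over.
  rewrite ge0_integralD; last 5 first.
  - exact: mD.
  - by move=> t /mu0 ?; rewrite lee_fin.
  - by apply/measurable_EFinP; exact: mmu.
  - by move=> t _; rewrite lee_fin subr_ge0.
  - by apply/measurable_EFinP; exact: measurable_cst.
  rewrite integral_mu integral_cst // [X in (_ * X)%E](@leb_D R) mule1 (md7 h) -EFinD; congr (_%:E); ring.
under eq_integral => t _.
  rewrite tangent_diff // addrAC EFinD; over.
rewrite ge0_integralD; last 5 first.
- exact: mD.
- move=> t /mu0 t0; rewrite lee_fin; have := pl_lower d m (mu t); rewrite /tangent; lra.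
- exact: mpl.
- by move=> t _; rewrite lee_fin mulr_ge0 ?hinge_ge0 // ltW // slope_gt0.
- apply: (mc (f := fun x => slope d m * hinge (knot d m) x)); apply: measurable_funM => //.
  exact: measurable_hinge.
under [X in (_ + X)%E]eq_integral do rewrite EFinM.
rewrite ge0_integralZl_EFin; last 4 first.
- exact: mD.
- by move=> t _; rewrite lee_fin hinge_ge0.
- exact: mc (measurable_hinge _).
- exact: ltW (slope_gt0 _ _).
by rewrite ih (integral_hinge h (knot_ge0 _ d0)) -EFinM -EFinD.
Qed.

(* The node [1] of the mesh makes the minorant nonnegative. *)
Lemma pl_ge0 n t : D t -> 0 <= pl n.+1%:R^-1 (n.+1 * n.+1) (mu t).
Proof.
move=> /mu0 m0; have jm : (n <= n.+1 * n.+1)%N by rewrite mulSn addSn leqW ?leq_addr.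
apply: le_trans (pl_ge _ _ jm); rewrite divff ?pnatr_eq0 // /tangent ln1 add0r mulr1.
by rewrite subrK.
Qed.

Lemma integral_pl n : let d := n.+1%:R^-1 in
  (\int[leb]_(t in D) (pl d (n.+1 * n.+1) (mu t))%:E = (pl_val d (n.+1 * n.+1) L + ln d)%:E)%E.
Proof.
move=> d; have d0 : 0 < d by rewrite invr_gt0.
have d1 : d <= 1 by rewrite invf_le1 // ler1n.
have := integral_pl_shift (n.+1 * n.+1) d0 d1.
under eq_integral do rewrite -mulNr EFinD.
have l0 : 0 <= - ln d by rewrite oppr_ge0 ln_le0.
rewrite ge0_integralD; last 5 first.
- exact: mD.
- by move=> t Dt; rewrite lee_fin pl_ge0.
- exact: mc (measurable_pl _ _).
- by move=> t /mu0 t0; rewrite lee_fin mulr_ge0.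
- by apply: (mc (f := fun x => - ln d * x)); exact: measurable_funM.
under [X in (_ + X)%E = _ -> _]eq_integral do rewrite EFinM.
rewrite ge0_integralZl_EFin; last 4 first.
- exact: mD.
- by move=> t /mu0 ?; rewrite lee_fin.
- by apply/measurable_EFinP; exact: mmu.
- exact: l0.
rewrite integral_mu mule1; move: (integral _ _ _) => I; case: I => [x||] //=.
by rewrite -EFinD => -[<-]; congr (_%:E); ring.
Qed.
Lemma measurable_ent_mu : measurable_fun D (fun t => (ent (mu t))%:E).
Proof. exact: mc measurable_ent. Qed.
Lemma measurable_pl_mu d m : measurable_fun D (fun t => (pl d m (mu t))%:E).
Proof. exact: mc (measurable_pl _ _). Qed.
Lemma ent_ge0 t : D t -> 0 <= ent (mu t).
Proof.
by move=> /mu0 m0; apply: le_trans (tangent_le ltr01 m0); rewrite /tangent ln1 add0r mulr1 subrK.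
Qed.
Lemma integral_pl_le n :
  (\int[leb]_(t in D) (pl n.+1%:R^-1 (n.+1 * n.+1) (mu t))%:E <= \int[leb]_(t in D) (ent (mu t))%:E)%E.
Proof.
apply: ge0_le_integral => //.
- by move=> t Dt; rewrite lee_fin pl_ge0.
- exact: measurable_pl_mu.
- exact: measurable_ent_mu.
- move=> t /mu0 t0; rewrite lee_fin.
  have d0 : 0 < n.+1%:R^-1 :> R by rewrite invr_gt0.
  by have [] := pl_le (n.+1 * n.+1) d0 t0.
Qed.
End One.

(** Fatou's lemma along the minorants of [ent (mu1 t)]: for each minorant the integrals along [mu1]
    and [mu2] compare through [pl_val], and along [mu2] the minorant stays below [ent]. Both
    integrals may be infinite. *)
Lemma integral_ent_le mu1 N1 L1 mu2 N2 L2 : rearr mu1 N1 L1 -> rearr mu2 N2 L2 ->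
  (forall r, 0 <= r -> L1 r <= L2 r) ->
  (\int[leb]_(t in D) (ent (mu1 t))%:E <= \int[leb]_(t in D) (ent (mu2 t))%:E)%E.
Proof.
move=> h1 h2 hL.
pose f n t := (pl n.+1%:R^-1 (n.+1 * n.+1) (mu1 t))%:E : \bar R.
have flim t : D t -> limn_einf (f^~ t) = (ent (mu1 t))%:E.
  move=> Dt; have m0 : 0 <= mu1 t by move: Dt; rewrite /= in_itv /= => /andP[? ?]; exact: (md0 h1).
  have cv : f^~ t @ \oo --> (ent (mu1 t))%:E.
    apply: cvg_EFin; first by apply: nearW.
    apply/cvgrPdist_le => e e0; have [n0 hn] := pl_cvg m0 e0.
    exists n0 => // n /= /hn hle; rewrite ger0_norm // subr_ge0.
    have d0 : 0 < n.+1%:R^-1 :> R by rewrite invr_gt0.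
    by have [] := pl_le (n.+1 * n.+1) d0 m0.
  by rewrite is_cvg_limn_einfE; [apply: cvg_lim | apply/cvg_ex; eexists; exact: cv].
have -> : (\int[leb]_(t in D) (ent (mu1 t))%:E = \int[leb]_(t in D) limn_einf (f^~ t))%E.
  by apply: eq_integral => t /set_mem/flim.
apply: le_trans (@fatou _ _ R leb D mD f _ _) _.
- by move=> n; exact: (measurable_pl_mu h1).
- by move=> n t Dt; rewrite lee_fin (pl_ge0 h1).
have ub n : (\int[leb]_(t in D) f n t <= \int[leb]_(t in D) (ent (mu2 t))%:E)%E.
  apply: le_trans (integral_pl_le h2 n); rewrite (integral_pl h1) (integral_pl h2) lee_fin lerD2r.
  by apply: pl_val_le => //; rewrite (md7 h1) (md7 h2).
rewrite limn_einf_lim; apply: lime_le; first exact: is_cvg_einfs.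
apply: nearW => n; apply: le_trans (ub n); apply: ereal_inf_lbound; exists n => //=.
Qed.

(** The negative part of [f - 1] is at most 1, so its integral is finite and can be moved to the
    other side. *)
Lemma integral_shift (f : R -> R) : measurable_fun D f -> (forall t, D t -> 0 <= f t) ->
  (\int[leb]_(t in D) (f t)%:E = \int[leb]_(t in D) (f t - 1)%:E + 1)%E.
Proof.
move=> mf f0; rewrite [X in (X + _)%E]integralE.
pose g t := (f t - 1)%:E : \bar R.
have mg : measurable_fun D g by apply/measurable_EFinP; exact: measurable_funB.
have gn t : D t -> (0 <= g^\- t <= 1)%E.
  move=> /f0 t0; rewrite funenegE /g le_max lexx orbT /= ge_max lee01 andbT lee_fin; lra.
have fin : (\int[leb]_(t in D) g^\- t)%E \is a fin_num.
  apply/fin_numPlt; apply/andP; split.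
    by apply: (@lt_le_trans _ _ 0%E) => //; apply: integral_ge0 => t /gn/andP[].
  apply: (@le_lt_trans _ _ (\int[leb]_(t in D) cst 1 t)%E); last first.
    by rewrite integral_cst // [X in (_ * X)%E](@leb_D R) mule1 ltry.
  apply: ge0_le_integral => //.
  - exact: measurable_funeneg.
  - by move=> t /gn/andP[].
have e : (\int[leb]_(t in D) g^\+ t + 1 = \int[leb]_(t in D) (f t)%:E + \int[leb]_(t in D) g^\- t)%E.
  have -> : (1 = \int[leb]_(t in D) cst 1 t)%E.
    by rewrite integral_cst // [X in (_ * X)%E](@leb_D R) mule1.
  rewrite -!ge0_integralD //.
  - apply: eq_integral => t /set_mem/f0 t0.
    rewrite funeposE funenegE /g -EFinN /cst -!EFin_max -!EFinD; congr (_%:E).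
    by rewrite !maxEle; do 2!case: leP => ?; lra.
  - exact/measurable_EFinP.
  - exact: measurable_funeneg.
  - exact: measurable_funepos.
by rewrite addeAC e addeK.
Qed.

(* The extended integrals of [mu ln mu] exist since this function is bounded below. *)
Lemma integral_xlnx_le mu1 N1 L1 mu2 N2 L2 : rearr mu1 N1 L1 -> rearr mu2 N2 L2 ->
  (forall r, 0 <= r -> L1 r <= L2 r) ->
  (\int[leb]_(t in D) (mu1 t * ln (mu1 t))%:E <= \int[leb]_(t in D) (mu2 t * ln (mu2 t))%:E)%E.
Proof.
move=> h1 h2 hL; have := integral_ent_le h1 h2 hL.
have key mu N L : rearr mu N L -> (\int[leb]_(t in D) (ent (mu t))%:E =
    \int[leb]_(t in D) (mu t * ln (mu t))%:E + 1)%E.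
  move=> h; rewrite integral_shift.
  - by congr (_ + _)%E; apply: eq_integral => t _; rewrite /ent addrK.
  - by apply/measurable_EFinP; exact: (measurable_ent_mu h).
  - exact: (ent_ge0 h).
by rewrite (key _ _ _ h1) (key _ _ _ h2) leeD2rE.
Qed.
End EntropyComparison.

(** * Singular values of a density *)

Section SingularValues.
Context {R : realType} {H : hilbertType R}.
Local Notation B := (bop H).
Context {A : set B} {tau : B -> R[i]}.
Hypotheses (vA : von_neumann_algebra A) (tA : tracial_state A tau).
Local Notation Tr := (tr (tau := tau)).

Lemma pop_norm_le (T : pop (H := H)) (m : R) : 0 <= m ->
  (forall u, pdom T u /\ nm (papp T u) <= m * nm u) -> (pop_norm T <= m%:E)%E.
Proof.
move=> m0 h; rewrite /pop_norm asboolT; last first.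
  by apply/seteqP; split=> u _ //; case: (h u).
apply: ge_ereal_sup => _ [u /= u1 <-]; rewrite lee_fin.
have nu : nm u <= 1 by rewrite -lecR -norm_nm.
have [_ hu] := h u; apply: le_trans hu _; rewrite -[leRHS]mulr1; exact: ler_wpM2l.
Qed.

Lemma pop_norm_ge0 (T : pop (H := H)) : (0 <= pop_norm T)%E.
Proof.
rewrite /pop_norm; case: ifP => // _.
apply: le_trans (ereal_sup_ubound _); last by exists 0 => //=; rewrite normr0.
by rewrite lee_fin; exact: nm_ge0.
Qed.

Lemma pop_norm_bound (T : pop (H := H)) (c : R) : pop_linear T -> (pop_norm T <= c%:E)%E ->
  forall u, pdom T u /\ nm (papp T u) <= c * nm u.
Proof.
rewrite /pop_norm => -[T0 Tl]; case: ifPn => [/asboolP dT|_]; last by rewrite leNgt ltry.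
move=> h u; have du v : pdom T v by rewrite dT.
split=> //.
have h1 v : nm v <= 1 -> nm (papp T v) <= c.
  move=> nv; rewrite -lee_fin; apply: le_trans h; apply: ereal_sup_ubound.
  by exists v => //=; rewrite norm_nm lecR.
have p0 : papp T 0 = 0.
  have [_] := Tl (-1) 0 0 (du 0) (du 0).
  by rewrite !scaleN1r oppr0 addr0 addNr.
have TZ (a : R[i]) v : papp T (a *: v) = a *: papp T v.
  by have [_] := Tl a v 0 (du _) (du _); rewrite p0 !addr0.
have [->|un0] := eqVneq u 0; first by rewrite p0 nm0 mulr0.
have nu : 0 < nm u by rewrite lt_def nm_ge0 andbT; apply: contra_neq un0; exact: nm0_eq0.
have := h1 ((nm u)^-1%:C *: u); rewrite TZ !nmZ ger0_norm ?invr_ge0 ?nm_ge0 //.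
rewrite mulVf ?gt_eqF // => /(_ (lexx _)).
by rewrite mulrC ler_pdivrMr.
Qed.

Context {psi : H} {rho : pop (H := H)}.
Hypotheses (dens : density A tau (vector_state psi) rho) (psi1 : nm psi = 1).
Context {E Y : R -> B}.
Hypothesis sf : specfam (A := A) (rho := rho) E Y.

Lemma rho_comp_linear (p : B) : pop_linear (pop_comp rho p).
Proof.
have [l0 ll] : pop_linear rho by case: dens => _ [].
split=> /= [|c u v du dv]; first by rewrite op0.
by rewrite opD opZ; exact: ll.
Qed.

Definition mu_of (rho' : pop (H := H)) t : R := fine (singular_value A tau rho' t).

Lemma singular_value_ge0 t : (0 <= singular_value A tau rho t)%E.
Proof. by apply: le_ereal_inf_tmp => _ [p _ <-]; exact: pop_norm_ge0. Qed.

Lemma tau_le_tr x (t : R) : A x -> pos x -> (tau x <= t%:C) = (Tr x <= t).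
Proof. by move=> Ax px; rewrite (tau_tr tA Ax px) lecR. Qed.

Lemma singular_value_le m t : 0 <= m -> Tr (E m) <= t -> (singular_value A tau rho t <= m%:E)%E.
Proof.
move=> m0 Nt; have AE := sfA sf m0; have pE := sfP sf m0.
have Aq : A (1 - E m) := vnB vA (vn1 vA) AE.
apply: (@le_trans _ _ (pop_norm (pop_comp rho (1 - E m)))).
  apply: ereal_inf_lbound; exists (1 - E m) => //; split=> //.
    exact/projP/projC.
  by rewrite opprB addrC subrK tau_le_tr //; exact: proj_pos.
apply: pop_norm_le => // u /=; have [d ->] := sfY sf u m0; split=> //.
(* The bound in [pos_nm_le] has to be positive; for [m = 0] the form of [Y 0] is zero and [pos_CS]
   makes the operator vanish. *)
have [m_0|mn0] := eqVneq m 0.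
  have := sfYm sf m0; rewrite m_0 scale0r sub0r => pN.
  have py := sfPY sf m0; rewrite m_0 in py *.
  have y0 v : rd (Y 0 v) v = 0.
    by apply/eqP; rewrite eq_le (pos_rd v py) andbT; have := pos_rd v pN; rewrite bopN rdNl oppr_ge0.
  rewrite mul0r; have := pos_CS u (Y 0 u) py; rewrite y0 mul0r rdE => h.
  rewrite -(@ler_pXn2r _ 4) ?nnegrE ?nm_ge0 // expr0n /=.
  by rewrite (exprM _ 2 2).
apply: pos_nm_le; first by rewrite lt_def mn0.
  exact: (sfPY sf m0).
have -> : m%:C *: (1 : B) - Y m = (m%:C *: (1 - E m) - Y m) + m%:C *: E m.
  by rewrite scalerBr addrAC subrK.
by apply: posD; [exact: (sfYm sf m0) | apply: posZ => //; exact: proj_pos].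
Qed.

Lemma singular_value_fin t : 0 < t -> singular_value A tau rho t \is a fin_num.
Proof.
move=> t0; have [M0 hM] := tr_E_small vA tA dens sf t0.
have m0 : 0 <= Num.max 0 M0 by rewrite le_max lexx.
have h : Tr (E (Num.max 0 M0)) <= t by apply: hM; rewrite le_max lexx orbT.
apply/fin_numPlt; rewrite (le_lt_trans (singular_value_le m0 h) (ltry _)) andbT.
exact: lt_le_trans (ltNyr _) (singular_value_ge0 t).
Qed.

(** A projection witnessing a singular value below [m] bounds [rho] by a constant strictly below
    [m], which is the gap that [spec_cmp] requires. *)
Lemma singular_value_lt m t : 0 <= m -> (singular_value A tau rho t < m%:E)%E -> Tr (E m) <= t.
Proof.
move=> m0 /ereal_inf_lt [_ [p [Ap /projP pp tp] <-]] nm.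
have np := pop_norm_ge0 (pop_comp rho p).
have fp : pop_norm (pop_comp rho p) \is a fin_num.
  by apply/fin_numPlt; rewrite (lt_le_trans (ltNyr _) np) (lt_trans nm (ltry _)).
move: nm np; rewrite -(fineK fp) lte_fin lee_fin => cm c0.
have hp := pop_norm_bound (rho_comp_linear p) (_ : (_ <= (fine (pop_norm (pop_comp rho p)))%:E)%E).
rewrite fineK // in hp; have {}hp := hp (lexx _).
apply: le_trans (spec_cmp vA tA dens sf c0 cm Ap pp hp) _.
by rewrite -tau_le_tr //; [exact: (vnB vA (vn1 vA)) | exact/proj_pos/projC].
Qed.

(** No integration is involved: [L m] is the optimum in [spec_opt], and the bounds on [L r - L s]
    come from testing the optimum at one threshold with the spectral projection of the other.
    Testing with 0 and with 1 gives the behaviour at infinity and the value at 0. *)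
Lemma density_rearr : rearr (mu_of rho) (fun m => Tr (E m))
  (fun m => om (psi := psi) (E m) - m * Tr (E m)).
Proof.
have opt := spec_opt vA tA dens sf psi1.
have trE m : 0 <= m -> 0 <= Tr (E m) <= 1.
  move=> m0; have AE := sfA sf m0; have pE := sfP sf m0.
  rewrite (tr_pos tA AE (proj_pos pE)) /= -(tr1 tA).
  by apply: (tr_le vA tA) => //; [exact: vn1 | exact/proj_pos/projC].
split.
- by move=> t t0 _; apply: fine_ge0; exact: singular_value_ge0.
- move=> s t s0 st _; have t0 := lt_le_trans s0 st.
  apply: fine_le; [exact: singular_value_fin | exact: singular_value_fin |].
  apply: le_ereal_inf => _ [p [Ap pp tp] <-]; exists p => //; split=> //.
  by apply: le_trans tp _; rewrite lecR.
- move=> m t m0 t0 _ Nt; rewrite -lee_fin fineK ?singular_value_fin //.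
  exact: singular_value_le.
- move=> m t m0 t0 _ mt; apply: singular_value_lt => //.
  by rewrite -(fineK (singular_value_fin t0)) lte_fin.
- exact: trE.
- move=> r s r0 rs; have s0 := le_trans r0 rs.
  have h1 := opt r (E s) r0 (sfA sf s0) (sfP sf s0).
  have h2 := opt s (E r) s0 (sfA sf r0) (sfP sf r0).
  by apply/andP; split; lra.
- move=> e e0; have d0 : 0 < Num.min 1 e by rewrite lt_min ltr01.
  have [M0 hM] := E_psi_small dens sf d0.
  exists (Num.max 0 M0); first by rewrite le_max lexx.
  move=> m; rewrite ge_max => /andP[m0 /hM hm].
  have := opt m 0 m0 (vn0 vA) (@proj0 _ _).
  rewrite (tr0 vA tA) mulr0 /om rd0l subr0 => h0.
  rewrite ger0_norm //.
  have [n0 _] := andP (trE m m0); have := mulr_ge0 m0 n0 => h1.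
  have -> : rd (E m psi) psi = nm (E m psi) ^+ 2 by exact: proj_rd (sfP sf m0).
  have h2 : nm (E m psi) ^+ 2 <= 1 * e.
    rewrite expr2; apply: ler_pM => //; apply: le_trans hm _; by rewrite ge_min lexx ?orbT.
  lra.
- rewrite mul0r subr0.
  have := opt 0 1 (lexx _) (vn1 vA) (@proj1 _ _); rewrite !mul0r !subr0 => h.
  have h1 : om (psi := psi) 1 = 1 by rewrite /om bop1E rdE psi1 expr1n.
  apply/eqP; rewrite eq_le -{2}h1 h andbT /om (proj_rd _ (sfP sf (lexx 0))).
  by rewrite expr_le1 // -psi1; exact: proj_nm (sfP sf (lexx 0)).
Qed.
End SingularValues.

(** For each [r] take [p = E1 r] and let [K] be [r * tr p] plus the value of [L] for [phi] at [r]: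
    optimality for [phi] bounds the weight of every [a] with [tr a <= tr p] by this [K], and the
    conclusion compares the two functions [L] at [r]. *)
Lemma entropy_le_of_proj (R : realType) (H : hilbertType R) (A : set (bop H))
    (tau : bop H -> R[i]) (psi phi : H) (rho_psi rho_phi : pop (H := H)) :
  von_neumann_algebra A -> tracial_state A tau -> nm psi = 1 -> nm phi = 1 ->
  density A tau (vector_state psi) rho_psi -> density A tau (vector_state phi) rho_phi ->
  (forall (p : bop H) (K : R), A p -> proj p -> 0 <= K ->
     (forall a, A a -> proj a -> tr (tau := tau) a <= tr (tau := tau) p -> rd (a phi) phi <= K) ->
     rd (p psi) psi <= K) ->
  (entropy A tau rho_phi <= entropy A tau rho_psi)%E.
Proof.
move=> vA tA n1 n2 d1 d2 h.
have [E1 [Y1 s1]] := specfam_ex vA d1; have [E2 [Y2 s2]] := specfam_ex vA d2.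
rewrite /entropy leeN2.
apply: (integral_xlnx_le (density_rearr vA tA d1 n1 s1) (density_rearr vA tA d2 n2 s2)).
move=> r r0; have opt := spec_opt vA tA d2 s2 n2 r0.
have AE := sfA s1 r0; have pE := sfP s1 r0.
have tE := tr_pos tA AE (proj_pos pE).
rewrite lerBlDr; apply: h => //.
  have := opt 0 (vn0 vA) (@proj0 _ _); rewrite (tr0 vA tA) mulr0 /om rd0l subr0 => h0.
  by rewrite addr_ge0 // mulr_ge0.
move=> a Aa pa ta; have := opt a Aa pa; have := ler_wpM2l r0 ta; rewrite /om; lra.
Qed.

(** * Weak* convergence *)

Section GramSchmidt.
Context {R : realType} {V : lmodType R[i]}.
Variable b : V -> V -> R[i].
Hypotheses (b_lin : forall (c : R[i]) x y z, b (c *: x + y) z = c * b x z + b y z)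
  (b_herm : forall x y, b y x = Num.conj (b x y)) (b_pos : forall x, 0 <= b x x).

Let bDl x y z : b (x + y) z = b x z + b y z.
Proof. by have := b_lin 1 x y z; rewrite scale1r mul1r. Qed.
Let b0l z : b 0 z = 0.
Proof. by apply: (addrI (b 0 z)); rewrite -bDl !addr0. Qed.
Let bZl (c : R[i]) x z : b (c *: x) z = c * b x z.
Proof. by have := b_lin c x 0 z; rewrite b0l !addr0. Qed.
Let bBl x y z : b (x - y) z = b x z - b y z.
Proof. by rewrite bDl -scaleN1r bZl mulN1r. Qed.
Let bZr (c : R[i]) x z : b z (c *: x) = Num.conj c * b z x.
Proof. by rewrite b_herm bZl rmorphM [b z x]b_herm. Qed.
Let bDr x y z : b z (x + y) = b z x + b z y.
Proof. by rewrite b_herm bDl rmorphD [b z x]b_herm [b z y]b_herm. Qed.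
Let b0r z : b z 0 = 0. Proof. by rewrite b_herm b0l rmorph0. Qed.
Let conjR (t : R) : Num.conj (t%:C) = t%:C.
Proof. by apply/eqP; rewrite eq_complex /= oppr0 !eqxx. Qed.
Let b_suml (I : Type) (s : seq I) (F : I -> V) z :
  b (\sum_(i <- s) F i) z = \sum_(i <- s) b (F i) z.
Proof. by apply: (big_morph (fun x => b x z)) => [x y|]; rewrite ?bDl ?b0l. Qed.

Let b_null r x : b r r = 0 -> b r x = 0.
Proof.
move=> r0.
have re y : complex.Re (b r y) = 0.
  apply/eqP; rewrite -sqrf_eq0 eq_le sqr_ge0 andbT.
  rewrite -[leRHS](mul0r (complex.Re (b y y))); apply: quad_discr => //.
    exact: Re_le (b_pos y).
  move=> t; have /Re_le := b_pos (t%:C *: y + r).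
  rewrite bDl !bDr !bZl !bZr r0 addr0 !conjR !ReD !ReMr [b y r]b_herm ReJ expr2; lra.
apply: complex_ext; first exact: re.
by have := re ('i%C *: x); rewrite bZr; case: (b r x) => u v /=; rewrite mul0r sub0r mulN1r opprK.
Qed.

Definition gs_next (s : seq V) (v : V) : V :=
  let r := v - \sum_(f <- s) b v f *: f in
  if b r r == 0 then 0 else ((Num.sqrt (complex.Re (b r r)))^-1)%:C *: r.
Fixpoint gs_seq (l : nat -> V) n : seq V :=
  if n is m.+1 then rcons (gs_seq l m) (gs_next (gs_seq l m) (l m)) else [::].
Definition gs (l : nat -> V) n : V := gs_next (gs_seq l n) (l n).

Lemma gs_seqE l n : gs_seq l n = [seq gs l i | i <- iota 0 n].
Proof.
elim: n => // n ih; have -> : iota 0 n.+1 = rcons (iota 0 n) n by rewrite -addn1 iotaD cats1.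
by rewrite map_rcons -ih.
Qed.

Lemma gram_schmidt (l : nat -> V) : exists f : nat -> V,
  [/\ forall i j, i <> j -> b (f i) (f j) = 0,
      forall i, b (f i) (f i) = 1 \/ f i = 0 &
      forall n x, b (l n) x = \sum_(j < n.+1) b (l n) (f j) * b (f j) x].
Proof.
exists (gs l); set f := gs l.
pose r n := l n - \sum_(j < n) b (l n) (f j) *: f j.
have fE n : f n = if b (r n) (r n) == 0 then 0 else ((Num.sqrt (complex.Re (b (r n) (r n))))^-1)%:C *: r n.
  have rE : l n - \sum_(f <- gs_seq l n) b (l n) f *: f = r n.
    by rewrite /r gs_seqE big_map -(big_mkord xpredT (fun j => b (l n) (f j) *: f j)) /index_iota subn0.
  by rewrite /f /gs /gs_next rE.
have bb x : b x x = (complex.Re (b x x))%:C.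
  have := b_pos x; case: (b x x) => u v; rewrite lecE /= => /andP[/eqP -> _]; by [].
have fnorm i : b (f i) (f i) = 1 \/ f i = 0.
  rewrite fE; case: eqVneq => [_|n0]; [by right|left].
  rewrite bZl bZr conjR (bb (r i)) -!rmorphM /= -[1]/(1%:C); congr (_%:C).
  have p : 0 < complex.Re (b (r i) (r i)).
    rewrite lt_def; have := Re_le (b_pos (r i)) => /= ->; rewrite andbT.
    by apply: contra_neq n0 => e; rewrite bb e.
  by rewrite mulrA -invfM -expr2 sqr_sqrtr ?mulVf ?gt_eqF // ltW.
have rf n x : b (r n) x = b (l n) x - \sum_(j < n) b (l n) (f j) * b (f j) x.
  rewrite /r bBl b_suml; congr (_ - _); apply: eq_bigr => j _; exact: bZl.
have fr n x : b (r n) x = 0 -> b (f n) x = 0.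
  by move=> e; rewrite fE; case: ifP; rewrite ?b0l // bZl e mulr0.
have orth_lt n : forall j, (j < n)%N -> b (f n) (f j) = 0.
  elim/ltn_ind: n => n ih j jn; apply: fr; rewrite rf.
  rewrite (bigD1 (Ordinal jn)) //= big1 ?addr0 => [|i ij].
    by case: (fnorm j) => [->|->]; rewrite ?mulr1 ?subrr // b0r mul0r subrr.
  have {}ij : nat_of_ord i != j by apply: contraNneq ij => e; apply/eqP/val_inj.
  case: (ltngtP i j) ij => // [ij _|ij _].
    by rewrite [b (f i) (f j)]b_herm (ih j) // rmorph0 mulr0.
  by rewrite (ih i) ?mulr0 //; exact: ltn_ord.
have orth i j : i <> j -> b (f i) (f j) = 0.
  move=> ij; case: (ltngtP i j) => [h|h|//]; last exact: orth_lt.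
  by rewrite b_herm orth_lt // rmorph0.
split=> // n x.
rewrite big_ord_recr /=; apply/eqP; rewrite addrC -subr_eq -rf; apply/eqP.
have [z|n0] := eqVneq (b (r n) (r n)) 0.
  by rewrite (b_null _ z) (fr _ x (b_null _ z)) mulr0.
have lr : b (l n) (r n) = b (r n) (r n).
  rewrite [RHS]rf big1 ?subr0 // => j _.
  have : b (f n) (f j) = 0 by apply: orth_lt; exact: ltn_ord.
  rewrite fE (negbTE n0) bZl => /eqP; rewrite mulf_eq0 => /orP[|/eqP e].
    rewrite fmorph_eq0 invr_eq0 sqrtr_eq0 leNgt => /negP; case.
    rewrite lt_def; have := Re_le (b_pos (r n)) => /= ->; rewrite andbT.
    by apply: contra_neq n0 => e; rewrite bb e.
  by rewrite [b (f j) _]b_herm e rmorph0 mulr0.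
rewrite fE (negbTE n0) bZl bZr lr conjR (bb (r n)).
have p : 0 < complex.Re (b (r n) (r n)).
  rewrite lt_def; have := Re_le (b_pos (r n)) => /= ->; rewrite andbT.
  by apply: contra_neq n0 => e; rewrite bb e.
set c := complex.Re _ in p *; set q := (Num.sqrt c)^-1.
have -> : q%:C * c%:C * (q%:C * b (r n) x) = (q * c * q)%:C * b (r n) x.
  by rewrite mulrA -!rmorphM.
have -> : q * c * q = 1.
  by rewrite mulrAC -expr2 exprVn sqr_sqrtr ?ltW // mulVf ?gt_eqF.
by rewrite mul1r.
Qed.
End GramSchmidt.

Section WeakStar.
Context {R : realType} {H : hilbertType R}.
Local Notation B := (bop H).
Implicit Types (x y : B) (w : B -> R).

Lemma predual_bound (xi : nat -> H) :
  cvgn (series (fun k => `|xi k| ^+ 2 : R[i]^o)) ->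
  exists M : R, forall n, \sum_(k < n) nm (xi k) ^+ 2 <= M.
Proof.
move=> /cvg_ex[l /cvgrPdist_le/(_ 1 ltr01)[N _ hN]].
have sE n : series (fun k => `|xi k| ^+ 2 : R[i]^o) n = (\sum_(k < n) nm (xi k) ^+ 2)%:C.
  rewrite /series /= big_mkord rmorph_sum; apply: eq_bigr => k _.
  by rewrite norm_nm -rmorphXn.
exists (complex.Re `|l| + 1) => n.
have : \sum_(k < maxn n N) nm (xi k) ^+ 2 <= complex.Re `|l| + 1.
  have := hN (maxn n N) (leq_maxr _ _); rewrite sE => h.
  rewrite -lecR rmorphD /= -norm_Re_real.
  set t := (\sum_(k < maxn n N) _)%:C in h *.
  apply: le_trans (_ : `|t| <= _); first by rewrite normrC lecR ler_norm.
  rewrite -(subrK l t) addrC; apply: le_trans (ler_normD _ _) _.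
  by rewrite lerD2l distrC.
apply: le_trans; rewrite -!(big_mkord xpredT (fun k => nm (xi k) ^+ 2)).
rewrite (big_cat_nat (leq0n n) (leq_maxl n N)) /= lerDl sumr_ge0 // => i _.
exact: sqr_ge0.
Qed.

Lemma predual_approx (omega : B -> R[i]) (xi eta : nat -> H) x :
  series (fun k => dot (x (xi k)) (eta k) : R[i]^o) @ \oo --> (omega x : R[i]^o) ->
  forall e : R, 0 < e -> exists N, forall n, (N <= n)%N ->
    complex.Re `|omega x - \sum_(k < n) dot (x (xi k)) (eta k)| <= e.
Proof.
move=> /cvgrPdist_le h e e0; have e1 : 0 < e%:C by rewrite ltcR.
have [N _ hN] := h _ e1; exists N => n /hN; rewrite /series /= big_mkord.
by rewrite norm_Re_real lecR.
Qed.

Lemma rot (z : R[i]) : exists2 c : R[i], complex.Re `|c| = 1 & (complex.Re `|z|)%:C = c * z.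
Proof.
have [->|zn0] := eqVneq z 0; first by exists 1; rewrite ?mulr0 ?normr1 ?normr0.
have nz : `|z| != 0 by rewrite normr_eq0.
exists (Num.conj z / `|z|); first by rewrite normrM normfV normr_id norm_conjC divff.
by rewrite mulrAC (mulrC (Num.conj z)) -normCK expr2 mulfK // -norm_Re_real.
Qed.

Lemma pos_dot_le x (u v : H) : pos x ->
  complex.Re `|dot (x u) v| <= rd (x u) u + rd (x v) v.
Proof.
move=> px; have [c nc ec] := rot (dot (x u) v).
have e1 : complex.Re `|dot (x u) v| = rd (x (c *: u)) v.
  by rewrite /rd opZ dotZl -ec.
have e2 : rd (x (c *: u)) (c *: u) = rd (x u) u.
  rewrite /rd opZ dotZl dotZr mulrA -normCK (norm_Re_real c) nc expr1n mul1r //.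
have := pos_rd (c *: u - v) px; rewrite opB rdBl !rdBr e2 -e1.
have -> : rd (x v) (c *: u) = complex.Re `|dot (x u) v|.
  by rewrite e1 rd_adj (pos_sa px) rdC.
have := pos_rd u px; have := pos_rd v px; lra.
Qed.

(** In a series representing the functional, the tails are small uniformly in [n] because
    [D n <= D 0], and each of the finitely many remaining terms tends to 0 by [pos_dot_le]. *)
Lemma weakstar_decr (D : nat -> B) : (forall n, pos (D n)) ->
  (forall n, pos (D n - D n.+1)) ->
  (forall u (e : R), 0 < e -> exists N, forall n, (N <= n)%N -> rd (D n u) u <= e) ->
  weakstar_cvg (D @ \oo) 0.
Proof.
move=> pD dD hD omega [xi [eta [/predual_bound[M1 h1] /predual_bound[M2 h2] hom]]].
have om0 : omega 0 = 0.
  apply: Re_norm_eq0; apply/ler_addgt0Pl => e e0; rewrite addr0.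
  have [N hN] := predual_approx (hom 0) e0; have := hN N (leqnn N).
  by rewrite big1 ?subr0 // => k _; rewrite bop0E dot0l.
have [K K0 hK] := pos_bound (pos_sa (pD 0%N)).
have Dle n u : rd (D n u) u <= K * nm u ^+ 2.
  have le0 : rd (D n u) u <= rd (D 0%N u) u.
    elim: n => [//|n ih]; apply: le_trans ih.
    by have := pos_rd u (dD n); rewrite bopB rdBl subr_ge0.
  apply: le_trans le0 _.
  by have := pos_rd u hK; rewrite bopB rdBl subr_ge0 bopZ bop1E rdZl rdE.
pose a k := nm (xi k) ^+ 2 + nm (eta k) ^+ 2.
pose S n := \sum_(k < n) a k.
have a0 k : 0 <= a k by rewrite addr_ge0 ?sqr_ge0.
apply/cvgrPdist_le => _ /gt0_realc[e e0 ->]; rewrite om0.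
have e3 : 0 < e / 3 by rewrite divr_gt0.
have [||N0 hN0] := @mono_cauchy R S (M1 + M2) _ _ (e / 3 / K) (divr_gt0 e3 K0).
- by move=> n; rewrite /S big_ord_recr /= lerDl.
- by move=> n; rewrite /S /a big_split /=; apply: lerD; [exact: h1 | exact: h2].
pose c n k := rd (D n (xi k)) (xi k) + rd (D n (eta k)) (eta k).
have [n1 hn1] : exists n1, forall n, (n1 <= n)%N -> \sum_(k < N0) c n k <= e / 3.
  have : forall f : R, 0 < f -> exists n1, forall n, (n1 <= n)%N -> \sum_(k < N0) c n k <= f.
    elim: N0 {hN0} => [|N0 ih] f f0; first by exists 0%N => n _; rewrite big_ord0 ltW.
    have f3 : 0 < f / 3 by rewrite divr_gt0.
    have [m1 k1] := ih _ f3; have [m2 k2] := hD (xi N0) _ f3; have [m3 k3] := hD (eta N0) _ f3.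
    exists (maxn m1 (maxn m2 m3)) => n; rewrite !geq_max => /and3P[q1 q2 q3].
    rewrite big_ord_recr /= /c.
    have := k1 _ q1; have := k2 _ q2; have := k3 _ q3; rewrite /c; lra.
  by apply.
exists n1 => // n /= nn; rewrite sub0r normrN norm_Re_real lecR.
have [N hN] := predual_approx (hom (D n)) e3.
set m := maxn N N0; have {}hN := hN m (leq_maxl _ _).
have hs : complex.Re `|\sum_(k < m) dot (D n (xi k)) (eta k)| <= e / 3 + e / 3.
  have hc : complex.Re `|\sum_(k < m) dot (D n (xi k)) (eta k)| <= \sum_(k < m) c n k.
    rewrite -lecR -norm_Re_real rmorph_sum /=; apply: le_trans (ler_norm_sum _ _ _) _.
    apply: ler_sum => k _; rewrite norm_Re_real lecR; exact: pos_dot_le.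
  apply: le_trans hc _.
  rewrite -(big_mkord xpredT (c n)) (big_cat_nat (leq0n N0) (leq_maxr N N0)) /=.
  rewrite big_mkord; apply: lerD; first exact: hn1.
  have := hN0 m (leq_maxr _ _); rewrite /S -!(big_mkord xpredT a).
  rewrite (big_cat_nat (leq0n N0) (leq_maxr N N0)) /= addrAC subrr add0r.
  rewrite ler_pdivlMr // => h; apply: le_trans h; rewrite big_distrl /=.
  apply: ler_sum => k _; rewrite /c /a mulrDl ![_ * K]mulrC; exact: lerD.
have : `|omega (D n)| <= `|omega (D n) - \sum_(k < m) dot (D n (xi k)) (eta k)| + `|\sum_(k < m) dot (D n (xi k)) (eta k)|.
  by rewrite -{1}(subrK (\sum_(k < m) dot (D n (xi k)) (eta k)) (omega (D n))) ler_normD.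
move=> /Re_le; rewrite ReD; lra.
Qed.

(** Monotonicity reduces the claim to a single index. The form at [zeta m + v] is at most twice the
    sum of the forms at [zeta m] and at [v], which explains [e / 4] and [4 * K]. *)
Lemma decr_dense (D : nat -> B) (zeta : nat -> H) :
  (forall n, pos (D n)) -> (forall n, pos (D n - D n.+1)) ->
  (forall u (e : R), 0 < e -> exists m, nm (u - zeta m) <= e) ->
  (forall m (e : R), 0 < e -> exists N, rd (D N (zeta m)) (zeta m) <= e) ->
  forall u (e : R), 0 < e -> exists N, forall n, (N <= n)%N -> rd (D n u) u <= e.
Proof.
move=> pD dD hz hD u e e0.
have mono m n v : (m <= n)%N -> rd (D n v) v <= rd (D m v) v.
  move=> mn; rewrite -(subnK mn); elim: (n - m)%N => [//|k ih]; apply: le_trans ih.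
  by have := pos_rd v (dD (k + m)%N); rewrite bopB rdBl subr_ge0.
have [K K0 hK] := pos_bound (pos_sa (pD 0%N)).
set d := Num.min 1 (e / (4 * K)).
have d0 : 0 < d by rewrite lt_min ltr01 divr_gt0 // mulr_gt0.
have dK : d * (4 * K) <= e by rewrite -ler_pdivlMr ?mulr_gt0 // ge_min lexx orbT.
have d1 : d <= 1 by rewrite ge_min lexx.
have [m hm] := hz u d d0; have [N hN] := hD m (e / 4) (divr_gt0 e0 (ltr0Sn _ 3)).
exists N => n Nn; apply: le_trans (mono _ _ u Nn) _.
move: hm; move vE : (u - zeta m) => v hm.
have uE : u = zeta m + v by rewrite -vE addrC subrK.
have h1 : rd (D N v) v <= K * d.
  apply: le_trans (mono 0%N N v (leq0n _)) _.
  have := pos_rd v hK; rewrite bopB rdBl subr_ge0 bopZ bop1E rdZl rdE => h.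
  apply: le_trans h _; apply: ler_wpM2l; first exact: ltW.
  rewrite expr2 -[leRHS]mul1r; apply: ler_pM => //; exact: le_trans hm d1.
have := pos_rd (zeta m - v) (pD N).
rewrite uE !opD !opN !rdDl !rdDr !rdNl !rdNr.
move: hN h1; lra.
Qed.

Record pfun w : Prop := Pfun {
  pfD : forall x y, w (x + y) = w x + w y;
  pfZ : forall (r : R) x, w (r%:C *: x) = r * w x;
  pf_ge0 : forall x, pos x -> 0 <= w x }.
Definition wle w w' := forall x, pos x -> w x <= w' x.
Definition wnormal w := forall (F : set_system B) x, Filter F -> weakstar_cvg F x ->
  forall e : R, 0 < e -> \forall y \near F, `|w y - w x| <= e.

Section Pfun.
Context {w : B -> R}.
Hypothesis pw : pfun w.
Lemma pf0 : w 0 = 0.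
Proof. by have := pfZ pw 0 0; rewrite scaler0 mul0r. Qed.
Lemma pfN x : w (- x) = - w x.
Proof.
by have := pfZ pw (-1) x; rewrite rmorphN1 scaleN1r mulN1r.
Qed.
Lemma pfB x y : w (x - y) = w x - w y.
Proof. by rewrite (pfD pw) pfN. Qed.
Lemma pf_sum (I : Type) (s : seq I) (P : pred I) (F : I -> B) :
  w (\sum_(i <- s | P i) F i) = \sum_(i <- s | P i) w (F i).
Proof. by apply: (big_morph w) => [x y|]; rewrite ?(pfD pw) ?pf0. Qed.
Lemma pf_le x y : pos (y - x) -> w x <= w y.
Proof. by move=> h; rewrite -subr_ge0 -pfB (pf_ge0 pw). Qed.
End Pfun.

Definition vec (u : H) x : R := rd (x u) u.
Lemma vec_pfun u : pfun (vec u).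
Proof.
split=> [x y|r x|x px]; rewrite /vec.
- by rewrite bopD rdDl.
- by rewrite bopZ rdZl.
- exact: pos_rd.
Qed.

Lemma vector_state_predual u : predual (H := H) (vector_state u).
Proof.
pose xi k : H := if k is 0%N then u else 0.
have c (f : nat -> R[i]^o) : (forall k, f k.+1 = 0) -> series f @ \oo --> f 0%N.
  move=> f0; apply: cvg_near_cst; exists 1%N => // -[//|n] _.
  by rewrite /series /= big_nat_recl // big1 ?addr0.
have cx : cvgn (series (fun k => `|xi k| ^+ 2 : R[i]^o)).
  by apply/cvg_ex; eexists; apply: c => k /=; rewrite normr0 expr0n.
exists xi, xi; split; [exact: cx | exact: cx | move=> x].
have h k : dot (x (xi k.+1)) (xi k.+1) = 0 by exact: dot0r.
exact: (c (fun k => dot (x (xi k)) (xi k)) h).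
Qed.
Lemma vec_wnormal u : wnormal (vec u).
Proof.
move=> F x FF /(_ _ (vector_state_predual u)) /cvgrPdist_le h e e0.
have e1 : 0 < e%:C by rewrite ltcR.
apply: filterS (h _ e1) => y; rewrite norm_Re_real lecR => hy.
by apply: le_trans hy; rewrite distrC -ReN -ReD; exact: Re_le_norm.
Qed.

Lemma wnormal_comp w (T : B -> B) : wnormal w -> normal_map T -> wnormal (w \o T).
Proof.
move=> nw nT F x FF Fx e e0; have := nw _ _ _ (nT F x FF Fx) e e0; exact.
Qed.

Record pmap (T : B -> B) : Prop := Pmap {
  pmD : forall x y, T (x + y) = T x + T y;
  pmZ : forall (c : R[i]) x, T (c *: x) = c *: T x;
  pm_pos : forall x, pos x -> pos (T x) }.

Lemma cp_pmap T : completely_positive T -> pmap T.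
Proof.
move=> [Tl Tp].
have TD x y : T (x + y) = T x + T y by have := Tl 1 x y; rewrite !scale1r.
have T0 : T 0 = 0 by apply: (addrI (T 0)); rewrite -TD !addr0.
split=> // [c x|x px]; first by have := Tl c x 0; rewrite T0 !addr0.
apply/positive_opP => u.
have : mx_positive (fun i j : 'I_1 => x).
  move=> xi; rewrite !big_ord1; exact: ((positive_opP x).2 px _).
by move=> /Tp /(_ (fun=> u)); rewrite !big_ord1.
Qed.
Lemma NCP_pmap T : NCP T -> pmap T.
Proof. by case=> /cp_pmap. Qed.
Lemma pm0 T : pmap T -> T 0 = 0.
Proof. by move=> h; have := pmZ h 0 0; rewrite !scale0r. Qed.
Lemma pmN T x : pmap T -> T (- x) = - T x.
Proof. by move=> h; rewrite -scaleN1r (pmZ h) scaleN1r. Qed.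
Lemma pmB T x y : pmap T -> T (x - y) = T x - T y.
Proof. by move=> h; rewrite (pmD h) pmN. Qed.
Lemma pm_sum T (I : Type) (s : seq I) (P : pred I) (F : I -> B) : pmap T ->
  T (\sum_(i <- s | P i) F i) = \sum_(i <- s | P i) T (F i).
Proof. by move=> h; apply: (big_morph T) => [x y|]; rewrite ?(pmD h) ?pm0. Qed.
Lemma pfun_comp w T : pfun w -> pmap T -> pfun (w \o T).
Proof.
move=> pw pT; split=> [x y|r x|x px] /=.
- by rewrite (pmD pT) (pfD pw).
- by rewrite (pmZ pT) (pfZ pw).
- by apply: (pf_ge0 pw); exact: (pm_pos pT).
Qed.

Lemma pfunD w w' : pfun w -> pfun w' -> pfun (fun x => w x + w' x).
Proof.
move=> p p'; split=> [x y|r x|x px].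
- by rewrite (pfD p) (pfD p') addrACA.
- by rewrite (pfZ p) (pfZ p') mulrDr.
- by rewrite addr_ge0 // ?(pf_ge0 p) ?(pf_ge0 p').
Qed.
Lemma pfun0 : pfun (fun=> 0).
Proof. by split=> // *; rewrite ?addr0 ?mulr0. Qed.

Lemma ler_sum_subset (I : choiceType) (s t : seq I) (F : I -> R) :
  uniq s -> uniq t -> {subset s <= t} -> (forall i, 0 <= F i) ->
  \sum_(i <- s) F i <= \sum_(i <- t) F i.
Proof.
move=> us ut st F0.
have e : perm_eq [seq i <- t | i \in s] s.
  apply: uniq_perm => //; first exact: filter_uniq.
  move=> i; rewrite mem_filter; case: (boolP (i \in s)) => //= /st ->; by [].
rewrite -(perm_big _ e) /= big_filter [leRHS](bigID (mem s)) /= lerDl.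
by apply: sumr_ge0.
Qed.

Section WeakSums.
Context {I : choiceType} {S : set I} {f : I -> B} {x : B} {w : B -> R}.
Hypotheses (pw : pfun w) (nw : wnormal w) (fx : weakstar_sum S f x)
  (pf : forall i, S i -> pos (f i)).

Let wf i := if i \in S then w (f i) else 0.
Let wf0 i : 0 <= wf i.
Proof. by rewrite /wf; case: ifPn => // /set_mem/pf/(pf_ge0 pw). Qed.
Let wsumE (s : seq I) : w (\sum_(i <- s | i \in S) f i) = \sum_(i <- s) wf i.
Proof. by rewrite (pf_sum pw) big_mkcond. Qed.

Lemma weakstar_sum_approx (e : R) : 0 < e ->
  exists2 s : seq I, uniq s & forall t, uniq t -> {subset s <= t} ->
    `|w (\sum_(i <- t | i \in S) f i) - w x| <= e.
Proof.
move=> e0; have [|K0 _ hK] := nw _ fx e0; first exact: fmap_filter totally_filter.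
exists K0; first exact: fset_uniq.
move=> t ut st; have tE : perm_eq [fset i in t]%fset t.
  by apply: uniq_perm => // i; rewrite in_fset.
rewrite wsumE -(perm_big _ tE) -wsumE; apply: hK.
by apply/fsubsetP => i /st; rewrite in_fset.
Qed.

Lemma weakstar_sum_ge (t : seq I) : uniq t -> w (\sum_(i <- t | i \in S) f i) <= w x.
Proof.
move=> ut; apply/ler_addgt0Pr => e e0.
have [s us hs] := weakstar_sum_approx e0.
have h := hs (undup (s ++ t)) (undup_uniq _); rewrite !wsumE in h *.
have : \sum_(i <- t) wf i <= \sum_(i <- undup (s ++ t)) wf i.
  apply: ler_sum_subset => //; first exact: undup_uniq.
  by move=> i it; rewrite mem_undup mem_cat it orbT.
have /h : {subset s <= undup (s ++ t)} by move=> i it; rewrite mem_undup mem_cat it.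
rewrite ler_norml => /andP[]; lra.
Qed.
End WeakSums.

(** Passes from the net of finite subsets to initial segments: any initial segment containing a good
    finite subset is good. *)
Lemma weakstar_sum_nat (f : nat -> B) x : weakstar_sum setT f x -> (forall i, pos (f i)) ->
  adj x = x ->
  let D n := x - \sum_(i < n) f i in
  [/\ forall n, pos (D n), forall n, pos (D n - D n.+1) &
    forall u (e : R), 0 < e -> exists N, forall n, (N <= n)%N -> rd (D n u) u <= e].
Proof.
move=> fx pf xs D.
have E n : \sum_(i < n) f i = \sum_(i <- iota 0 n | i \in [set: nat]) f i.
  rewrite -(big_mkord xpredT f) /index_iota subn0 [RHS]big_mkcond; apply: eq_bigr => i _.
  by rewrite in_setT.
have pf' i : [set: nat] i -> pos (f i) by move=> _; exact: pf.
split=> [n|n|u e e0].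
- split=> [|u]; first by rewrite adjB xs (pos_sa (pos_sum _ _)).
  rewrite bopB rdBl subr_ge0 E.
  exact: (weakstar_sum_ge (vec_pfun u) (vec_wnormal u) fx pf' (iota_uniq _ _)).
- by rewrite /D opprB addrC addrA subrK big_ord_recr /= addrC addKr.
- have [s us hs] := weakstar_sum_approx (vec_pfun u) (vec_wnormal u) fx e0.
  exists (\max_(i <- s) i).+1 => n hn; rewrite /D bopB rdBl E.
  have := hs (iota 0 n) (iota_uniq _ _); rewrite ler_norml /vec => /(_ _)/andP[]; last first.
    by move=> ? _; lra.
  move=> i si; rewrite mem_iota add0n /=; apply: leq_trans hn; rewrite ltnS.
  by rewrite (big_rem i) //= leq_maxl.
Qed.
End WeakStar.

(** * Kraus decompositions *)

Section RankOne.
Context {R : realType} {H : hilbertType R}.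
Local Notation B := (bop H).
Implicit Types (u v z : H) (x y b : B).

Lemma theta_ex v u : exists t : B, forall z, t z = dot z u *: v.
Proof.
apply: (@mk_bop _ _ _ (nm u * nm v)) => [c z1 z2|z].
  by rewrite dotDl dotZl scalerDl scalerA.
by rewrite nm_cZ mulrAC; apply: ler_wpM2r => //; rewrite mulrC; exact: dot_CS.
Qed.
(** The rank one operator |v><u|. *)
Definition theta v u : B := projT1 (cid (theta_ex v u)).
Lemma thetaE v u z : theta v u z = dot z u *: v.
Proof. exact: (projT2 (cid (theta_ex v u))). Qed.
Lemma mul_theta x v u : x * theta v u = theta (x v) u.
Proof. by apply: bop_ext => z; rewrite bopM !thetaE opZ. Qed.
Lemma theta_mul v u x : theta v u * x = theta v (adj x u).
Proof. by apply: bop_ext => z; rewrite bopM !thetaE dot_adj. Qed.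
Lemma theta_adj v u : adj (theta v u) = theta u v.
Proof.
apply/esym/adj_unique => z1 z2; rewrite !thetaE dotZl dotZr.
by rewrite [dot z2 v]dotC conjCK mulrC.
Qed.
Lemma thetaDr v (c : R[i]) u1 u2 : theta v (c *: u1 + u2) = Num.conj c *: theta v u1 + theta v u2.
Proof. by apply: bop_ext => z; rewrite bopD bopZ !thetaE dotDr dotZr scalerDl scalerA. Qed.
Lemma theta_theta v u v' u' : theta v u * theta v' u' = dot v' u *: theta v u'.
Proof. by apply: bop_ext => z; rewrite bopM bopZ !thetaE dotZl !scalerA mulrC. Qed.
Lemma theta_sqr_rd v z : rd (theta v v z) z = complex.Re `|dot z v| ^+ 2.
Proof.
rewrite /rd thetaE dotZl [dot v z]dotC -normCK (norm_Re_real (dot z v)) -rmorphXn //.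
Qed.
Lemma theta_pos v : pos (theta v v).
Proof.
split=> [|z]; first exact: theta_adj.
by rewrite theta_sqr_rd sqr_ge0.
Qed.
Lemma theta_le v : pos ((nm v ^+ 2)%:C *: (1 : B) - theta v v).
Proof.
split=> [|z]; first by rewrite adjB adjZ adj1 theta_adj.
rewrite bopB bopZ bop1E rdBl rdZl rdE theta_sqr_rd subr_ge0 -exprMn.
rewrite ler_pXn2r ?nnegrE ?Re_norm_ge0 ?mulr_ge0 // mulrC; exact: dot_CS.
Qed.

(* An orthonormal system, possibly padded with zero vectors. *)
Definition onseq (v : nat -> H) := (forall i j, i <> j -> dot (v i) (v j) = 0) /\
  (forall i, dot (v i) (v i) = 1 \/ v i = 0).
Definition fproj (v : nat -> H) n : B := \sum_(i < n) theta (v i) (v i).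

Lemma fproj_proj (v : nat -> H) n : onseq v -> proj (fproj v n).
Proof.
move=> [ho1 ho2]; split.
  rewrite /fproj big_distrl /=; apply: eq_bigr => i _; rewrite big_distrr /=.
  rewrite (bigD1 i) //= big1 ?addr0 => [|j ij].
    rewrite theta_theta; case: (ho2 i) => [->|->]; first by rewrite scale1r.
    by rewrite dot0l scale0r; apply: bop_ext => z; rewrite thetaE scaler0.
  rewrite theta_theta ho1 ?scale0r // => e; move/eqP: ij; apply; exact: val_inj.
rewrite /fproj; elim/big_rec: _ => [|i x _ IH]; first exact: adj0.
by rewrite adjD theta_adj IH.
Qed.
Lemma bessel (v : nat -> H) n u : onseq v -> \sum_(i < n) complex.Re `|dot u (v i)| ^+ 2 <= nm u ^+ 2.
Proof.
move=> ov; have := pos_rd u (proj_pos (projC (fproj_proj n ov))).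
rewrite bopB bop1E rdBl rdE subr_ge0 /fproj bop_sum => h; apply: le_trans h.
rewrite le_eqVlt; apply/orP; left; apply/eqP.
elim: n => [|n ih]; first by rewrite !big_ord0 rd0l.
by rewrite !big_ord_recr /= rdDl ih theta_sqr_rd.
Qed.

Lemma dense_seq : separable H -> exists zeta : nat -> H,
  forall u (e : R), 0 < e -> exists m, nm (u - zeta m) <= e.
Proof.
move=> [D /countable_injP[f finj] dD].
have ex n : exists z : H, (exists2 y, D y & f y = n) -> D z /\ f z = n.
  have [[y Dy fy]|h] := pselect (exists2 y, D y & f y = n); first by exists y.
  by exists 0.
have [zeta hz] := choice ex; exists zeta => u e e0.
have [] := dD (ball u e%:C).
- by exists u; apply: ballxx; rewrite ltcR.
- exact: ball_open.
move=> y [hb Dy]; exists (f y).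
have [|D' e'] := hz (f y); first by exists y.
have -> : zeta (f y) = y by apply: finj => //; rewrite in_setE.
by move: hb; rewrite -ball_normE /= norm_nm ltcR => /ltW.
Qed.

Lemma fproj_dense : separable H -> exists v : nat -> H, onseq v /\
  forall u (e : R), 0 < e -> exists N, forall n, (N <= n)%N -> rd ((1 - fproj v n) u) u <= e.
Proof.
move=> /dense_seq[zeta hz].
have [|||v [ho1 ho2 pv]] := @gram_schmidt R H (fun u z => dot u z) _ _ _ zeta.
- exact: dot_linearl.
- exact: dotC.
- by move=> x; rewrite dotE ler0c sqr_ge0.
have ov : onseq v by split.
exists v; split=> //; apply: (decr_dense (zeta := zeta)) => //.
- by move=> n; apply/proj_pos/projC/fproj_proj.
- move=> n; rewrite opprB addrC addrA subrK /fproj big_ord_recr /= addrC addKr.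
  exact: theta_pos.
move=> m e e0; exists m.+1.
(* By the Gram-Schmidt expansion, [zeta m] lies in the span of the first [m + 1] vectors. *)
suff -> : (1 - fproj v m.+1) (zeta m) = 0 by rewrite rd0l ltW.
apply: rd_eq0 => z; rewrite bopB bop1E rdBl /rd pv /fproj bop_sum dot_suml.
apply/eqP; rewrite subr_eq0; apply/eqP; congr complex.Re; apply: eq_bigr => i _.
by rewrite thetaE dotZl.
Qed.
End RankOne.

Section CompletelyPositive.
Context {R : realType} {H : hilbertType R}.
Local Notation B := (bop H).
Implicit Types (u v z : H) (x y b : B).
Context {Psi : B -> B}.
Hypothesis cpPsi : completely_positive Psi.

Local Notation pP := (cp_pmap cpPsi).

(** A self-adjoint operator is a difference of positive ones; the general case follows from
    [x + adj x] and [i (x - adj x)]. *)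
Lemma cp_adj x : Psi (adj x) = adj (Psi x).
Proof.
have sa y : adj y = y -> adj (Psi y) = Psi y.
  move=> ys; have [K K0 hK] := pos_bound ys.
  have h1 := pos_sa (pm_pos pP hK); have h2 := pos_sa (pm_pos pP (@pos1 R H)).
  move: h1; rewrite (pmB _ _ pP) (pmZ pP) adjB adjZ h2 => /addrI; exact: oppr_inj.
have h1 : adj (Psi x) + adj (Psi (adj x)) = Psi x + Psi (adj x).
  by rewrite -adjD -(pmD pP); apply: sa; rewrite adjD adjK addrC.
have h2 : adj (Psi x) - adj (Psi (adj x)) = Psi (adj x) - Psi x.
  have : adj (Psi ('i%C *: (x - adj x))) = Psi ('i%C *: (x - adj x)).
    by apply: sa; rewrite adjZi adjB adjK -scalerN opprB.
  rewrite (pmZ pP) (pmB _ _ pP) adjZi adjB -scalerN opprB => /(congr1 (fun y => (- 'i%C) *: y)).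
  rewrite !scalerA mulNr -expr2 sqr_i opprK !scale1r => /(congr1 -%R).
  by rewrite !opprB.
have := congr2 +%R h1 h2; rewrite addrACA subrr addr0 (addrC (Psi x)) [RHS]addrACA subrr addr0 => e.
by rewrite -[LHS]halfD -scalerDr -e scalerDr halfD.
Qed.

(** Frees complete positivity from ordinal indices, as needed for [bool] in [cp_CS] and for the sum
    type in [kop_dominated]. *)
Lemma cp_fin (T : finType) (X : T -> T -> B) (xi : T -> H) :
  (forall et : T -> H, 0 <= \sum_a \sum_b dot (X a b (et b)) (et a)) ->
  0 <= \sum_a \sum_b dot (Psi (X a b) (xi b)) (xi a).
Proof.
have reidx (F : T -> T -> R[i]) :
    \sum_(i < #|T|) \sum_(j < #|T|) F (enum_val i) (enum_val j) = \sum_a \sum_b F a b.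
  rewrite [RHS](reindex_onto (@enum_val T T) (@enum_rank T)) /=; last first.
    by move=> i _; rewrite enum_rankK.
  apply: eq_big => [i|i _]; first by rewrite enum_valK eqxx.
  rewrite [RHS](reindex_onto (@enum_val T T) (@enum_rank T)) /=; last first.
    by move=> j _; rewrite enum_rankK.
  by apply: eq_bigl => j; rewrite enum_valK eqxx.
move=> hX; rewrite -reidx.
apply: (cpPsi.2 _ (fun i j => X (enum_val i) (enum_val j)) _ (fun i => xi (enum_val i))).
move=> et; have := hX (fun a => et (enum_rank a)); rewrite -reidx.
under eq_bigr do under eq_bigr do rewrite !enum_valK.
by [].
Qed.

(* Positivity of the Stinespring inner product. *)
Lemma cp_stinespring (T : finType) (Y : T -> B) x (xi : T -> H) : pos x ->
  0 <= \sum_a \sum_b dot (Psi (adj (Y a) * x * Y b) (xi b)) (xi a).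
Proof.
move=> px; apply: cp_fin => et; pose s := \sum_i Y i (et i).
suff -> : \sum_a \sum_b dot ((adj (Y a) * x * Y b) (et b)) (et a) = dot (x s) s.
  exact: ((positive_opP x).2 px _).
rewrite /s dot_sumr; apply: eq_bigr => i _.
rewrite op_sum dot_suml; apply: eq_bigr => j _.
by rewrite !bopM dot_adj adjK.
Qed.

Lemma cp_theta (T : finType) (a : T -> H) (xi : T -> H) :
  0 <= \sum_i \sum_j dot (Psi (theta (a i) (a j)) (xi j)) (xi i).
Proof.
apply: cp_fin => et; pose s := \sum_i dot (et i) (a i).
suff -> : \sum_i \sum_j dot (theta (a i) (a j) (et j)) (et i) = s * Num.conj s.
  exact: mul_conjC_ge0.
rewrite /s rmorph_sum mulr_sumr /=; apply: eq_bigr => i _.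
rewrite mulr_suml; apply: eq_bigr => j _.
by rewrite thetaE dotZl [dot (a i) _]dotC.
Qed.

Lemma cp_CS u v (xi z : H) :
  rd (Psi (theta v u) xi) z ^+ 2 <= rd (Psi (theta u u) xi) xi * rd (Psi (theta v v) z) z.
Proof.
rewrite mulrC; apply: quad_discr.
- exact: pos_rd (pm_pos pP (theta_pos v)).
- exact: pos_rd (pm_pos pP (theta_pos u)).
move=> t; have := cp_theta (fun b : bool => if b then u else v) (fun b : bool => if b then t%:C *: xi else z).
rewrite !big_bool /= => /Re_le; rewrite !ReD -!/(rd _ _) !opZ !rdZl !rdZr.
have -> : rd (Psi (theta u v) z) xi = rd (Psi (theta v u) xi) z.
  by rewrite -theta_adj cp_adj -rd_adjr rdC.
by rewrite expr2; lra.
Qed.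

Lemma cp_dot_bound u v (xi z : H) : complex.Re `|dot (Psi (theta v u) xi) z| ^+ 2 <=
  rd (Psi (theta u u) xi) xi * rd (Psi (theta v v) z) z.
Proof.
have [c nc ec] := rot (dot (Psi (theta v u) xi) z).
have -> : complex.Re `|dot (Psi (theta v u) xi) z| = rd (Psi (theta v u) (c *: xi)) z.
  by rewrite /rd opZ dotZl -ec.
apply: le_trans (cp_CS _ _ _ _) _.
by rewrite /rd opZ dotZl dotZr mulrA -normCK (norm_Re_real c) nc expr1n mul1r.
Qed.

(* [k xi] is the image of [1 (x) xi] under the adjoint of [u |-> theta u v (x) z], in
   the Stinespring space. *)
Lemma kraus_ex v z : exists k : B, forall xi u, dot (k xi) u = dot (Psi (theta v u) xi) z.
Proof.
have [K K0 hK] := pos_bound (pos_sa (pm_pos pP (@pos1 R H))).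
pose M := rd (Psi (theta v v) z) z.
have M0 : 0 <= M by exact: pos_rd (pm_pos pP (theta_pos v)).
pose C := Num.sqrt (K * M).
have bound xi u : complex.Re `|dot (Psi (theta v u) xi) z| <= C * nm xi * nm u.
  apply: ler_of_sqr; first by rewrite !mulr_ge0 ?sqrtr_ge0.
  apply: le_trans (cp_dot_bound _ _ _ _) _.
  have h1 : rd (Psi (theta u u) xi) xi <= nm u ^+ 2 * (K * nm xi ^+ 2).
    have := pos_rd xi (pm_pos pP (theta_le u)); rewrite (pmB _ _ pP) (pmZ pP) bopB bopZ rdBl rdZl subr_ge0.
    move=> h; apply: le_trans h _; apply: ler_wpM2l; first exact: sqr_ge0.
    by have := pos_rd xi hK; rewrite bopB rdBl subr_ge0 bopZ bop1E rdZl rdE.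
  rewrite /C !exprMn sqr_sqrtr ?mulr_ge0 ?(ltW K0) //.
  apply: le_trans (ler_wpM2r M0 h1) _; rewrite le_eqVlt; apply/orP; left; apply/eqP.
  by rewrite /M; ring.
have ex xi : exists w, forall u, dot w u = dot (Psi (theta v u) xi) z.
  have [||w hw] := @riesz _ _ (fun u => Num.conj (dot (Psi (theta v u) xi) z)) (C * nm xi).
  - move=> c u1 u2; rewrite thetaDr (pmD pP) (pmZ pP) bopD bopZ dotDl dotZl.
    by rewrite rmorphD rmorphM /= conjCK.
  - by move=> u; rewrite norm_conjC; exact: bound.
  by exists w => u; rewrite dotC -hw conjCK.
have [f fP] := choice ex.
have [|xi|k kf] := @mk_bop _ _ f C.
- move=> c x1 x2; apply/eqP; rewrite -subr_eq0; apply/eqP/rd_eq0 => u.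
  by rewrite /rd dotBl dotDl dotZl !fP opD opZ dotDl dotZl subrr.
- apply: nm_le_rd; first by rewrite mulr_ge0 ?sqrtr_ge0.
  move=> u; apply: le_trans (bound xi u); rewrite /rd fP.
  exact: le_trans (ler_norm _) (Re_le_norm _).
by exists k => xi u; rewrite kf fP.
Qed.
End CompletelyPositive.

Section Coefficients.
Context {R : realType}.
Implicit Types (c d : nat -> R[i]) (P Q : {poly R[i]}).

(** The linear functional sending the n-th power of the variable to [c n]. Polynomials serve only as
    finitely supported coefficient sequences, the vector space on which Gram-Schmidt is run. *)
Definition lc c P : R[i] := \sum_(i < size P) P`_i * c i.
Lemma lcE N c P : (size P <= N)%N -> lc c P = \sum_(i < N) P`_i * c i.
Proof.
move=> h; rewrite /lc (big_ord_widen _ (fun i => P`_i * c i) h) big_mkcond /=.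
by apply: eq_bigr => i _; case: ltnP => // hi; rewrite nth_default ?mul0r.
Qed.
Lemma lc_linear (a : R[i]) c P Q : lc c (a *: P + Q) = a * lc c P + lc c Q.
Proof.
pose N := maxn (size P) (size Q).
have hP : (size P <= N)%N by exact: leq_maxl.
have hQ : (size Q <= N)%N by exact: leq_maxr.
have hPQ : (size (a *: P + Q)%R <= N)%N.
  have /leq_trans -> // : (size (a *: P + Q)%R <= maxn (size (a *: P)%R) (size Q))%N by exact: size_polyD.
  rewrite geq_max hQ andbT.
  exact: leq_trans (size_scale_leq _ _) hP.
rewrite (lcE c hP) (lcE c hQ) (lcE c hPQ) mulr_sumr -big_split /=.
by apply: eq_bigr => i _; rewrite coefD coefZ mulrDl mulrA.
Qed.
Lemma lcX c n : lc c 'X^n = c n.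
Proof.
rewrite /lc size_polyXn big_ord_recr /= big1 ?add0r => [|i _].
  by rewrite coefXn eqxx mul1r.
by rewrite coefXn ltn_eqF ?mul0r.
Qed.
End Coefficients.

Section Kraus.
Context {R : realType} {H : hilbertType R}.
Local Notation B := (bop H).
Implicit Types (u z xi : H) (x y : B) (P Q : {poly R[i]}).
Context {Psi : B -> B}.
Hypothesis cpPsi : completely_positive Psi.
Context {vv zz : nat -> H} {k : nat -> B}.
Hypothesis kE : forall n xi u, dot (k n xi) u = dot (Psi (theta (vv n) u) xi) (zz n).
Local Notation pP := (cp_pmap cpPsi).

Let G m n : R[i] := dot (k n (zz m)) (vv m).

Let Gherm m n : Num.conj (G m n) = G n m.
Proof.
by rewrite /G !kE -dotC dot_adjr -(cp_adj cpPsi) theta_adj.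
Qed.

(* In the Stinespring space of [Psi], the maps [W_n : u |-> theta u (vv n) (x) zz n]
   satisfy [<W_P u, W_Q u'> = <u, u'> kmx P Q] for the combinations [W_P] of the [W_n]
   with the coefficients of the polynomial [P]; [kop P] is the adjoint of [W_P]
   applied to [xi |-> 1 (x) xi]. *)
Definition kmx P Q : R[i] := lc (fun i => Num.conj (lc (fun j => Num.conj (G i j)) Q)) P.

Let kmxE N P Q : (size P <= N)%N -> (size Q <= N)%N ->
  kmx P Q = \sum_(i < N) \sum_(j < N) P`_i * (Num.conj Q`_j * G i j).
Proof.
move=> hP hQ; rewrite /kmx (lcE _ hP); apply: eq_bigr => i _.
rewrite (lcE _ hQ) rmorph_sum mulr_sumr; apply: eq_bigr => j _.
by rewrite rmorphM /= conjCK.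
Qed.

Lemma kmx_linear (c : R[i]) P P' Q : kmx (c *: P + P') Q = c * kmx P Q + kmx P' Q.
Proof. exact: lc_linear. Qed.
Lemma kmx_herm P Q : kmx Q P = Num.conj (kmx P Q).
Proof.
pose N := maxn (size P) (size Q).
have hP : (size P <= N)%N by exact: leq_maxl.
have hQ : (size Q <= N)%N by exact: leq_maxr.
rewrite (kmxE hP hQ) (kmxE hQ hP) rmorph_sum exchange_big /=; apply: eq_bigr => i _.
rewrite rmorph_sum; apply: eq_bigr => j _.
by rewrite !rmorphM /= conjCK Gherm mulrCA.
Qed.
Lemma kmx_ge0 P : 0 <= kmx P P.
Proof.
rewrite (kmxE (leqnn _) (leqnn _)) exchange_big /=.
have := cp_theta cpPsi (fun i : 'I_(size P) => vv i) (fun i => P`_i *: zz i).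
congr (_ <= _); apply: eq_bigr => i _; apply: eq_bigr => j _.
by rewrite /G kE opZ dotZl dotZr.
Qed.

Definition kop P : B := \sum_(n < size P) (Num.conj P`_n : R[i]) *: k n.

Lemma dot_kop N P xi u : (size P <= N)%N ->
  dot (kop P xi) u = \sum_(n < N) Num.conj P`_n * dot (k n xi) u.
Proof.
move=> h; rewrite /kop bop_sum dot_suml.
rewrite (big_ord_widen _ (fun n => dot (((Num.conj P`_n : R[i]) *: k n) xi) u) h) big_mkcond /=.
apply: eq_bigr => i _; case: ltnP => [_|hi]; first exact: dotZl.
by rewrite nth_default ?rmorph0 ?mul0r.
Qed.
Lemma kop_kmx P m : dot (kop P (zz m)) (vv m) = kmx 'X^m P.
Proof.
rewrite (dot_kop _ _ (leqnn _)) /kmx lcX /lc rmorph_sum; apply: eq_bigr => i _.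
by rewrite rmorphM /= conjCK.
Qed.

(** Since [theta v u * b] is [theta v (adj b u)], the bimodule property for [b] in the commutant
    becomes commutation of [k n] with [b]. *)
Lemma kop_mem (A : set B) P : von_neumann_algebra A -> bimodule_map (commutant A) Psi ->
  A (kop P).
Proof.
move=> vA bm; apply: vn_sum => // n _; apply: vnZ => //; apply: vn_bicomm => // b hb.
apply: bop_ext => xi; apply/eqP; rewrite -subr_eq0; apply/eqP/rd_eq0 => u.
have c1 : commutant A 1 by move=> y _; rewrite mul1r mulr1.
rewrite !bopM /rd dotBl dot_adj kE kE -theta_mul.
by have := bm 1 (theta (vv n) u) b c1 hb; rewrite !mul1r => ->; rewrite bopM subrr.
Qed.

(** Bessel's inequality in the Stinespring space, weighted by [x]: positivity at the vector
    [1 (x) xi] minus the sum of the [W_(f j) (K j xi)]. Each of the two cross terms is minus the sum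
    of the [d j], and by orthonormality the square of the subtracted vector is that sum. *)
Lemma kop_dominated J (f : nat -> {poly R[i]}) x :
  (forall i j, i <> j -> kmx (f i) (f j) = 0) ->
  (forall i, kmx (f i) (f i) = 1 \/ f i = 0) -> pos x ->
  pos (Psi x - \sum_(j < J) adj (kop (f j)) * x * kop (f j)).
Proof.
move=> f1 f2 px; apply/positive_opP => xi.
pose N := (\max_(j < J) size (f j))%N.
have hN (j : 'I_J) : (size (f j) <= N)%N by exact: (leq_bigmax (F := fun j : 'I_J => size (f j))).
pose K (j : 'I_J) : B := kop (f j).
pose d j := dot (x (K j xi)) (K j xi).
(* The left summand indexes [1 (x) xi], the right one the coefficients of the polynomials [f j]. *)
pose T := (unit + 'I_J * 'I_N)%type.
pose Y (a : T) : B := match a with inl _ => 1 | inr p => theta (K p.1 xi) (vv p.2) end.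
pose et (a : T) : H := match a with inl _ => xi | inr p => - ((f p.1)`_p.2 *: zz p.2) end.
have := cp_stinespring cpPsi Y et px.
have adjx := pos_sa px.
have dsym j : dot (K j xi) (x (K j xi)) = d j by rewrite dot_adjr adjx.
have kE' n u : dot (Psi (theta u (vv n)) (zz n)) xi = Num.conj (dot (k n xi) u).
  by rewrite kE -[RHS]dotC dot_adjr -(cp_adj cpPsi) theta_adj.
have E0 : dot (Psi (adj (Y (inl tt)) * x * Y (inl tt)) (et (inl tt))) (et (inl tt)) =
    dot (Psi x xi) xi by rewrite /= adj1 mul1r mulr1.
have E1 j : \sum_(n < N) dot (Psi (adj (Y (inl tt)) * x * Y (inr (j, n))) (et (inr (j, n)))) (et (inl tt)) = - d j.
  have -> : d j = Num.conj (dot (K j xi) (x (K j xi))) by rewrite -dotC.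
  rewrite (dot_kop _ _ (hN j)) rmorph_sum -sumrN.
  apply: eq_bigr => n _ /=.
  by rewrite adj1 mul1r mul_theta opN opZ dotNl dotZl kE' rmorphM /= conjCK.
have E2 j : \sum_(n < N) dot (Psi (adj (Y (inr (j, n))) * x * Y (inl tt)) (et (inl tt))) (et (inr (j, n))) = - d j.
  rewrite -dsym (dot_kop _ _ (hN j)) -sumrN; apply: eq_bigr => n _ /=.
  by rewrite mulr1 theta_adj theta_mul adjx dotNr dotZr kE.
have E3 i j : \sum_(m < N) \sum_(n < N)
    dot (Psi (adj (Y (inr (i, m))) * x * Y (inr (j, n))) (et (inr (j, n)))) (et (inr (i, m))) =
    dot (x (K j xi)) (K i xi) * kmx (f j) (f i).
  rewrite (kmxE (hN j) (hN i)) exchange_big mulr_sumr /=; apply: eq_bigr => n _.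
  rewrite mulr_sumr; apply: eq_bigr => m _.
  rewrite theta_adj theta_mul theta_theta adjx (pmZ pP) bopZ opN opZ dotZl dotNl dotNr dotZl dotZr opprK.
  by rewrite /G kE dot_adjr adjx; ring.
have E4 i : \sum_(j < J) dot (x (K j xi)) (K i xi) * kmx (f j) (f i) = d i.
  rewrite (bigD1 i) //= big1 ?addr0 => [|j ji].
    have [->|f0] := f2 i; first by rewrite mulr1.
    by rewrite /d /K /kop f0 size_poly0 big_ord0 bop0E dot0r mul0r.
  by rewrite f1 ?mulr0 // => e; move/eqP: ji; apply; exact: val_inj.
pose F a b := dot (Psi (adj (Y a) * x * Y b) (et b)) (et a).
have sT (g : T -> R[i]) : \sum_a g a = g (inl tt) + \sum_(j < J) \sum_(n < N) g (inr (j, n)).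
  rewrite big_sumType /= (big_pred1 tt) => [|[]] //; congr (_ + _).
  by rewrite pair_bigA; apply: eq_bigr => -[].
rewrite -/(F _ _) in E0; under eq_bigr do rewrite -/(F _ _).
have -> : \sum_a \sum_b F a b = dot (Psi x xi) xi - \sum_(j < J) d j.
  rewrite sT sT E0 (eq_bigr _ (fun j _ => E1 j)) sumrN.
  rewrite [X in _ + X]big1 ?addr0 // => i _.
  under eq_bigr do rewrite sT; rewrite big_split /= E2 exchange_big /=.
  by under eq_bigr do rewrite E3; rewrite E4 addNr.
rewrite bopB dotBl bop_sum dot_suml; congr (_ <= _ - _).
by apply: eq_bigr => j _; rewrite !bopM dot_adj adjK.
Qed.
End Kraus.

Section KrausDecomposition.
Context {R : realType} {H : hilbertType R}.
Local Notation B := (bop H).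
Implicit Types (u z xi : H) (x y : B) (A : set B).

Lemma Re_sum (I : Type) (s : seq I) (P : pred I) (F : I -> R[i]) :
  complex.Re (\sum_(i <- s | P i) F i) = \sum_(i <- s | P i) complex.Re (F i).
Proof. exact: (big_morph _ (@ReD R)). Qed.

(** The vectors [W_n] range over all pairs of a member of the orthonormal system and a member of the
    dense sequence; the [K j] come from orthonormalising them. Domination is [kop_dominated]. For
    exhaustion, the Gram-Schmidt expansion writes the form of [Psi (fproj v N)] at [zeta m] through
    the coefficients of the [K j (zeta m)], and normality of [Psi] lets [fproj v N] tend to 1. *)
Theorem kraus_decomposition A Psi : separable H -> von_neumann_algebra A ->
  CPs (commutant A) Psi -> exists K : nat -> B,
  [/\ forall j, A (K j),
      forall J x, pos x -> pos (Psi x - \sum_(j < J) adj (K j) * x * K j) &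
      forall u (e : R), 0 < e -> exists N, forall n, (N <= n)%N ->
        rd ((Psi 1 - \sum_(j < n) adj (K j) * K j) u) u <= e].
Proof.
move=> sH vA [[cpPsi nPsi] bm].
have [v [ov dv]] := fproj_dense sH; have [zeta dz] := dense_seq sH.
pose dec (n : nat) : nat * nat := odflt (0%N, 0%N) (@choice.unpickle (nat * nat)%type n).
pose vv n := v (dec n).1; pose zz n := zeta (dec n).2.
have [k kE] := choice (fun n => kraus_ex cpPsi (vv n) (zz n)).
have [f [f1 f2 f3]] := @gram_schmidt _ _ _ (kmx_linear (vv := vv) (zz := zz) (k := k))
  (kmx_herm cpPsi kE) (kmx_ge0 cpPsi kE) (fun n => 'X^n).
have pP := cp_pmap cpPsi.
pose K j := kop (k := k) (f j); exists K.
have dom J x : pos x -> pos (Psi x - \sum_(j < J) adj (K j) * x * K j).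
  exact: (kop_dominated cpPsi kE).
have dom1 J : pos (Psi 1 - \sum_(j < J) adj (K j) * K j).
  have := dom J _ (@pos1 R H); under eq_bigr do rewrite mulr1; exact.
split=> // [j|]; first exact: (kop_mem kE _ vA bm).
apply: (decr_dense (zeta := zeta)) => // [n|m e e0].
  rewrite opprB addrC addrA subrK big_ord_recr /= addrC addKr; exact: pos_sqr.
have pw : pfun (vec (zeta m) \o Psi) by apply: pfun_comp => //; exact: vec_pfun.
have nw : wnormal (vec (zeta m) \o Psi) by apply: wnormal_comp => //; exact: vec_wnormal.
have wc : weakstar_cvg ((fun n => 1 - fproj v n) @ \oo) 0.
  apply: weakstar_decr => // n; first exact/proj_pos/projC/fproj_proj.
  rewrite opprB addrC addrA subrK /fproj big_ord_recr /= addrC addKr; exact: theta_pos.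
have [N _ hN] := nw _ _ _ wc e e0.
have : `|(vec (zeta m) \o Psi) (1 - fproj v N) - (vec (zeta m) \o Psi) 0| <= e := hN N (leqnn N).
rewrite (pf0 pw) subr0 (pfB pw) => /(le_trans (ler_norm _)) {hN} hN.
pose nn (a : nat) := choice.pickle (a, m).
have decE a : dec (nn a) = (a, m) by rewrite /dec choice.pickleK.
(* Gram-Schmidt is triangular, so the first [J] vectors suffice to expand every [W_(nn a)] with
   [a < N]. *)
pose J := (\max_(a < N) nn a).+1; exists J.
rewrite bopB rdBl bop_sum.
suff h : vec (zeta m) (Psi (fproj v N)) <= rd (\sum_(j < J) (adj (K j) * K j) (zeta m)) (zeta m).
  by move: hN; rewrite /= /vec in h *; lra.
rewrite /fproj (pm_sum _ _ _ pP) (pf_sum (vec_pfun _)).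
have -> : rd (\sum_(j < J) (adj (K j) * K j) (zeta m)) (zeta m) = \sum_(j < J) nm (K j (zeta m)) ^+ 2.
  rewrite /rd dot_suml Re_sum; apply: eq_bigr => j _.
  by rewrite -rdE bopM /rd dot_adj adjK.
apply: (@le_trans _ _ (\sum_(a < N) \sum_(j < J) complex.Re `|dot (K j (zeta m)) (v a)| ^+ 2)); last first.
  by rewrite exchange_big; apply: ler_sum => j _; exact: bessel.
apply: ler_sum => a _.
have aJ : (nn a < J)%N by rewrite ltnS (leq_bigmax (F := fun a : 'I_N => nn a)).
have -> : vec (zeta m) (Psi (theta (v a) (v a))) = complex.Re (kmx (vv := vv) (zz := zz) (k := k) 'X^(nn a) 'X^(nn a)).
  by rewrite /kmx !lcX conjCK kE /vec /rd /vv /zz decE.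
rewrite f3 (big_ord_widen _ (fun j => kmx (vv := vv) (zz := zz) (k := k) 'X^(nn a) (f j) * kmx (vv := vv) (zz := zz) (k := k) (f j) 'X^(nn a)) aJ) big_mkcond Re_sum.
apply: ler_sum => j _.
case: ifP => _; last exact: sqr_ge0.
rewrite [X in _ * X](kmx_herm cpPsi kE)-kop_kmx.
have aux (t : R[i]) : complex.Re (t * Num.conj t) = complex.Re `|t| ^+ 2.
  by rewrite -normCK (norm_Re_real t) -rmorphXn.
by rewrite aux /vv /zz decE.
Qed.
End KrausDecomposition.

(** * Collecting weight through one completely positive map *)

Section Cut.
Context {R : realType} {H : hilbertType R}.
Local Notation B := (bop H).
Implicit Types (u z : H) (x y p : B).

(** Positivity of [t * y * t] for [t = d (1 - p) - p] bounds the off-diagonal corners of [y] by the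
    diagonal ones, weighted by [d]. *)
Lemma block_le (w : B -> R) p y (d : R) : pfun w -> proj p -> pos y ->
  d * w y <= (d + d ^+ 2) * w ((1 - p) * y * (1 - p)) + (d + 1) * w (p * y * p).
Proof.
move=> pw pp py; move qE : (1 - p) => q.
have qs : adj q = q by rewrite -qE; exact: (projC pp).2.
pose t := d%:C *: q - p.
have ts : adj t = t by rewrite /t adjB adjZ qs pp.2.
have := pf_ge0 pw (pos_conj t py); rewrite ts.
have -> : t * y * t = d%:C *: (d%:C *: (q * y * q)) - d%:C *: (p * y * q) - (d%:C *: (q * y * p) - p * y * p).
  by rewrite /t mulrBl mulrBr !mulrBl !bopZl !bopZr.
rewrite !(pfB pw) !(pfZ pw) => h.
have -> : w y = w (p * y * p) + w (p * y * q) + (w (q * y * p) + w (q * y * q)).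
  rewrite -!(pfD pw) -!mulrDr -!mulrDl; congr w.
  have -> : p + q = 1 by rewrite -qE addrC subrK.
  by rewrite mul1r mulr1.
by move: h; nra.
Qed.

(** If [1 - x] is small on the corner [p], then [w x] is almost at least [w p]: apply [block_le] to
    [1 - x], whose other corner is at most [1 - p]. *)
Lemma two_block (w : B -> R) p x (d : R) : pfun w -> proj p -> pos x -> pos (1 - x) -> 0 < d ->
  w p - d * w 1 - (1 + d^-1) * w (p * (1 - x) * p) <= w x.
Proof.
move=> pw pp px py d0; have := block_le d pw pp py.
have h1 : w ((1 - p) * (1 - x) * (1 - p)) <= w (1 - p).
  have [qq qs] := projC pp; apply: (pf_le pw).
  move: qq qs; move: (1 - p) => q qq qs.
  have -> : q - q * (1 - x) * q = q * x * q.
    by rewrite (mulrBr q) mulr1 mulrBl qq opprB addrCA subrr addr0.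
  by rewrite -{1}qs; exact: pos_conj.
have h2 : w (1 - p) <= w 1 by apply: (pf_le pw); rewrite opprB addrC subrK; exact: proj_pos.
have h0 : 0 <= w (p * (1 - x) * p).
  by apply: (pf_ge0 pw); rewrite -{1}pp.2; exact: pos_conj.
rewrite (pfB pw 1 x); move: h1; rewrite !(pfB pw 1 p) in h2 *.
move: h0; move: (w (p * (1 - x) * p)) (w ((1 - p) * (1 - x) * (1 - p))) => a b a0 hb h.
have di : d * d^-1 = 1 by rewrite mulfV // gt_eqF.
have h' : w 1 - w x <= (1 + d) * b + (1 + d^-1) * a.
  rewrite -(ler_pM2l d0); apply: le_trans h _.
  have -> : d * ((1 + d) * b + (1 + d^-1) * a) = (d + d ^+ 2) * b + (d + d * d^-1) * a by ring.
  by rewrite di.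
have h3 : (1 + d) * b <= (1 + d) * (w 1 - w p) by apply: ler_wpM2l => //; lra.
have h4 : 0 <= d * w p by apply: mulr_ge0; [exact: ltW | lra].
by move: h' h3 h4; move: (d^-1) => i; lra.
Qed.

Lemma compress_decr (w : B -> R) p (D : nat -> B) (e : R) : pfun w -> wnormal w -> proj p ->
  (forall n, pos (D n)) -> (forall n, pos (D n - D n.+1)) ->
  (forall u (e : R), 0 < e -> exists N, forall n, (N <= n)%N -> rd (D n u) u <= e) ->
  0 < e -> exists N, w (p * D N * p) <= e.
Proof.
move=> pw nw [pp ps] pD dD ex e0.
have wc : weakstar_cvg ((fun n => p * D n * p) @ \oo) 0.
  apply: weakstar_decr => [n|n|u d d0].
  - by rewrite -{1}ps; exact: pos_conj.
  - by rewrite -mulrBl -mulrBr -{1}ps; exact: pos_conj.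
  - have [N hN] := ex (p u) d d0; exists N => n /hN.
    by rewrite !bopM rd_adjr ps.
have [N _ hN] := nw _ _ _ wc _ e0; exists N.
by have := hN N (leqnn N); rewrite /= (pf0 pw) subr0; exact: le_trans (ler_norm _).
Qed.

Section KrausCut.
Context {A : set B} {tau : B -> R[i]}.
Hypotheses (vA : von_neumann_algebra A) (tA : tracial_state A tau).

Local Notation tr := (tr (tau := tau)).

(** Cut [h], the square of the absolute value of [k * p], at the level [c]. Above it, [range_proj]
    moves the spectral projection, taken under [p], to [a]; below it, at most [c * p] is lost. *)
Lemma cut_one k p (c : R) : A k -> A p -> proj p -> 0 < c ->
  exists a, [/\ A a, proj a, tr a <= tr p &
    pos (c%:C *: p - p * (adj k * k - adj k * a * k) * p)].
Proof.
move=> Ak Ap pp c0; have [ppp ps] := pp.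
pose z : B := k * p; pose h : B := adj z * z.
have Az : A z by exact: vnM.
have Ah : A h by apply: vnM => //; exact: vn_adj.
have hp : h * p = h by rewrite /h /z -!mulrA ppp.
have ph : p * h = h by rewrite /h /z adjM ps !mulrA ppp.
have ph0 : pos h by exact: pos_sqr.
pose g : B := h - c%:C *: (1 : B).
have gs : adj g = g by rewrite /g adjB adjZ adj1 (pos_sa ph0).
have [e [pe ec ge1 ge2]] := spectral_cut gs.
have pg : p * g = g * p by rewrite /g mulrBl mulrBr ph hp bopZl bopZr mul1r mulr1.
have Ag : A g by apply: vnB => //; apply: vnZ => //; exact: vn1.
have Ae : A e by apply: (vn_of_comm vA Ag).
have pec : p * e = e * p by exact: ec.
have he : h * e = e * h.
  apply: ec; rewrite /g mulrBl mulrBr; congr (_ - _).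
  by rewrite bopZl bopZr mul1r mulr1.
pose e' : B := e * p.
have pe' : proj e' by apply: proj_mul.
have Ae' : A e' by exact: vnM.
have he' : h * e' = e' * h.
  by rewrite /e' mulrA he -mulrA hp -mulrA ph.
have [|a [Aa pa ta ea _]] := range_proj vA tA Az Ae' pe' c0 (esym he').
  have := pos_conj p ge1; rewrite ps.
  suff -> : p * (g * e) * p = h * e' - c%:C *: e' by [].
  have pe'2 : p * e' = e' by rewrite /e' mulrA pec -mulrA ppp.
  by rewrite -(mulrA p) -(mulrA g) -/e' mulrA pg -mulrA pe'2 /g mulrBl bopZl mul1r.
exists a; split=> //.
  rewrite ta; apply: (tr_le vA tA Ae' Ap).
  suff -> : p - e' = p * (1 - e) by apply: proj_pos; apply: proj_mul => //; [exact: projC|rewrite mulrBr mulrBl mulr1 mul1r pec].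
  by rewrite mulrBr mulr1 pec.
have -> : p * (adj k * k - adj k * a * k) * p = h * (1 - e).
  rewrite mulrBr mulrBl.
  have -> : p * (adj k * k) * p = h by rewrite /h /z adjM ps !mulrA.
  have -> : p * (adj k * a * k) * p = adj z * a * z by rewrite /z adjM ps !mulrA.
  by rewrite ea -/h /e' mulrA he -mulrA hp mulrBr mulr1 he.
have -> : c%:C *: p - h * (1 - e) = c%:C *: (p * e * p) + p * (- (g * (1 - e))) * p.
  have pep : p * e * p = e * p by rewrite pec -mulrA ppp.
  move: ge2 => _; move qE : (1 - e) => q.
  have pq : p * q = q * p by rewrite -qE mulrBr mulrBl mulr1 mul1r pec.
  have hq : h * q = q * h by rewrite -qE mulrBr mulrBl mulr1 mul1r he.
  have -> : p * (- (g * q)) * p = c%:C *: (q * p) - h * q.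
    have e1 : p * (g * q) * p = g * (q * p) by rewrite mulrA pg -!mulrA (mulrA p) pq -(mulrA q) ppp.
    by rewrite mulrN mulNr e1 /g mulrBl bopZl mul1r (mulrA h) hq -(mulrA q) hp opprB.
  rewrite pep addrA -scalerDr -mulrDl; congr (_ *: _ - _).
  by rewrite -qE addrC subrK mul1r.
apply: posD; first by apply: posZ; [exact: ltW|rewrite -{1}ps; apply/pos_conj/proj_pos].
by rewrite -{1}ps; exact: pos_conj.
Qed.

(** Two losses are incurred: the tail of the Kraus series compressed to [p], and for each remaining
    operator the part below the level [c]. *)
Lemma kraus_cut Psi (w : B -> R) p (e : R) : separable H -> CPs (commutant A) Psi ->
  pfun w -> wnormal w -> A p -> proj p -> 0 < e -> exists (N : nat) (k a : nat -> B),
  [/\ forall m, [/\ A (k m), A (a m), proj (a m) & tr (a m) <= tr p],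
      forall x, pos x -> pos (Psi x - \sum_(m < N) adj (k m) * x * k m),
      pos (Psi 1 - \sum_(m < N) adj (k m) * a m * k m) &
      w (p * (Psi 1 - \sum_(m < N) adj (k m) * a m * k m) * p) <= e].
Proof.
move=> sH cP pw nw Ap pp e0; have [K [AK dom ex]] := kraus_decomposition sH vA cP.
have ps := pp.2.
pose D n := Psi 1 - \sum_(j < n) adj (K j) * K j.
have pD n : pos (D n).
  by have := dom n _ (@pos1 R H); under eq_bigr do rewrite mulr1; exact.
have dD n : pos (D n - D n.+1).
  rewrite /D opprB addrC addrA subrK big_ord_recr /= addrC addKr; exact: pos_sqr.
have e20 : 0 < e / 2 by rewrite divr_gt0.
have [N h1] := compress_decr pw nw pp pD dD ex e20.
have wp0 : 0 <= w p by exact: pf_ge0 (proj_pos pp).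
(* With this choice the [N] cuts lose at most [N * (c * w p) <= e / 2] together; the added ones keep
   [M] positive. *)
pose M := (N%:R + 1) * (w p + 1); have M0 : 0 < M.
  by rewrite mulr_gt0 // ltr_pwDr // ler0n.
pose c := e / 2 / M; have c0 : 0 < c by exact: divr_gt0.
have [a ha] := choice (fun j => cut_one (AK j) Ap pp c0).
exists N, K, a; split=> [m| | |]; [by have [Aa pa ta _] := ha m; split|exact: dom| |].
  rewrite -(subrK (\sum_(m < N) adj (K m) * 1 * K m) (Psi 1)) -addrA; apply: posD.
    exact: dom (@pos1 R H).
  rewrite -sumrB; apply: pos_sum => m _.
  rewrite -mulrBl -mulrBr; apply/pos_conj/proj_pos/projC; by have [] := ha m.
have -> : p * (Psi 1 - \sum_(m < N) adj (K m) * a m * K m) * p = p * D N * p +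
    \sum_(m < N) p * (adj (K m) * K m - adj (K m) * a m * K m) * p.
  rewrite -mulr_suml -mulr_sumr -mulrDl -mulrDr; congr (_ * _ * _).
  by rewrite sumrB /D addrA subrK.
rewrite (pfD pw) (pf_sum pw).
have h2 : \sum_(m < N) w (p * (adj (K m) * K m - adj (K m) * a m * K m) * p) <= \sum_(m < N) c * w p.
  by apply: ler_sum => m _; have [_ _ _ /(pf_le pw)] := ha m; rewrite (pfZ pw).
move: h2; rewrite sumr_const card_ord -mulr_natl => h2.
have h3 : N%:R * (c * w p) <= e / 2.
  have -> : e / 2 = c * M by rewrite divfK // gt_eqF.
  rewrite mulrCA; apply: ler_wpM2l; first exact: ltW.
  by rewrite /M; have := ler0n R N; nra.
by lra.
Qed.
End KrausCut.
End Cut.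

(** * LOCC protocols *)

Section Reach.
Context {R : realType} {H : hilbertType R}.
Local Notation B := (bop H).
Implicit Types (u z : H) (x y p : B) (w v : B -> R) (c e : R).

Lemma ex_share (n : nat) (e : R) : 0 < e -> exists2 q : R, 0 < q & n%:R * q <= e.
Proof.
move=> e0; have n0 : 0 < n%:R + 1 :> R by rewrite ltr_wpDl.
exists (e / (n%:R + 1)); first exact: divr_gt0.
by rewrite mulrCA; apply: ler_piMr; [exact: ltW|rewrite ler_pdivrMr // mul1r lerDl].
Qed.

Lemma pmap_conj (k : B) : pmap (fun x => adj k * x * k).
Proof.
split=> [x y|c x|x px]; last exact: pos_conj.
- by rewrite mulrDr mulrDl.
- by rewrite bopZr bopZl.
Qed.

Context {A : set B} {tau : B -> R[i]}.
Hypotheses (vA : von_neumann_algebra A) (tA : tracial_state A tau).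
Hypothesis sH : separable H.
Local Notation tr := (tr (tau := tau)).
Variable s : R.

(* [reach w c] certifies that the total weight [c] of [w] can be collected from
   projections of trace at most [s], with one projection for each member of a
   finite family of functionals whose sum is dominated by [w]. *)
Inductive reach : (B -> R) -> R -> Prop :=
| reach0 w : pfun w -> reach w 0
| reach1 w p : pfun w -> A p -> proj p -> tr p <= s -> reach w (w p)
| reachD w v c e : reach w c -> reach v e -> reach (fun x => w x + v x) (c + e)
| reach_le w v c e : reach w c -> pfun v -> wle w v -> e <= c -> reach v e.

Lemma reach_pfun w c : reach w c -> pfun w.
Proof. by elim=> // *; exact: pfunD. Qed.

Lemma reach_sum (I : eqType) (t : seq I) (P : pred I) (W : I -> B -> R) (C : I -> R) :
  (forall i, i \in t -> reach (W i) (C i)) ->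
  reach (fun x => \sum_(i <- t | P i) W i x) (\sum_(i <- t | P i) C i).
Proof.
elim: t => [|i t ih] h.
  rewrite big_nil (_ : (fun x => _) = fun=> 0); first by apply: reach0; exact: pfun0.
  by apply/funext => x; rewrite big_nil.
have h1 : reach (W i) (C i) by apply: h; rewrite inE eqxx.
have h2 : reach (fun x => \sum_(i <- t | P i) W i x) (\sum_(i <- t | P i) C i).
  by apply: ih => j jt; apply: h; rewrite inE jt orbT.
rewrite big_cons; have -> : (fun x => \sum_(j <- (i :: t) | P j) W j x) =
    (fun x => if P i then W i x + \sum_(j <- t | P j) W j x else \sum_(j <- t | P j) W j x).
  by apply/funext => x; rewrite big_cons.
by case: (P i) => //; exact: reachD.
Qed.

(** One [X] serves every [v]; the functional [w] measures how far [X] falls short of [Psi 1] on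
    [p]. *)
Lemma reach_cut Psi w p e : CPs (commutant A) Psi -> pfun w -> wnormal w ->
  A p -> proj p -> tr p <= s -> 0 < e -> exists X,
  [/\ A X, pos X, pos (Psi 1 - X), w (p * (Psi 1 - X) * p) <= e &
      forall v, pfun v -> reach (v \o Psi) (v X)].
Proof.
move=> cP pw nw Ap pp sp e0.
have [N [k [a [ha dom px hw]]]] := kraus_cut vA tA sH cP pw nw Ap pp e0.
exists (\sum_(m < N) adj (k m) * a m * k m); split=> // [||v pv].
- by apply: vn_sum => // m _; have [Ak Aa _ _] := ha m; apply: vnM => //; apply: vnM => //; exact: vn_adj.
- by apply: pos_sum => m _; apply/pos_conj/proj_pos; have [] := ha m.
rewrite (pf_sum pv).
have pP : pmap Psi by exact: cp_pmap cP.1.1.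
apply: (@reach_le (fun x => \sum_(m < N) v (adj (k m) * x * k m))) => //.
- apply: (@reach_sum _ _ predT (fun (m : 'I_N) x => v (adj (k m) * x * k m)) (fun m : 'I_N => v (adj (k m) * a m * k m))) => m _.
  have [Ak Aa pa ta] := ha m.
  apply: (@reach1 (v \o (fun x => adj (k m) * x * k m))) => //; last exact: le_trans ta sp.
  exact: pfun_comp (pmap_conj _).
- exact: pfun_comp.
- by move=> x /dom; move/(pf_le pv); rewrite (pf_sum pv).
Qed.

(** Finitely many branches account for the total, yet every branch has its own nonnegative
    certificate, since the next round acts on all of them. *)
Definition collects w (T : nat -> B -> B) c := exists (N : nat) (C : nat -> R),
  (forall i, 0 <= C i /\ reach (w \o T i) (C i)) /\ c <= \sum_(i < N) C i.

(** As a member of a certificate, [w] is not known to be normal, so the losses are measured with a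
    normal functional [w0] above it. *)
Lemma collects_proj w w0 p T e : pfun w -> pfun w0 -> wnormal w0 -> wle w w0 ->
  A p -> proj p -> tr p <= s -> one_way_instrument A T -> 0 < e -> collects w T (w p - e).
Proof.
move=> pw pw0 nw0 ww0 Ap pp sp [[Ts [nT sT [_ T1]]] lr] e0.
have ps := pp.2; have w10 : 0 <= w 1 := pf_ge0 pw (@pos1 R H).
(* Half of [e] pays for the term [d * w 1] of [two_block], the other half for the corner term, whose
   factor [1 + d^-1] dictates the tolerance [r]. *)
pose d := e / 2 / (w 1 + 1).
have d0 : 0 < d by rewrite !divr_gt0 // ltr_wpDl.
have dw : d * w 1 <= e / 2.
  rewrite /d mulrAC ler_pdivrMr ?ltr_wpDl //; apply: ler_wpM2l; last by rewrite lerDl.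
  by rewrite divr_ge0 // ltW.
pose i1 := 1 + d^-1; have i10 : 1 <= i1 by rewrite lerDl invr_ge0 ltW.
pose r := e / 2 / i1; have r0 : 0 < r by rewrite !divr_gt0 // (lt_le_trans ltr01).
have ir : i1 * r = e / 2 by rewrite mulrC divfK // gt_eqF // (lt_le_trans ltr01).
have r20 : 0 < r / 2 by rewrite divr_gt0.
have pT i : pos (T i 1) by apply: (pm_pos (NCP_pmap (nT i))); exact: pos1.
have [|pD dD hD] := weakstar_sum_nat (sT 1) pT; first by rewrite T1 adj1.
rewrite T1 in pD dD hD.
have [N hN] := compress_decr pw0 nw0 pp pD dD hD r20.
have [q q0 Nq] := ex_share N r20.
have c1 : commutant A 1 by move=> y _; rewrite mul1r mulr1.
case: lr => lr.
(* Right instruments: [Psi i 1] and [X i] lie in [A], which [Phi i] fixes pointwise. The losses of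
   the branches add up, and [two_block] is applied once, to the sum of the [X i]. *)
- have [Phi hPhi] := choice lr; have [Psi hP] := choice hPhi.
  have fx i x : A x -> Phi i x = x.
    have [[[_ bm] P1] _ _] := hP i => Ax.
    by have := bm x 1 1 Ax (vn1 vA); rewrite !mulr1 P1 mulr1.
  have AP i : A (Psi i 1).
    have [_ [_ bm] _] := hP i; apply: vn_bicomm => // b hb.
    have := bm b 1 1 hb c1; rewrite !mulr1 => <-.
    by have := bm 1 1 b c1 hb; rewrite !mul1r.
  have T1E i : T i 1 = Psi i 1 by have [_ _ ->] := hP i; exact: fx.
  have cP i : CPs (commutant A) (Psi i) by have [] := hP i.
  have [X hX] := choice (fun i => reach_cut (cP i) pw0 nw0 Ap pp sp q0).
  have pX i : pos (X i) by have [] := hX i.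
  have pPhi i : pmap (Phi i) by have [[[/NCP_pmap]]] := hP i.
  exists N, (fun i => w (X i)); split.
    move=> i; split; first exact: pf_ge0 (pX i).
    have [AX _ _ _ /(_ _ (pfun_comp pw (pPhi i)))] := hX i.
    by rewrite /= fx //; have [_ _ ->] := hP i.
  rewrite -(pf_sum pw).
  have e1 : 1 - \sum_(i < N) X i = (1 - \sum_(i < N) T i 1) + \sum_(i < N) (Psi i 1 - X i).
    by rewrite sumrB addrA; congr (_ - _); under eq_bigr do rewrite T1E; rewrite subrK.
  have pX1 : pos (1 - \sum_(i < N) X i).
    rewrite e1; apply: posD => //; apply: pos_sum => i _; by have [] := hX i.
  have pX0 : pos (\sum_(i < N) X i) by apply: pos_sum => i _.
  have := two_block pw pp pX0 pX1 d0.
  have h1 : w (p * (1 - \sum_(i < N) X i) * p) <= r.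
    apply: le_trans (ww0 _ _) _; first by rewrite -{1}ps; exact: pos_conj.
    rewrite e1 mulrDr mulrDl (pfD pw0) mulr_sumr mulr_suml (pf_sum pw0).
    have h2 : \sum_(i < N) w0 (p * (Psi i 1 - X i) * p) <= \sum_(i < N) q.
      by apply: ler_sum => i _; have [] := hX i.
    by move: h2; rewrite sumr_const card_ord -mulr_natl; lra.
  have h3 : i1 * w (p * (1 - \sum_(i < N) X i) * p) <= i1 * r.
    by apply: ler_wpM2l => //; exact: le_trans ler01 i10.
  by rewrite ir in h3; rewrite -/i1; move: h3 dw; lra.
(* Left instruments: [Psi i] is unital and [Phi i p = p * T i 1 * p]. Here [two_block] is applied in
   each branch to [w \o Phi i], and the corners are summed afterwards. *)
have [Phi hPhi] := choice lr; have [Psi hP] := choice hPhi.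
have P1 i : Psi i 1 = 1 by have [_ [_ h] _] := hP i.
have T1E i : T i 1 = Phi i 1 by have [_ _ ->] := hP i; rewrite /= P1.
have cP i : CPs (commutant A) (Psi i) by have [_ []] := hP i.
have pPhi i : pmap (Phi i) by have [[/NCP_pmap]] := hP i.
have nPhi i : wnormal (w0 \o Phi i) by have [[[_ h] _] _ _] := hP i; exact: wnormal_comp.
have [X hX] := choice (fun i => reach_cut (cP i) (pfun_comp pw0 (pPhi i)) (nPhi i) Ap pp sp q0).
have pX i : pos (X i) by have [] := hX i.
have Pp i : Phi i p = p * T i 1 * p.
  have [[_ bm] _ _] := hP i; have := bm p 1 p Ap Ap.
  by rewrite mulr1 pp.1 T1E.
exists N, (fun i => w (Phi i (X i))); split.
  move=> i; split; first by apply: (pf_ge0 pw); apply: (pm_pos (pPhi i)).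
  have [_ _ _ _ /(_ _ (pfun_comp pw (pPhi i)))] := hX i.
  by have [_ _ ->] := hP i.
have h1 (i : 'I_N) : w (p * T i 1 * p) - d * w (T i 1) - i1 * q <= w (Phi i (X i)).
  have pX1 : pos (1 - X i) by rewrite -(P1 i); have [] := hX i.
  have := two_block (pfun_comp pw (pPhi i)) pp (pX i) pX1 d0.
  rewrite /= Pp -T1E -/i1.
  have h2 : w (Phi i (p * (1 - X i) * p)) <= q.
    apply: le_trans (ww0 _ _) _.
      by apply: (pm_pos (pPhi i)); rewrite -{1}ps; exact: pos_conj.
    by have [_ _ _] := hX i; rewrite P1.
  have h3 : i1 * w (Phi i (p * (1 - X i) * p)) <= i1 * q.
    by apply: ler_wpM2l => //; exact: le_trans ler01 i10.
  by move: h3; lra.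
apply: (@le_trans _ _ (\sum_(i < N) (w (p * T i 1 * p) - d * w (T i 1) - i1 * q))); last exact: ler_sum.
rewrite !sumrB -mulr_sumr sumr_const card_ord -mulr_natl -!(pf_sum pw) -mulr_suml -mulr_sumr.
have h4 : w (\sum_(i < N) T i 1) <= w 1 by exact: pf_le (pD N).
have h5 : w (p * (1 - \sum_(i < N) T i 1) * p) <= r / 2.
  by apply: le_trans (ww0 _ _) hN; rewrite -{1}ps; exact: pos_conj.
rewrite mulrBr mulr1 mulrBl pp.1 (pfB pw) in h5.
have h6 : i1 * (N%:R * q) <= i1 * (r / 2).
  by apply: ler_wpM2l => //; exact: le_trans ler01 i10.
have h7 : r <= e / 2 by rewrite -ir ler_peMl // ltW.
have h8 : d * w (\sum_(i < N) T i 1) <= d * w 1 by apply: ler_wpM2l => //; exact: ltW.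
rewrite mulrCA [i1 * (r / 2)]mulrA ir in h6.
by move: h5 h6 h7 h8 dw; lra.
Qed.

Lemma ler_sum_widen (N M : nat) (C : nat -> R) : (N <= M)%N -> (forall i, 0 <= C i) ->
  \sum_(i < N) C i <= \sum_(i < M) C i.
Proof.
move=> NM C0; rewrite (big_ord_widen _ C NM) big_mkcond /=.
by apply: ler_sum => i _; case: ifP.
Qed.

(** Induction on the certificate: each of its projections passes through the instrument separately,
    and all its members stay below the same normal [w0]. *)
Lemma collects_step w c : reach w c -> forall w0 T e, pfun w0 -> wnormal w0 -> wle w w0 ->
  one_way_instrument A T -> 0 < e -> collects w T (c - e).
Proof.
elim=> {w c} [w pw|w p pw Ap pp sp|w v c b rw ihw rv ihv|w v c b rw ihw pv wv bc] w0 T e pw0 nw0 ww0 oT e0.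
- have pT i : pmap (T i) by case: oT => -[Ts [/(_ i)/NCP_pmap]].
  exists 0%N, (fun=> 0); split; last by rewrite big_ord0 sub0r oppr_le0 ltW.
  by move=> i; split=> //; apply: reach0; exact: pfun_comp.
- exact: (collects_proj pw pw0).
- have e20 : 0 < e / 2 by rewrite divr_gt0.
  have [pw pv] := (reach_pfun rw, reach_pfun rv).
  have [|N1 [C1 [h1 s1]]] := ihw _ _ _ pw0 nw0 _ oT e20.
    by move=> x px; apply: le_trans (ww0 x px); rewrite lerDl; exact: pf_ge0.
  have [|N2 [C2 [h2 s2]]] := ihv _ _ _ pw0 nw0 _ oT e20.
    by move=> x px; apply: le_trans (ww0 x px); rewrite lerDr; exact: pf_ge0.
  exists (maxn N1 N2), (fun i => C1 i + C2 i); split.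
    move=> i; have [p1 r1] := h1 i; have [p2 r2] := h2 i; split; first exact: addr_ge0.
    exact: reachD r1 r2.
  rewrite big_split /=.
  have := ler_sum_widen (leq_maxl N1 N2) (fun i => (h1 i).1).
  have := ler_sum_widen (leq_maxr N1 N2) (fun i => (h2 i).1).
  by move: s1 s2; lra.
- have pT i : pmap (T i) by case: oT => -[Ts [/(_ i)/NCP_pmap]].
  have [|N [C [h sC]]] := ihw _ _ _ pw0 nw0 _ oT e0.
    by move=> x px; exact: le_trans (wv x px) (ww0 x px).
  exists N, C; split; last by move: sC; lra.
  move=> i; have [C0 rC] := h i; split=> //.
  apply: (reach_le rC) => //; first exact: pfun_comp.
  by move=> x px; apply: wv; exact: pm_pos.
Qed.

(** Finitely many branches of [T], followed by finitely many of each [T' k], still collect all but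
    [e]. Each block of the coarse-graining dominates the finite sum of its selected branches, so it
    inherits the sum of their certificates. *)
Lemma collects_linked w T J c : pfun w -> wnormal w -> (forall k, NCP (T k)) -> linked A T J ->
  (forall e, 0 < e -> collects w T (c - e)) -> forall e, 0 < e -> collects w J (c - e).
Proof.
move=> pw nw nT [T' [oT' [[Ts [nTT _ _]] [Js [nJ _ _]] [S [_ covS sumS]]]]] hT e e0.
have e20 : 0 < e / 2 by rewrite divr_gt0.
have [N [C [hC sC]]] := hT _ e20.
have [q q0 Nq] := ex_share N e20.
have st k : collects (w \o T k) (T' k) (C k - q).
  apply: (collects_step (hC k).2 _ _ _ (oT' k) q0) => [||x px] //.
    exact: pfun_comp (NCP_pmap (nT k)).
  exact: wnormal_comp (nT k).2.
have [NN hNN] := choice st; have [D hD] := choice hNN.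
have D0 k i : 0 <= D k i by have [/(_ i)[]] := hD k.
pose t := [seq (k, i) | k <- iota 0 N, i <- iota 0 (NN k)].
have ut : uniq t.
  apply: allpairs_uniq_dep => [|k _|]; rewrite ?iota_uniq //.
  by move=> [k1 i1] [k2 i2] _ _ /= [-> ->].
have sD : c - e <= \sum_(ki <- t) D ki.1 ki.2.
  rewrite big_allpairs_dep /=.
  have -> : \sum_(k <- iota 0 N) \sum_(i <- iota 0 (NN k)) D k i = \sum_(k < N) \sum_(i < NN k) D k i.
    rewrite -[RHS](big_mkord predT (fun k => \sum_(i < NN k) D k i)) /index_iota subn0.
    by apply: eq_bigr => k _; rewrite -[RHS](big_mkord predT (D k)) /index_iota subn0.
  have : \sum_(k < N) (C k - q) <= \sum_(k < N) \sum_(i < NN k) D k i.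
    by apply: ler_sum => k _; have [_] := hD k.
  by rewrite sumrB sumr_const card_ord -mulr_natl; move: sC Nq; lra.
have ex ki : exists j, S j ki.
  by have : (\bigcup_j S j) ki by [rewrite covS]; case=> j _ Sj; exists j.
have [jj hjj] := choice ex.
exists (\max_(ki <- t) jj ki).+1, (fun j => \sum_(ki <- t | ki \in S j) D ki.1 ki.2); split.
  move=> j; split; first by apply: sumr_ge0.
  apply: (reach_le (w := fun x => \sum_(ki <- t | ki \in S j) w (T ki.1 (T' ki.1 ki.2 x)))) => //.
  - apply: (@reach_sum _ t (fun ki => ki \in S j) (fun ki x => w (T ki.1 (T' ki.1 ki.2 x))) (fun ki => D ki.1 ki.2)) => ki _.
    by have [/(_ ki.2)[]] := hD ki.1.
  - exact: pfun_comp (NCP_pmap (nJ j)).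
  - move=> x px; have := weakstar_sum_ge pw nw (sumS j x) _ ut; rewrite (pf_sum pw); apply.
    by move=> ki _; apply: (pm_pos (NCP_pmap (nTT ki))).
apply: le_trans sD _; rewrite (exchange_big_dep predT) //=.
rewrite big_seq [leRHS]big_seq; apply: ler_sum => ki kt.
have jM : (jj ki < (\max_(ki <- t) jj ki).+1)%N by rewrite ltnS; apply: leq_bigmax_seq.
rewrite (bigD1 (Ordinal jM)) /=; last exact/mem_set.
by rewrite lerDl; apply: sumr_ge0.
Qed.

Lemma reach_total w T Th c : pfun w -> wnormal w -> instrument_sum T Th ->
  collects w T c -> reach (w \o Th) c.
Proof.
move=> pw nw [nT sT [nTh _]] [N [C [hC sC]]].
have r : reach (fun x => \sum_(k < N) w (T k x)) (\sum_(k < N) C k).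
  apply: (@reach_sum _ _ predT (fun (k : 'I_N) x => w (T k x)) (fun k : 'I_N => C k)) => k _.
  by have [] := hC k.
apply: (reach_le r) => //; first exact: pfun_comp (NCP_pmap nTh).
move=> x px; have := weakstar_sum_ge pw nw (sT x) _ (iota_uniq 0 N).
rewrite (pf_sum pw) => h; rewrite -(big_mkord predT (fun k => w (T k x))) /index_iota subn0.
rewrite (eq_bigl (fun k => k \in setT)) => [|k]; last by rewrite in_setT.
by apply: h => k _; exact: pm_pos (NCP_pmap (nT k)) _ px.
Qed.

(** The induction over rounds asserts the bound for all losses at once, so that each round can ask
    the previous one for a smaller loss. *)
Lemma locc_reach w p Th e : LOCC A Th -> pfun w -> wnormal w -> A p -> proj p -> tr p <= s ->
  0 < e -> reach (w \o Th) (w p - e).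
Proof.
move=> [n [T [oT lT sT]]] pw nw Ap pp sp e0.
suff h m : (m <= n)%N -> (forall k, NCP (T m k)) /\ (forall e, 0 < e -> collects w (T m) (w p - e)).
  exact: reach_total sT ((h n (leqnn n)).2 e e0).
elim: m => [_|m ih mn].
  split; first by have [[Ts []]] := oT.
  by move=> b b0; apply: (collects_proj pw pw).
have [nT hT] := ih (ltnW mn); have lm := lT m mn; split; last exact: (collects_linked pw nw nT lm hT).
by have [T' [_ [_ [Js []]]]] := lm.
Qed.
End Reach.

(** * Weight that can be collected near a pure state *)

Section Bound.
Context {R : realType} {H : hilbertType R}.
Local Notation B := (bop H).
Context {A : set B} {tau : B -> R[i]}.
Local Notation tr := (tr (tau := tau)).

(** For a single projection [p] this is [block_le] relative to the rank one projection [e] on [phi],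
    where [e * p * e] is [<p phi, phi> e]. The right-hand side is additive and monotone in [w], so
    the bound passes to every certificate. *)
Lemma reach_bound (s : R) (phi : H) (K : R) w c : nm phi = 1 -> 0 <= K ->
  (forall a, A a -> proj a -> tr a <= s -> rd (a phi) phi <= K) ->
  reach (A := A) (tau := tau) s w c -> forall d : R, 0 < d ->
  d * c <= (d + d ^+ 2) * (K * w (theta phi phi)) + (d + 1) * w (1 - theta phi phi).
Proof.
move=> n1 K0 hK rw d d0; move eE : (theta phi phi) => e.
have pe : proj e.
  split; last by rewrite -eE theta_adj.
  by rewrite -eE theta_theta dotE n1 expr1n scale1r.
have e1 : pos (1 - e) := proj_pos (projC pe).
have dd : 0 <= d + d ^+ 2 by rewrite addr_ge0 ?sqr_ge0 // ltW.
have d1 : 0 <= d + 1 by rewrite addr_ge0 // ltW.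
elim: rw => {w c} [w pw|w p pw Ap pp sp|w v c b rw ihw rv ihv|w v c b rw ihw pv wv bc].
- rewrite mulr0; apply: addr_ge0; apply: mulr_ge0 => //; last exact: pf_ge0 e1.
  by apply: mulr_ge0 => //; apply: (pf_ge0 pw); exact: proj_pos.
- apply: le_trans (block_le d pw (projC pe) (proj_pos pp)) _.
  rewrite opprB addrCA subrr addr0; apply: lerD; apply: ler_wpM2l => //.
    have -> : e * p * e = (rd (p phi) phi)%:C *: e.
      rewrite -eE -mulrA mul_theta theta_theta; congr (_ *: _).
      apply: complex_ext => //=; apply: ger0_Im.
      exact: (positive_opP _).2 (proj_pos pp) phi.
    by rewrite (pfZ pw); apply: ler_wpM2r; [apply: (pf_ge0 pw); exact: proj_pos|exact: hK].
  have [qq qs] := projC pe; apply: (pf_le pw).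
  have := pos_conj (1 - e) (proj_pos (projC pp)); rewrite qs.
  by rewrite (mulrBr (1 - e) 1 p) mulr1 (mulrBl (1 - e)) qq.
- by rewrite !mulrDr; move: ihw ihv; lra.
- apply: (@le_trans _ _ (d * c)); first by apply: ler_wpM2l => //; exact: ltW.
  apply: le_trans ihw _; apply: lerD; apply: ler_wpM2l => //; last exact: wv.
  by apply: ler_wpM2l => //; apply: wv; exact: proj_pos.
Qed.
End Bound.

Theorem proposition6p7 (R : realType) (H : hilbertType R)
    (A : set (bop H)) (tau : bop H -> R[i]) :
  separable H -> II1_factor A -> tracial_state A tau ->
  forall (psi phi : H) (rho_psi rho_phi : pop (H := H)),
    `|psi| = 1 -> `|phi| = 1 ->
    density A tau (vector_state psi) rho_psi ->
    density A tau (vector_state phi) rho_phi ->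
    approx_convertible A psi phi ->
    (entropy A tau rho_phi <= entropy A tau rho_psi)%E.
Proof.
move=> sH [vA _ _ _] tA psi phi rho_psi rho_phi n1 n2 dpsi dphi cv.
have npsi : nm psi = 1 by rewrite /nm n1.
have nphi : nm phi = 1 by rewrite /nm n2.
apply: (entropy_le_of_proj vA tA npsi nphi dpsi dphi) => p K Ap pp K0 hK.
set w := vec psi; have pw : pfun w := vec_pfun psi.
have pe : pos (theta phi phi) := theta_pos phi.
(* The output functional of [Th] gives weight at most [e] to [1 - theta phi phi], so [reach_bound]
   caps the collected weight at little more than [K]. *)
have key (d e : R) : 0 < d -> 0 < e ->
    d * (rd (p psi) psi - e) <= (d + d ^+ 2) * K + (d + 1) * e.
  move=> d0 e0; have [Th lTh hn] := cv e e0.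
  have nTh : NUCP Th by case: lTh => n [T [_ _ []]].
  have pTh := NCP_pmap nTh.1.
  have r := locc_reach vA tA sH lTh pw (vec_wnormal psi) Ap pp (lexx _) e0.
  have := reach_bound nphi K0 hK r d0; rewrite /= => h; apply: le_trans h _.
  have pc : pos (1 - theta phi phi) by have := theta_le phi; rewrite nphi expr1n scale1r.
  apply: lerD; apply: ler_wpM2l; rewrite ?addr_ge0 ?sqr_ge0 ?(ltW d0) //.
    apply: ler_piMr => //.
    have -> : 1 = w (Th 1) by rewrite nTh.2 /w /vec bop1E rdE npsi expr1n.
    by rewrite -subr_ge0 -(pfB pw) -(pmB _ _ pTh); apply: (pf_ge0 pw); exact: (pm_pos pTh).
  have q0 : dot ((1 - theta phi phi) phi) phi = 0.
    by rewrite bopB bop1E thetaE dotE nphi expr1n scale1r subrr dot0l.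
  have qP : proj (1 - theta phi phi).
    apply: projC; split; last exact: theta_adj.
    by rewrite theta_theta dotE nphi expr1n scale1r.
  (* The projection [1 - theta phi phi] has norm at most 1 and value 0 in the state of [phi], so the
     norm distance bounds its value in the output state. *)
  rewrite -lee_fin; apply: le_trans (ltW hn).
  apply: (@le_trans _ _ (complex.Re `|vector_state psi (Th (1 - theta phi phi)) - vector_state phi (1 - theta phi phi)|)%:E).
    rewrite lee_fin [vector_state phi _]q0 subr0; exact: le_trans (ler_norm _) (Re_le_norm _).
  apply: ereal_sup_ubound; exists (1 - theta phi phi) => //= u.
  rewrite !norm_nm lecR; apply: ler_of_sqr => //.
  rewrite -(proj_rd u qP) -(rdE u) -subr_ge0 -rdBl.
  by have := pos_rd u (proj_pos (projC qP)); rewrite (bopB 1) bop1E.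
apply/ler_addgt0Pr => t t0.
(* Dividing [key] by [d] leaves the errors [d * K] and [(2 * d + 1) * e / d]; each is made at most
   [t / 2], with [d] chosen before [e]. *)
pose d := t / 2 / (K + 1).
have d0 : 0 < d by rewrite !divr_gt0 // ltr_wpDl.
have dK : d * K <= t / 2.
  rewrite /d mulrAC ler_pdivrMr ?ltr_wpDl //; apply: ler_wpM2l; last by rewrite lerDl.
  by rewrite divr_ge0 // ltW.
pose e := d * t / 2 / (2 * d + 1).
have dp : 0 < 2 * d + 1 by rewrite ltr_wpDl // mulr_ge0 // ltW.
have e0 : 0 < e by rewrite !divr_gt0 // mulr_gt0.
have ee : (2 * d + 1) * e = d * t / 2 by rewrite mulrC divfK // gt_eqF.
have h := key d e d0 e0; rewrite -(ler_pM2l d0).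
have h2 : d * (d * K) <= d * (t / 2) by apply: ler_wpM2l => //; exact: ltW.
by move: h h2 ee; move: (rd (p psi) psi) => C; lra.
Qed.
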